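(* Let $(S_t,t\ge0)$ be a drift-free subordinator whose Lévy measure $\nu$ has a continuous density on $]0,\infty[$ and satisfies conditions (L) and (R) stated in the context. Let $K_n$ be the number of parts of the regenerative composition $\mathcal C_n$ derived from $(S_t)$, and let $m_j=\int_0^\infty y^j\,\nu(\mathrm{d}y)$. Then the distribution of the random variable $$\frac{K_n-\log^2 n/(2m_1)}{\sqrt{m_2/(3m_1^3)}\;\log^{3/2}n}$$ converges weakly to the standard normal distribution as $n\to\infty$.
   Context: Notation: $\log^a x=(\log x)^a$. Let $\tilde\nu$ be the measure on $[0,1]$ that is the image of $\nu$ under $y\mapsto 1-e^{-y}$. The Laplace exponent of the subordinator is $$\Phi(s)=\int_0^\infty(1-e^{-sy})\,\nu(\mathrm{d}y)=\int_0^1\bigl(1-(1-x)^s\bigr)\,\tilde\nu(\mathrm{d}x),$$ and its Poisson transform is $$\widehat\Phi(s)=\int_0^1(1-e^{-sx})\,\tilde\nu(\mathrm{d}x).$$ Condition (L): for some constants $c$ and $\epsilon>0$, with $\gamma=-\Gamma'(1)$ Euler's constant, any one of the following four conditions (stated by the authors to be equivalent) holds: (1) $\Phi(\rho)=\log\rho+c+O(\rho^{-\epsilon})$ as $\rho\to\infty$; (2) $\widehat\Phi(\rho)=\log\rho+c+O(\rho^{-\epsilon})$ as $\rho\to\infty$; (3) $\nu[y,\infty]=-\log y+c-\gamma+O(y^{\epsilon})$ as $y\downarrow0$; (4) $\tilde\nu[x,1]=-\log x+c-\gamma+O(x^{\epsilon})$ as $x\downarrow0$. Condition (R): for some $\epsilon>0$,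 either of the following two equivalent conditions holds: $\nu[y,\infty]=O(e^{-\epsilon y})$ as $y\uparrow\infty$; or $\tilde\nu[x,1]=O((1-x)^{\epsilon})$ as $x\uparrow1$. Construction of the composition: let $\widetilde S_t=1-\exp(-S_t)$, and let $\widetilde{\mathcal R}\subset[0,1]$ be the closed range of $(\widetilde S_t,t\ge0)$. The gaps of $\widetilde{\mathcal R}$ are the open interval components of $[0,1]\setminus\widetilde{\mathcal R}$. Let $u_1,\dots,u_n$ be i.i.d. uniform on $[0,1]$, independent of $\widetilde{\mathcal R}$. Two sample points are in the same block iff they fall in the same gap of $\widetilde{\mathcal R}$. The composition $\mathcal C_n$ of $n$ is the sequence of sizes of the nonempty blocks, ordered from left to right. Thus $K_n$ is the number of gaps containing at least one of the $n$ sample points. *)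

(* Defs.v *)
From HB Require Import structures.
From mathcomp Require Import all_boot all_order all_algebra finmap.
From mathcomp Require Import all_classical all_reals all_analysis.

Set Implicit Arguments.
Unset Strict Implicit.
Unset Printing Implicit Defensive.

Import Order.TTheory GRing.Theory Num.Theory.
Import numFieldNormedType.Exports.

Local Open Scope classical_set_scope.
Local Open Scope ring_scope.

Section probability_notions.
Context {R : realType} {d : measure_display} {T : measurableType d}.
Variable P : probability T R.

Definition independent2 (F G : set (set T)) : Prop :=
  forall A B, F A -> G B -> (P (A `&` B) = P A * P B)%E.

Definition mutually_independent {I : finType} (F : I -> set (set T)) : Prop :=
  forall (J : {set I}) (A : I -> set T), (forall i, i \in J -> F i (A i)) ->
    P (\bigcap_(i in [set` J]) A i) = (\prod_(i in J) P (A i))%E.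

Definition iid_uniform {I : finType} (u : I -> {RV P >-> R}) : Prop :=
  (forall i B, measurable B ->
     distribution P (u i) B = uniform_prob (@ltr01 R) B) /\
  mutually_independent (fun i => g_sigma_algebra_preimage (u i)).

Definition family_sigma_algebra {I : finType} (u : I -> {RV P >-> R}) :
  set (set T) := <<s \bigcup_i g_sigma_algebra_preimage (u i) >>.

(* A random closed set is observed through the open sets that it hits. *)
Definition random_set_sigma_algebra (X : T -> set R) : set (set T) :=
  <<s [set [set w | X w `&` O !=set0] | O in open] >>.

End probability_notions.

(* R and measurableTypeR R carry the same Borel sets; the library states laws of
   real random variables over the former and the normal law over the latter. *)
Definition weakly_converges {R : realType} (mu_ : nat -> probability R R)
    (mu : probability (measurableTypeR R) R) : Prop :=
  forall f : R -> R, continuous f -> (exists M : R, forall x, `|f x| <= M) ->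
    \int[mu_ n]_x f x @[n --> \oo] --> \int[mu]_x f x.

Section levy_measure.
Context {R : realType}.
Implicit Types (nu : {measure set R -> \bar R}) (s x y : R) (j : nat).

(* A measure on ]0, +oo[ is encoded as a measure on R that does not charge
   ]-oo, 0]. There is no mass at +oo: such an atom is the killing rate, and it
   must vanish when the tail tends to 0. *)
Definition is_levy_measure nu : Prop :=
  nu `]-oo, 0]%classic = 0%E /\
  (\int[nu]_(y in `]0%R, +oo[) (Num.min 1 y)%:E < +oo)%E.

Definition has_continuous_density nu : Prop :=
  exists f : R -> R,
    [/\ {in `]0, +oo[, continuous f},
        {in `]0, +oo[, forall y, 0 <= f y} &
        forall A : set R, measurable A -> A `<=` `]0, +oo[ ->
          nu A = (\int[lebesgue_measure]_(y in A) (f y)%:E)%E].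

Definition exp_squash y : R := 1 - expR (- y).

Definition nu_tilde nu : set R -> \bar R := pushforward nu exp_squash.

Definition laplace_exponent nu s : R :=
  \int[nu]_(y in `]0, +oo[) (1 - expR (- (s * y))).

Definition poisson_transform nu s : R :=
  fine (\int[nu_tilde nu]_(x in `[0%R, 1%R]) (1 - expR (- (s * x)))%:E)%E.

Definition moment nu j : R := \int[nu]_(y in `]0, +oo[) y ^+ j.

Definition nu_tail nu y : R := fine (nu `[y, +oo[%classic).

Definition nu_tilde_tail nu x : R := fine (nu_tilde nu `[x, 1]%classic).

Definition Gamma s : R :=
  \int[lebesgue_measure]_(x in `]0, +oo[) (x `^ (s - 1) * expR (- x)).

Definition euler_gamma : R := - (Gamma^`())%classic 1.

(* The filter of the neighborhoods of +oo, packaged for the Landau notations. *)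
Definition at_infinity : filter_on R := FilterType (pinfty_nbhs R) _.

Definition condition_L nu : Prop :=
  exists c eps : R, 0 < eps /\
    [\/ laplace_exponent nu =
          (fun rho => ln rho + c) +O_at_infinity (fun rho => rho `^ (- eps)),
        poisson_transform nu =
          (fun rho => ln rho + c) +O_at_infinity (fun rho => rho `^ (- eps)),
        nu_tail nu =
          (fun y => - ln y + c - euler_gamma) +O_ (0^'+) (fun y => y `^ eps) |
        nu_tilde_tail nu =
          (fun x => - ln x + c - euler_gamma) +O_ (0^'+) (fun x => x `^ eps)].

Definition condition_R nu : Prop :=
  exists eps : R, 0 < eps /\
    (nu_tail nu =O_at_infinity (fun y => expR (- (eps * y))) \/
     nu_tilde_tail nu =O_ (1^'-) (fun x => (1 - x) `^ eps)).

End levy_measure.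

Section subordinator.
Context {R : realType} {d : measure_display} {T : measurableType d}.
Variable P : probability T R.

(* Only the times t >= 0 are meaningful; left limits exist by monotonicity. *)
Record is_subordinator (S : R -> {RV P >-> R}) : Prop := IsSubordinator {
  sub_start : forall w, S 0 w = 0 ;
  sub_nondecreasing : forall w (s t : R), 0 <= s -> s <= t -> S s w <= S t w ;
  sub_right_continuous : forall w (t : R), 0 <= t -> S s w @[s --> t^'+] --> S t w ;
  sub_stationary : forall t h : R, 0 <= t -> 0 <= h ->
    forall B : set R, measurable B ->
      P [set w | B (S (t + h) w - S t w)] = P [set w | B (S h w)] ;
  sub_independent : forall (k : nat) (t : nat -> R),
    0 <= t 0%N -> (forall i : nat, t i <= t i.+1) ->
    mutually_independent P (fun i : 'I_k =>
      g_sigma_algebra_preimage (fun w => S (t i.+1) w - S (t i) w)) }.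

(* The Levy-Khintchine formula without linear term and without killing. *)
Definition driftfree_with_levy_measure (S : R -> {RV P >-> R})
    (nu : {measure set R -> \bar R}) : Prop :=
  is_levy_measure nu /\
  forall t s : R, 0 <= t -> 0 <= s ->
    'E_P[(fun w => expR (- (s * S t w)))]%E =
    (expR (- (t * laplace_exponent nu s)))%:E.

Definition closed_range (S : R -> T -> R) (w : T) : set R :=
  closure [set 1 - expR (- S t w) | t in `[0, +oo[].

End subordinator.

Section composition.
Context {R : realType}.
Implicit Type C : set R.

Definition gaps C : set (set R) :=
  [set connected_component (`[0, 1] `\` C) x | x in `[0, 1] `\` C].

Definition occupied_gaps C n (u : 'I_n -> R) : set (set R) :=
  [set G | gaps C G /\ exists i, G (u i)].

(* Gaps are disjoint intervals, so comparing their left endpoints orders them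
   from left to right. *)
Definition composition C n (u : 'I_n -> R) : seq nat :=
  [seq #|[pred i | `[< G (u i) >]]|
     | G <- sort (fun G H : set R => inf G <= inf H)
                 (fset_set (occupied_gaps C u))].

Definition number_of_parts C n (u : 'I_n -> R) : nat := size (composition C u).

End composition.

(* Main.v *)
Require Import Defs.
From mathcomp Require Import all_boot all_order all_algebra finmap.
From mathcomp Require Import all_classical all_reals all_analysis.
From mathcomp Require Import measurable_realfun.
From mathcomp Require Import ring lra.

(* By independence the sample may be drawn on a second copy of the probability
   space. Cut the range at the times k h. Given S, the number of cells
   [S~_kh, S~_(k+1)h) hit by the sample has mean sum_k f_k and, occupancies of
   distinct cells being negatively correlated, variance at most that mean; as
   h -> 0 it tends to K_n up to the points beyond S~_N. Replacing f_k by its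
   conditional mean given S_kh costs a martingale of small variance, and
   Phi(j) = log j + O(1) identifies that mean as h ((log n - S_kh)^+ + O(1)).
   So K_n is within O(log n) in L^1 of the sum over integers j of
   (log n - S_j)^+, which stops being positive near J = log n / m_1 and differs
   by O(log^(5/4) n) from the sum of log n - S_j over j < J. The latter is
   log^2 n / (2 m_1) up to O(log n) and a weighted sum of the independent
   centered increments of S, to which a Lindeberg estimate applies. *)

(** The fluctuations are of order log^(3/2) n, so every replacement may cost anything smaller in
    L^1. Constants are crude, and square roots are avoided by 2 r |f| <= f^2 + r^2 with a tunable r.
    The variance arises thus: the increment of index i enters S_j for each j > i, hence has weight J
    - 1 - i; the squared weights add up to about J^3 / 3, and J = log n / m_1 gives m_2 log^3 n / (3
    m_1^3). The exponent 5/4 balances a window of width w about the level log n, where S_j deviates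
    by about log^(1/2) n: the window costs w log^(1/2) n, the rest log^2 n / w, and w = log^(3/4) n
    makes them equal. The obstacle in passing from gaps to cells is that a sample point on the
    closed range lies in no gap. Without drift this has probability 0; the proof is by counting,
    since a fine cell holds at most two such points, so that a positive probability would make the
    number of cells occupied up to a fixed time linear in n, while its mean is O(log n). Convergence
    in law is tested with cos (t x + c) for all phases c, a real substitute for characteristic
    functions. *)

Set Implicit Arguments.
Unset Strict Implicit.
Unset Printing Implicit Defensive.
Import Order.TTheory GRing.Theory Num.Theory.
Import numFieldNormedType.Exports.
Local Open Scope classical_set_scope.
Local Open Scope ring_scope.

(** * Binomial means and elementary bounds *)

(* The expectation of [f] under the binomial law with parameters [n] and [q],
   conditioned on the outcome of one trial at a time. *)
Section binomial_mean.
Context {R : realType}.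
Implicit Types (q c : R) (f g h : nat -> R).

Fixpoint binE q n f : R :=
  if n is m.+1 then q * binE q m (fun j => f j.+1) + (1 - q) * binE q m f
  else f 0%N.

Lemma eq_binE q n f g : f =1 g -> binE q n f = binE q n g.
Proof.
by elim: n f g => [|n IH] f g fg /=; rewrite ?fg// (IH _ _ fg)
  (IH _ (fun j => g j.+1))// => j.
Qed.

Lemma binED q n f g : binE q n (fun j => f j + g j) = binE q n f + binE q n g.
Proof. by elim: n f g => [//|n IH] f g /=; rewrite !IH; ring. Qed.

Lemma binEZ q n c f : binE q n (fun j => c * f j) = c * binE q n f.
Proof. by elim: n f => [//|n IH] f /=; rewrite !IH; ring. Qed.

Lemma binE_cst q n c : binE q n (fun=> c) = c.
Proof. by elim: n => [//|n IH] /=; rewrite !IH; ring. Qed.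

Lemma binEB q n f g : binE q n (fun j => f j - g j) = binE q n f - binE q n g.
Proof. by elim: n f g => [//|n IH] f g /=; rewrite !IH; ring. Qed.

Lemma le_binE q n f g : 0 <= q <= 1 -> (forall j, (j <= n)%N -> f j <= g j) ->
  binE q n f <= binE q n g.
Proof.
move=> /andP[q0 q1]; elim: n f g => [|n IH] f g fg /=; first exact: fg.
apply: lerD; apply: ler_wpM2l; rewrite ?subr_ge0//; apply: IH => j jn; apply: fg => //.
exact: leqW.
Qed.

Lemma binE_ge0 q n f : 0 <= q <= 1 -> (forall j, (j <= n)%N -> 0 <= f j) -> 0 <= binE q n f.
Proof. by move=> q01 f0; rewrite -(binE_cst q n 0); exact: le_binE. Qed.

Lemma le_norm_binE q n f g : 0 <= q <= 1 ->
  (forall j, (j <= n)%N -> `|f j| <= g j) -> `|binE q n f| <= binE q n g.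
Proof.
move=> q01 fg; rewrite ler_norml; apply/andP; split.
  rewrite -[- binE q n g]mulN1r -binEZ; apply: le_binE => // j jn.
  by rewrite mulN1r; move: (fg j jn); rewrite ler_norml => /andP[].
by apply: le_binE => // j jn; move: (fg j jn); rewrite ler_norml => /andP[].
Qed.

Lemma binE_id q n : binE q n (fun j => j%:R) = n%:R * q.
Proof.
elim: n => [|n IH] /=; first by rewrite mul0r.
rewrite (eq_binE _ _ (g := fun j => j%:R + 1)); last by move=> j; rewrite natr1.
by rewrite binED binE_cst IH -natr1; ring.
Qed.

Lemma binE_sqr q n : binE q n (fun j => j%:R ^+ 2) = (n%:R * q) ^+ 2 + n%:R * q * (1 - q).
Proof.
elim: n => [|n IH] /=; first by rewrite expr0n /=; ring.
rewrite (eq_binE _ _ (g := fun j => j%:R ^+ 2 + (2 * j%:R + 1))); last first.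
  by move=> j; rewrite -natr1; ring.
by rewrite !binED binE_cst binEZ binE_id IH -natr1; ring.
Qed.

Lemma binE_pow q n c : binE q n (fun j => c ^+ j) = (1 - q + q * c) ^+ n.
Proof.
elim: n => [|n IH] /=; first by rewrite !expr0.
by rewrite (eq_binE _ _ (g := fun j => c * c ^+ j)) ?binEZ ?IH ?exprS; [ring|move=> j; rewrite exprS].
Qed.

(** Size biasing: the binomial law weighted by the number of successes is that of one success plus a
    binomial number with one trial fewer. Taking [h j = 1 / j] bounds inverse moments. *)
Lemma binE_size_bias q n h :
  n.+1%:R * q * binE q n (fun j => h j.+1) = binE q n.+1 (fun j => j%:R * h j).
Proof.
elim: n h => [|n IH] h; first by rewrite /=; ring.
have -> : binE q n.+2 (fun j => j%:R * h j) =
    q * binE q n.+1 (fun j => j.+1%:R * h j.+1) +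
    (1 - q) * binE q n.+1 (fun j => j%:R * h j) by [].
rewrite (eq_binE q n.+1 (f := fun j => j.+1%:R * h j.+1)
  (g := fun j => j%:R * h j.+1 + h j.+1)); last first.
  by move=> j; rewrite -natr1; ring.
rewrite binED -!IH -(natr1 n.+1) [binE q n.+1 (fun j => h j.+1)]/=; ring.
Qed.

Lemma binE_inv_le q n : 0 < q <= 1 -> binE q n (fun j => j.+1%:R^-1) <= (n.+1%:R * q)^-1.
Proof.
move=> /andP[q0 q1]; have q01 : 0 <= q <= 1 by rewrite ltW.
have nq : 0 < n.+1%:R * q by rewrite mulr_gt0.
(* With this [h] the right-hand side is the probability of at least one success, the term j = 0
   being 0. *)
rewrite -(ler_pM2l nq) divff ?gt_eqF// (binE_size_bias q n (fun j => j%:R^-1)).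
rewrite -[X in _ <= X](binE_cst q n.+1 1); apply: le_binE => // -[|j] _.
  by rewrite mul0r.
by rewrite divff.
Qed.

Lemma binE_mean_sqr q n : (0 < n)%N ->
  binE q n (fun j => (j%:R / n%:R - q) ^+ 2) = q * (1 - q) / n%:R.
Proof.
move=> n0; have n0' : n%:R != 0 :> R by rewrite pnatr_eq0 -lt0n.
rewrite (eq_binE _ _ (g := fun j => n%:R^-1 ^+ 2 * j%:R ^+ 2 + ((- 2 * q / n%:R) * j%:R + q ^+ 2))).
  by rewrite !binED !binEZ binE_cst binE_id binE_sqr; field.
by move=> j; field.
Qed.

End binomial_mean.

Lemma cvg_dist_le {R : realType} (u v : nat -> R) (l : R) :
    (\forall n \near \oo, `|u n - l| <= v n) -> v n @[n --> \oo] --> 0 ->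
  u n @[n --> \oo] --> l.
Proof.
move=> uv v0; apply/cvgrPdist_le => e e0.
have /cvgrPdist_le/(_ _ e0) := v0.
apply: filterS2 uv => n uvn; rewrite sub0r normrN distrC => vn.
by rewrite (le_trans uvn)// (le_trans (ler_norm _)).
Qed.

Lemma cvg_natV0 {R : realType} : (n%:R^-1 : R) @[n --> \oo] --> 0.
Proof. by rewrite -(cvg_shiftS (fun n => n%:R^-1 : R)); exact: cvg_harmonic. Qed.

(** * Uniform approximation by Bernstein polynomials *)

Section uniform_continuity.
Context {R : realType}.

(** Only [x] is confined to the segment; [y] may leave it, so the points j / N below need no
    membership check. *)
Lemma continuous_unif_segment (g : R -> R) (a b e : R) : continuous g -> 0 < e ->
  exists2 de : R, 0 < de & forall x y, a <= x <= b -> `|y - x| < de -> `|g y - g x| <= e.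
Proof.
move=> cg e0.
have /compact_near_coveringP/near_covering_withinP cov := @segment_compact R a b.
have : \forall de \near (0 : R)^'+, forall x, `[a, b]%classic x ->
   (forall y, `|y - x| < de -> `|g y - g x| <= e).
  apply: cov => x _.
  have e20 : 0 < e / 2 by rewrite divr_gt0.
  have /cvgrPdist_le/(_ _ e20)[r /= r0 Hr] := cg x.
  exists (ball x (r / 2), [set de | 0 < de < r / 2]).
    split; first by apply: nbhsx_ballx; rewrite divr_gt0.
    have r20 : 0 < r / 2 by rewrite divr_gt0.
    near=> de; apply/andP; split => //; near: de; exact: nbhs_right_lt.
  move=> [x' de] /= [bx' /andP[de0 der]] _ y yx'.
  have H1 : `|g x - g x'| <= e / 2.
    by apply: Hr; move: bx'; rewrite /ball /= => h; apply: lt_trans h _; lra.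
  have H2 : `|g x - g y| <= e / 2.
    apply: Hr; rewrite /ball_ /=; move: bx'; rewrite /ball /= => h.
    have := ler_distD x' x y; rewrite (distrC x' y); lra.
  have := ler_distD (g x) (g y) (g x'); rewrite (distrC (g y) (g x)); lra.
move=> H; have [de [de0 Hde]] : exists de, 0 < de /\ forall x, `[a, b]%classic x ->
   (forall y, `|y - x| < de -> `|g y - g x| <= e).
  near (0 : R)^'+ => de; exists de; split => //.
  by near: de.
by exists de => // x y xab; apply: Hde; rewrite /= in_itv.
Unshelve. all: by end_near. Qed.

(** Bernstein's argument: uniform continuity handles j / N within de of q, and elsewhere the
    difference is at most 2 M <= K (j / N - q)^2, whose binomial mean is at most K / N. *)
Lemma bernstein_approx (g : R -> R) (M e : R) : continuous g -> (forall x, `|g x| <= M) ->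
  0 < e -> exists2 N : nat, (0 < N)%N &
  forall q, 0 <= q <= 1 -> `|binE q N (fun j => g (j%:R / N%:R)) - g q| <= e.
Proof.
move=> cg gM e0.
have e20 : 0 < e / 2 by rewrite divr_gt0.
have [de de0 Hde] := continuous_unif_segment 0 1 cg e20.
have M0 : 0 <= M by exact: le_trans (gM 0).
pose K := 2 * M / de ^+ 2.
have K0 : 0 <= K by rewrite divr_ge0// ?sqr_ge0// mulr_ge0.
pose N := (Num.truncn (2 * K / e)).+1.
have NK : 2 * K / e < N%:R by exact: truncnS_gt.
exists N => // q q01; rewrite -(binE_cst q N (g q)) -binEB.
apply: (@le_trans _ _ (binE q N (fun j => e / 2 + K * (j%:R / N%:R - q) ^+ 2))).
  apply: le_norm_binE => // j _.
  have [lt|ge] := ltP `|j%:R / N%:R - q| de.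
    apply: (le_trans (Hde _ _ q01 lt)).
    by rewrite lerDl mulr_ge0// sqr_ge0.
  apply: (@le_trans _ _ (2 * M)).
    apply: (le_trans (ler_normB _ _)); move: (gM (j%:R / N%:R)) (gM q); lra.
  apply: (@le_trans _ _ (K * (j%:R / N%:R - q) ^+ 2)); last by rewrite lerDr ltW.
  rewrite /K -mulrA ler_peMr// ?mulr_ge0//.
  rewrite -[X in _ * X]real_normK ?num_real// mulrC ler_pdivlMr ?exprn_gt0// mul1r.
  by rewrite ler_sqr ?nnegrE// ltW.
rewrite binED binE_cst binEZ binE_mean_sqr//.
have N0 : 0 < N%:R :> R by rewrite ltr0n.
have : K * (q * (1 - q) / N%:R) <= e / 2.
  rewrite mulrA ler_pdivrMr//.
  have : K * (q * (1 - q)) <= K by rewrite ler_piMr//; case/andP: q01; nra.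
  move: NK; rewrite ltr_pdivrMr//; nra.
lra.
Qed.

End uniform_continuity.

(** * Taylor bounds for sine, cosine and the exponential *)

Section trigonometric_bounds.
Context {R : realType}.
Implicit Types x y : R.

(** Applied as a ladder: a bound on the derivative becomes a bound on the function with one more
    power of |y|. Climbing from sin to cos - 1, sin - id and cos - (1 - x^2 / 2) gives Taylor bounds
    with constants that are not sharp. *)
Lemma le_norm_mean_value (f df : R -> R) (y M : R) :
    (forall x, is_derive x 1 f (df x)) -> (forall x, `|x| <= `|y| -> `|df x| <= M) ->
  `|f y - f 0| <= M * `|y|.
Proof.
move=> fdf dfM.
have cf : continuous f.
  by move=> x; apply: differentiable_continuous; apply/derivable1_diffP; have [] := fdf x.
have [y0|y0] := leP 0 y.
  have [c cy ->] := @MVT_segment R f df 0 y y0 (fun x _ => fdf x) (continuous_subspaceT cf).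
  rewrite subr0 normrM ler_wpM2r// dfM//.
  by move: cy; rewrite in_itv/= => /andP[c0 cy]; rewrite !ger0_norm.
have [c cy] := @MVT_segment R f df y 0 (ltW y0) (fun x _ => fdf x) (continuous_subspaceT cf).
rewrite distrC => ->; rewrite sub0r normrM normrN ler_wpM2r// dfM//.
move: cy; rewrite in_itv/= => /andP[c0 cy]; rewrite !ler0_norm ?(ltW y0)//.
by rewrite lerN2.
Qed.

Lemma norm_sin_le x : `|sin x| <= `|x|.
Proof.
have := @le_norm_mean_value sin cos x 1 (@is_derive_sin R).
rewrite sin0 subr0 mul1r; apply => z _; exact: cos_max.
Qed.

Lemma norm_cosB1_le x : `|cos x - 1| <= x ^+ 2.
Proof.
have := @le_norm_mean_value cos (fun z => - sin z) x `|x| (@is_derive_cos R).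
rewrite cos0 -expr2 real_normK ?num_real//; apply => z zx.
by rewrite normrN (le_trans (norm_sin_le z)).
Qed.

Lemma norm_sinB_le x : `|sin x - x| <= `|x| ^+ 3.
Proof.
have := @le_norm_mean_value (fun z => sin z - z) (fun z => cos z - 1) x (x ^+ 2).
rewrite sin0 !subr0 -[x ^+ 2]real_normK ?num_real// -exprSr; apply => z zx.
apply: (le_trans (norm_cosB1_le z)).
by rewrite -[z ^+ 2]real_normK ?num_real// ler_sqr ?nnegrE.
Qed.

Lemma norm_cosB2_le x : `|cos x - (1 - x ^+ 2 / 2)| <= x ^+ 2 * x ^+ 2.
Proof.
have := @le_norm_mean_value (fun z => cos z - (1 - z ^+ 2 / 2)) (fun z => z - sin z) x (`|x| ^+ 3).
rewrite cos0 expr0n /= mul0r !subr0 subrr subr0.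
rewrite -exprSr (_ : `|x| ^+ 4 = x ^+ 2 * x ^+ 2); last first.
  by rewrite -exprD -normrX ger0_norm// -[4%N]/(2 * 2)%N exprM sqr_ge0.
apply.
  move=> z; apply: is_derive_eq.
  by rewrite /GRing.scale/=; field.
by move=> z zx; rewrite distrC (le_trans (norm_sinB_le z))// ler_pXn2r ?nnegrE.
Qed.

(** A smooth form of the integrand in Lindeberg's condition: cubic near 0 and quadratic far out, so
    that a second moment suffices to integrate it. *)
Definition lindeberg_weight y : R := y ^+ 2 * Num.min 1 `|y|.

Lemma norm_cos_taylor y : `|cos y - (1 - y ^+ 2 / 2)| <= 3 * lindeberg_weight y.
Proof.
rewrite /lindeberg_weight; have [y1|y1] := leP 1 `|y|.
  rewrite mulr1; apply: (le_trans (ler_normB _ _)).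
  have y21 : 1 <= y ^+ 2 by rewrite -[y ^+ 2]real_normK ?num_real// expr_ge1.
  have : `|1 - y ^+ 2 / 2| <= 1 + y ^+ 2 / 2.
    by rewrite ler_norml; apply/andP; split; lra.
  move: (cos_max y); lra.
apply: (le_trans (norm_cosB2_le y)).
have := sqr_ge0 y; rewrite -[y ^+ 2]real_normK ?num_real//.
have := normr_ge0 y; set a := `|y| in y1 *; nra.
Qed.

Lemma norm_sin_taylor y : `|sin y - y| <= 3 * lindeberg_weight y.
Proof.
rewrite /lindeberg_weight; have [y1|y1] := leP 1 `|y|.
  rewrite mulr1; apply: (le_trans (ler_normB _ _)).
  have : `|y| <= y ^+ 2 by rewrite -[y ^+ 2]real_normK ?num_real// expr2 ler_peMl.
  move: (norm_sin_le y); lra.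
apply: (le_trans (norm_sinB_le y)).
have := normr_ge0 y; rewrite -[y ^+ 2]real_normK ?num_real//.
set a := `|y| in y1 *; rewrite -exprSr => a0.
have := exprn_ge0 3 a0; lra.
Qed.

Lemma norm_expRN_taylor x : 0 <= x -> `|expR (- x) - (1 - x)| <= x ^+ 2.
Proof.
move=> x0; have h1 := expR_ge1Dx (- x).
have : expR (- x) <= (1 + x)^-1.
  rewrite expRN lef_pV2 ?posrE ?expR_gt0 ?expR_ge1Dx//; lra.
have -> : (1 + x)^-1 = 1 - x + x ^+ 2 / (1 + x) by field; lra.
have : x ^+ 2 / (1 + x) <= x ^+ 2 by rewrite ler_pdivrMr ?ler_peMr ?sqr_ge0//; lra.
by rewrite ler_norml => h2 h3; apply/andP; split; lra.
Qed.

End trigonometric_bounds.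

(** * Integrals of real functions *)

Section expectation.
Context {d : measure_display} {T : measurableType d} {R : realType}.
Variable mu : {measure set T -> \bar R}.
Implicit Types f g : T -> R.

Definition L1 f := mu.-integrable setT (EFin \o f).

Lemma L1_measurable f : L1 f -> measurable_fun setT f.
Proof. by move=> /measurable_int/measurable_EFinP. Qed.

Lemma L1_le f g : measurable_fun setT f -> (forall x, `|f x| <= g x) ->
  L1 g -> L1 f.
Proof.
move=> mf fg; apply: le_integrable => //; first exact/measurable_EFinP.
by move=> x _ /=; rewrite lee_fin (le_trans (fg x))// ler_norm.
Qed.

Lemma L1D f g : L1 f -> L1 g -> L1 (fun x => f x + g x).
Proof. by move=> Lf Lg; exact: (integrableD measurableT Lf Lg). Qed.

Lemma L1Z c f : L1 f -> L1 (fun x => c * f x).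
Proof. by move=> Lf; exact: (integrableZl measurableT c Lf). Qed.

Lemma L1N f : L1 f -> L1 (fun x => - f x).
Proof. by move=> Lf; exact: (integrableN Lf). Qed.

Lemma L1B f g : L1 f -> L1 g -> L1 (fun x => f x - g x).
Proof. by move=> Lf Lg; apply: L1D => //; exact: L1N. Qed.

Lemma L1_norm f : L1 f -> L1 (fun x => `|f x|).
Proof. by move=> Lf; exact: (integrable_norm Lf). Qed.

Lemma L1_0 : L1 (fun _ => 0).
Proof. exact: integrable0. Qed.

Lemma L1_sum I (r : seq I) (F : I -> T -> R) :
  (forall i, L1 (F i)) -> L1 (fun x => \sum_(i <- r) F i x).
Proof.
move=> LF; elim: r => [|i r IH].
  by under eq_fun do rewrite big_nil; exact: L1_0.
by under eq_fun do rewrite big_cons; apply: L1D.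
Qed.

Lemma intD f g : L1 f -> L1 g ->
  \int[mu]_x (f x + g x) = \int[mu]_x f x + \int[mu]_x g x.
Proof. by move=> Lf Lg; rewrite RintegralD. Qed.

Lemma intB f g : L1 f -> L1 g ->
  \int[mu]_x (f x - g x) = \int[mu]_x f x - \int[mu]_x g x.
Proof. by move=> Lf Lg; rewrite RintegralB. Qed.

Lemma intZ c f : L1 f -> \int[mu]_x (c * f x) = c * \int[mu]_x f x.
Proof. by move=> Lf; rewrite RintegralZl. Qed.

Lemma int0 : \int[mu]_x (0 : R) = 0.
Proof. by rewrite /Rintegral integral0. Qed.

Lemma int_sum I (r : seq I) (F : I -> T -> R) : (forall i, L1 (F i)) ->
  \int[mu]_x (\sum_(i <- r) F i x) = \sum_(i <- r) \int[mu]_x F i x.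
Proof.
move=> LF; elim: r => [|i r IH].
  rewrite big_nil -[RHS]int0; apply: eq_Rintegral => x _.
  by rewrite big_nil.
rewrite big_cons -IH -intD//; last exact: L1_sum.
by apply: eq_Rintegral => x _; rewrite big_cons.
Qed.

Lemma le_int f g : L1 f -> L1 g -> (forall x, f x <= g x) ->
  \int[mu]_x f x <= \int[mu]_x g x.
Proof. by move=> Lf Lg fg; exact: le_Rintegral. Qed.

Lemma int_ge0 f : (forall x, 0 <= f x) -> 0 <= \int[mu]_x f x.
Proof. by move=> f0; exact: Rintegral_ge0. Qed.

Lemma le_norm_int f g : L1 f -> L1 g -> (forall x, `|f x| <= g x) ->
  `|\int[mu]_x f x| <= \int[mu]_x g x.
Proof.
move=> Lf Lg fg; apply: (le_trans (le_normr_Rintegral _ Lf)) => //.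
by apply: le_int => //; exact: L1_norm.
Qed.

Lemma int_EFin f : L1 f -> (\int[mu]_x (f x)%:E)%E = (\int[mu]_x f x)%:E.
Proof. by move=> Lf; rewrite fineK//; exact: integrable_fin_num. Qed.

Lemma cvg_int_dominated (f_ : nat -> T -> R) f g :
    (forall n, measurable_fun setT (f_ n)) ->
    (forall x, f_ n x @[n --> \oo] --> f x) -> L1 g ->
    (forall n x, `|f_ n x| <= g x) ->
  L1 f /\ \int[mu]_x f_ n x @[n --> \oo] --> \int[mu]_x f x.
Proof.
move=> mf ff Lg fg.
have mfl : measurable_fun setT f by apply: measurable_fun_cvg => // x _; exact: ff.
have Lf : L1 f.
  apply: L1_le Lg => // x.
  apply: (cvgr_to_le (cvg_norm (ff x))).
  by near=> n; exact: fg.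
split=> //; apply: fine_cvg; rewrite -/(Rintegral _ _ _) -int_EFin//.
apply: (@dominated_cvg _ _ _ mu setT measurableT (fun n => EFin \o f_ n)
  (EFin \o f) (EFin \o g)) => //.
- by move=> n; exact/measurable_EFinP.
- by move=> x _; apply: cvg_EFin; [exact: nearW|exact: ff].
- by move=> n x _ /=; rewrite lee_fin.
Unshelve. all: by end_near. Qed.

Lemma int_monotone (f_ : nat -> T -> R) f (l : R) :
    (forall n, L1 (f_ n)) -> (forall n x, 0 <= f_ n x) ->
    (forall x, {homo f_^~ x : n m / (n <= m)%N >-> n <= m}) ->
    (forall x, f_ n x @[n --> \oo] --> f x) ->
    \int[mu]_x f_ n x @[n --> \oo] --> l ->
  L1 f /\ \int[mu]_x f x = l.
Proof.
move=> Lf f0 fnd ff fl.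
have mf n : measurable_fun setT (f_ n) := L1_measurable (Lf n).
have mfl : measurable_fun setT f by apply: measurable_fun_cvg => // x _; exact: ff.
have limf x : limn (fun n => (f_ n x)%:E) = (f x)%:E.
  by apply/cvg_lim => //; apply: cvg_EFin; [exact: nearW|exact: ff].
have flE : (\int[mu]_x (f x)%:E)%E = l%:E.
  under eq_integral do rewrite -limf.
  rewrite (@monotone_convergence _ _ _ mu setT measurableT
    (fun n => EFin \o f_ n))//.
  - apply/cvg_lim => //; apply: cvg_EFin; last exact: fl.
    by apply: nearW => n; exact: (integrable_fin_num measurableT (Lf n)).
  - by move=> n; exact/measurable_EFinP.
  - by move=> n x _ /=; rewrite lee_fin.
  - by move=> x _ n m nm /=; rewrite lee_fin; exact: fnd.
split; last by rewrite /Rintegral flE.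
apply/integrableP; split; first exact/measurable_EFinP.
have f_ge0 x : 0 <= f x.
  by apply: (cvgr_to_ge (ff x)); apply: nearW => n; exact: f0.
under eq_integral do rewrite /= ger0_norm//.
by rewrite flE ltry.
Qed.

End expectation.

Section probability_expectation.
Context {d : measure_display} {T : measurableType d} {R : realType}.
Variable P : probability T R.
Implicit Types f g : T -> R.

Lemma L1_bounded f (M : R) : measurable_fun setT f -> (forall x, `|f x| <= M) ->
  L1 P f.
Proof.
move=> mf fM; apply: measurable_bounded_integrable => //.
  exact: (le_lt_trans (probability_le1 P measurableT) (ltry 1)).
exists M; split; first exact: num_real.
by move=> y My x _ /=; rewrite (le_trans (fM x))// ltW.
Qed.

Lemma L1_cst (c : R) : L1 P (fun _ => c).
Proof. by apply: (@L1_bounded _ `|c|). Qed.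

Lemma int_cst (c : R) : \int[P]_x c = c.
Proof.
rewrite Rintegral_cst// -[RHS]mulr1; congr (c * _).
by rewrite -[RHS]/(fine 1%E); congr fine; exact: probability_setT.
Qed.

Lemma int_indic (A : set T) : measurable A ->
  \int[P]_x (\1_A x : R) = fine (P A).
Proof. by move=> mA; rewrite /Rintegral integral_indic// setIT. Qed.

Lemma L1_sqr f : measurable_fun setT f -> L1 P (fun x => f x ^+ 2) -> L1 P f.
Proof.
move=> mf Lf2; apply: (@L1_le _ _ _ _ _ (fun x => 1 + f x ^+ 2)) => //.
  move=> x; rewrite ler_norml; apply/andP; split; nra.
exact: L1D (L1_cst 1) Lf2.
Qed.

(** The inequality 2 r |f| <= f^2 + r^2 in place of Cauchy-Schwarz: with [r] near the standard
    deviation the order is the same, without square roots. *)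
Lemma int_norm_le_sqr f (r : R) : 0 < r -> L1 P (fun x => f x ^+ 2) ->
  measurable_fun setT f ->
  \int[P]_x `|f x| <= (\int[P]_x (f x ^+ 2)) / (2 * r) + r / 2.
Proof.
move=> r0 Lf2 mf.
have Lf := L1_norm (L1_sqr mf Lf2).
rewrite -[r / 2]int_cst mulrC -intZ// -intD//; last 2 first.
  exact: L1Z. exact: L1_cst.
apply: le_int => //; first by apply: L1D; [exact: L1Z|exact: L1_cst].
move=> x /=; rewrite -(real_normK (num_real (f x))).
have := sqr_ge0 (`|f x| - r).
set a := `|f x| => h.
rewrite -subr_ge0 [X in 0 <= X](_ : _ = (2 * r)^-1 * (a - r) ^+ 2).
  by rewrite mulr_ge0// invr_ge0 mulr_ge0// ltW.
by field; rewrite gt_eqF.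
Qed.

End probability_expectation.

Section product_expectation.
Context {d1 d2 : measure_display} {T1 : measurableType d1}
  {T2 : measurableType d2} {R : realType}.
Variables (P : probability T1 R) (Q : probability T2 R).

(** Integrability is asked of every section, not of almost every one, so that the real inner
    integral agrees everywhere with the extended one in Fubini's theorem. *)
Lemma int_prod (f : T1 * T2 -> R) : L1 (P \x Q)%E f ->
  (forall x, L1 Q (fun y => f (x, y))) ->
  L1 P (fun x => \int[Q]_y f (x, y)) /\
  \int[(P \x Q)%E]_z f z = \int[P]_x \int[Q]_y f (x, y).
Proof.
move=> Lf Lfx.
have E x : (\int[Q]_y (f (x, y))%:E)%E = (\int[Q]_y f (x, y))%:E by rewrite int_EFin.
have := integrable_fubini_F Lf.
rewrite /fubini_F (_ : (fun x => _) = EFin \o (fun x => \int[Q]_y f (x, y)));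
  last by apply/funext => x; rewrite E.
move=> LF; split => //.
rewrite {1}/Rintegral -(integral12_prod_meas1 Lf)/Rintegral; congr fine.
by apply: eq_integral => x _; rewrite /fubini_F /= E.
Qed.

End product_expectation.

(** * Independence *)

Section independence.
Context {d : measure_display} {T : measurableType d} {R : realType}.
Variable P : probability T R.

Definition RV_of {d' : measure_display} {T' : measurableType d'} (f : T -> T')
  (mf : measurable_fun setT f) : {RV P >-> T'} := mfun_Sub (mem_set mf).

Lemma int_distribution {d' : measure_display} {T' : measurableType d'}
    (X : {RV P >-> T'}) (f : T' -> R) : measurable_fun setT f ->
  L1 P (f \o X) -> \int[distribution P X]_y f y = \int[P]_x f (X x).
Proof.
by move=> mf Lf; rewrite /Rintegral integral_distribution//; exact/measurable_EFinP.
Qed.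

Lemma measurable_sub_sigma (F : set (set T)) : F `<=` measurable ->
  measurable_fun setT (id : T -> g_sigma_algebraType F).
Proof.
move=> FM _ A mA; rewrite setTI preimage_id.
by apply: (@smallest_sub _ (sigma_algebra setT) F measurable) => //;
  exact: sigma_algebra_measurable.
Qed.

End independence.

Section coupling.
Context {d : measure_display} {T : measurableType d} {R : realType}.
Variable P : probability T R.
Variables F G : set (set T).
Hypothesis FM : F `<=` measurable.
Hypothesis GM : G `<=` measurable.
Local Notation TF := (g_sigma_algebraType F).
Local Notation TG := (g_sigma_algebraType G).

Lemma measurable_diag_sub (h : TF * TG -> R) : measurable_fun setT h ->
  measurable_fun setT (fun w : T => h (w, w)).
Proof.
move=> mh; apply: (measurableT_comp mh).
by apply: measurable_fun_pair; exact: measurable_sub_sigma.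
Qed.

Lemma measurable_prod_sub :
  measurable_fun setT (fun z : T * T => (z.1, z.2) : TF * TG).
Proof.
apply: measurable_fun_pair.
- exact: (measurableT_comp (measurable_sub_sigma FM) measurable_fst).
- exact: (measurableT_comp (measurable_sub_sigma GM) measurable_snd).
Qed.

(* Rectangles generate the product sigma-algebra, and on them this is independence. *)
Lemma int_diag (h : TF * TG -> R) (M : R) :
    independent2 P (<<s F >>) (<<s G >>) ->
    measurable_fun setT h -> (forall z, `|h z| <= M) ->
  \int[P]_w h (w, w) = \int[(P \x P)%E]_z h z.
Proof.
move=> ind mh hM.
have miota : measurable_fun setT (fun w : T => (w, w) : TF * TG).
  by apply: measurable_fun_pair; exact: measurable_sub_sigma.
pose X1 := RV_of P miota.
pose X2 := RV_of (P \x P)%E measurable_prod_sub.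
(* The laws of the diagonal pair and of the product pair are both compared with the product of the
   restrictions of P to the two sigma-algebras. *)
pose PF := distribution P (RV_of P (measurable_sub_sigma FM)).
pose PG := distribution P (RV_of P (measurable_sub_sigma GM)).
have E1 := @product_measure_unique _ _ TF TG R PF PG (distribution P X1).
have E2 := @product_measure_unique _ _ TF TG R PF PG (distribution (P \x P)%E X2).
have -> : \int[P]_w h (w, w) = \int[distribution P X1]_z h z.
  rewrite int_distribution//; apply: (@L1_bounded _ _ _ _ _ M).
    exact: measurable_diag_sub.
  by move=> x; exact: hM.
have -> : \int[(P \x P)%E]_z h z = \int[distribution (P \x P)%E X2]_z h z.
  rewrite int_distribution//; last first.
    apply: (@L1_bounded _ _ _ _ _ M).
      exact: (measurableT_comp mh measurable_prod_sub).
    by move=> x; exact: hM.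
  by apply: eq_Rintegral => -[].
congr fine; apply: eq_measure_integral => A mA _.
rewrite -[LHS]E1// -?[RHS]E2//.
move=> A1 B1 mA1 mB1.
  transitivity ((P \x P)%E (A1 `*` B1)); last first.
    apply: product_measure1E.
    + by move: (measurable_sub_sigma FM measurableT mA1); rewrite setTI.
    + by move: (measurable_sub_sigma GM measurableT mB1); rewrite setTI.
  by rewrite /distribution/= /pushforward/=; congr ((P \x P)%E _); apply/seteqP; split=> -[].
Qed.

End coupling.

(** * Independence of a variable from its predecessors *)

Section past.
Context {d : measure_display} {T : measurableType d} {R : realType}.
Variable P : probability T R.
Variable Y : nat -> T -> R.
Hypothesis mY : forall i, measurable_fun setT (Y i).
Hypothesis indY : forall k, mutually_independent P
  (fun i : 'I_k => g_sigma_algebra_preimage (Y i)).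

(** Only a generating family. Being determined by the first [k] variables is expressed by giving a
    function the domain [g_sigma_algebraType (past k)], which has the points of T. *)
Definition past k : set (set T) :=
  \bigcup_(i in `I_k) g_sigma_algebra_preimage (Y i).

Lemma sigma_preimage_measurable i : g_sigma_algebra_preimage (Y i) `<=` measurable.
Proof. by move=> A [B mB <-]; exact: mY. Qed.

Lemma past_measurable k : past k `<=` measurable.
Proof. by move=> A [i _]; exact: sigma_preimage_measurable. Qed.

Let cyl k (B : nat -> set R) := [set w | forall i : 'I_k, B i (Y i w)].

Let cyls k := [set cyl k B | B in [set B | forall i, measurable (B i)]].

Let cylE k B : cyl k B = \bigcap_(i in [set` [set: 'I_k]%SET]) (Y i @^-1` B i).
Proof.
apply/seteqP; split => w /=; first by move=> H i _; exact: H.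
by move=> H i; apply: H => /=; rewrite inE.
Qed.

Let P_cyl k B : (forall i, measurable (B i)) ->
  P (cyl k B) = (\prod_(i < k) P (Y i @^-1` B i))%E.
Proof.
move=> mB; rewrite cylE (indY (J := [set: 'I_k]%SET) (A := fun i => Y i @^-1` B i)).
  by apply: eq_bigl => i; rewrite inE.
by move=> i _; exists (B i); [exact: mB|rewrite setTI].
Qed.

(** A pi-lambda argument: cylinders over the first [k] coordinates are stable under intersection,
    their sigma-algebra contains the past, and on them the restriction of P to the event on [Y k]
    agrees with P scaled by the probability of that event. *)
Lemma independent_past k :
  independent2 P (<<s past k >>) (<<s g_sigma_algebra_preimage (Y k) >>).
Proof.
move=> A C sA; rewrite sigma_algebra_id; last first.
  by apply: sigma_algebra_preimage; exact: sigma_algebra_measurable.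
move=> [B mB]; rewrite setTI => <-.
have mC : measurable (Y k @^-1` B) by rewrite -[X in measurable X]setTI; exact: mY.
pose r : {nonneg R} := NngNum (fine_ge0 (measure_ge0 P (Y k @^-1` B))).
have cylm : cyls k `<=` measurable.
  move=> _ [B' mB' <-]; rewrite cylE; apply: fin_bigcap_measurable => //.
  by move=> i _; rewrite -[X in measurable X]setTI; exact: mY.
have cylT : cyls k setT.
  by exists (fun _ => setT) => //; apply/seteqP; split.
have cylI : setI_closed (cyls k).
  move=> _ _ [B1 m1 <-] [B2 m2 <-]; exists (fun i => B1 i `&` B2 i).
    by move=> i; exact: measurableI.
  apply/seteqP; split => w /=; first by move=> H; split=> i; case: (H i).
  by move=> [H1 H2] i; split.
have sub : <<s past k >> `<=` <<s cyls k >>.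
  apply: smallest_sub; first exact: smallest_sigma_algebra.
  move=> _ [i /= ik [B' mB' <-]]; apply: sub_sigma_algebra.
  exists (fun j => if j == i then B' else setT).
    by move=> j; case: ifP.
  apply/seteqP; split => w /=.
    by move=> /(_ (Ordinal ik))/=; rewrite eqxx; split.
  by move=> [_ H] j; case: ifP => // /eqP ->.
have := @g_sigma_algebra_measure_unique _ R T (cyls k) cylm (fun _ => setT)
   (fun _ => cylT) _ (mrestr P mC) (mscale r P) cylI _ _ A (sub _ sA).
rewrite /mrestr/= /mscale/= fineK ?fin_num_measure// muleC; apply.
- by rewrite bigcup_const//; exists 0%N.
- move=> _ [B' mB' <-].
  rewrite /mrestr/= muleC P_cyl//.
  (* The event on [Y k] becomes one more coordinate of the cylinder, so that the product formula
     applies. *)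
  pose B2 i := if (i < k)%N then B' i else B.
  have -> : cyl k B' `&` Y k @^-1` B = cyl k.+1 B2.
    apply/seteqP; split => w /=.
      move=> [H1 H2] i; rewrite /B2; case: ltnP => ik; first exact: (H1 (Ordinal ik)).
      by have -> : i = k :> nat by apply/eqP; rewrite eqn_leq ik -ltnS ltn_ord.
    move=> H; split; last by move: (H ord_max); rewrite /B2 /= ltnn.
    by move=> i; move: (H (widen_ord (leqnSn k) i)); rewrite /B2 /= ltn_ord.
  rewrite P_cyl; last by move=> i; rewrite /B2; case: ifP.
  rewrite big_ord_recr/= /B2 ltnn; congr (_ * _)%E.
  by apply: eq_bigr => i _; rewrite ltn_ord.
- by move=> _; rewrite /mrestr/= setTI (le_lt_trans (probability_le1 P mC)) ?ltry.
Qed.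

Lemma int_mul_past k (H : g_sigma_algebraType (past k) -> R) (f : R -> R) (M M' : R) :
    measurable_fun setT H -> measurable_fun setT f ->
    (forall w, `|H w| <= M) -> (forall y, `|f y| <= M') ->
  \int[P]_w (H w * f (Y k w)) = (\int[P]_w H w) * \int[P]_w f (Y k w).
Proof.
move=> mH mf HM fM.
have mYk : measurable_fun setT (Y k : g_sigma_algebraType (g_sigma_algebra_preimage (Y k)) -> R).
  by move=> _ B mB; apply: sub_sigma_algebra; exists B.
have mHT : measurable_fun setT (H : T -> R).
  exact: (measurableT_comp mH (measurable_sub_sigma (@past_measurable k))).
have mfY : measurable_fun setT (f \o Y k) by exact: measurableT_comp.
have M0 : 0 <= M by exact: le_trans (HM point).
have bnd (z : T * T) : `|H z.1 * f (Y k z.2)| <= M * M'.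
  by rewrite normrM ler_pM.
rewrite (@int_diag _ _ _ P _ _ (@past_measurable k) (@sigma_preimage_measurable k)
  (fun z => H z.1 * f (Y k z.2)) (M * M')).
- have LfY : L1 P (fun y => f (Y k y)) by apply: (@L1_bounded _ _ _ _ _ M').
  have LH : L1 P H by apply: (@L1_bounded _ _ _ _ _ M).
  have [] := @int_prod _ _ T T R P P (fun z => H z.1 * f (Y k z.2)).
  + apply: (@L1_bounded _ _ _ _ _ (M * M')) => //.
    apply: measurable_funM; first exact: (measurableT_comp mHT).
    exact: (measurableT_comp mfY).
  + by move=> x; exact: (L1Z (H x) LfY).
  + move=> _ ->; under eq_Rintegral do rewrite /= intZ// mulrC.
    by rewrite intZ// mulrC.
- exact: independent_past.
- apply: measurable_funM; first exact: (measurableT_comp mH).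
  by apply: (measurableT_comp mf); exact: (measurableT_comp mYk).
- by move=> z; exact: bnd.
Qed.

Lemma measurable_past k i : (i < k)%N ->
  measurable_fun setT (Y i : g_sigma_algebraType (past k) -> R).
Proof. by move=> ik _ B mB; apply: sub_sigma_algebra; exists i => //; exists B. Qed.

End past.

(** * Convergence in law from cosine transforms *)

Section gaussian_cosine.
Context {R : realType}.
Local Notation lambda := (@lebesgue_measure R).
Let p (x : R) := normal_pdf 0 1 x.
Let k : R := normal_peak 1.

Let pE x : p x = k * expR (- (x ^+ 2 / 2)).
Proof. by rewrite /p normal_pdfE ?oner_eq0// /normal_fun subr0 expr1n mulNr. Qed.

Let k0 : 0 < k. Proof. by rewrite normal_peak_gt0// oner_eq0. Qed.

Let p_ge0 x : 0 <= p x. Proof. exact: normal_pdf_ge0. Qed.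

Let is_derive_p (x : R) : is_derive x 1 p (- (x * p x)).
Proof.
rewrite (_ : p = fun x => k * expR (- (x ^+ 2 / 2))); last exact/funext/pE.
by apply: is_derive_eq; rewrite /GRing.scale/=; field.
Qed.

Let cp : continuous p. Proof. by apply: continuous_normal_pdf; rewrite oner_eq0. Qed.

Let mp : measurable_fun setT p. Proof. exact: measurable_normal_pdf. Qed.

Let L1p : L1 lambda p. Proof. exact: integrable_normal_pdf. Qed.

Let L1xp : L1 lambda (fun x : R => `|x| * p x).
Proof.
(* Half of the exponent absorbs the factor |x|; the other half is the normal density of variance
   2. *)
pose s : R := Num.sqrt 2; have s0 : s != 0 by rewrite gt_eqF// sqrtr_gt0.
have s2 : s ^+ 2 = 2 by rewrite sqr_sqrtr.
pose C := 2 * k / normal_peak s.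
apply: (@L1_le _ (measurableTypeR R) R lambda _ (fun x : R => C * normal_pdf 0 s x)).
- by apply: measurable_funM => //; exact: measurableT_comp.
- move=> x; rewrite ger0_norm ?mulr_ge0// pE normal_pdfE// /normal_fun subr0 s2 /C.
  rewrite [leRHS](_ : _ = 2 * k * expR (- x ^+ 2 / (2 *+ 2))); last first.
    by field; rewrite gt_eqF// normal_peak_gt0.
  rewrite mulrCA [2 * k]mulrC -[leRHS]mulrA; apply: ler_wpM2l; first exact: ltW.
  rewrite (_ : - (x ^+ 2 / 2) = - x ^+ 2 / (2 *+ 2) + - x ^+ 2 / (2 *+ 2)); last by field.
  rewrite expRD mulrA ler_wpM2r ?expR_ge0//.
  rewrite mulNr expRN ler_pdivrMr ?expR_gt0//.
  apply: (@le_trans _ _ (2 * (1 + x ^+ 2 / (2 *+ 2)))); last first.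
    by rewrite ler_wpM2l// expR_ge1Dx.
  rewrite -[x ^+ 2]real_normK ?num_real//; have := sqr_ge0 (`|x| - 1); lra.
- by apply: L1Z; exact: integrable_normal_pdf.
Qed.

Let L1_mul_p (f : R -> R) (M : R) : measurable_fun setT f -> (forall x, `|f x| <= M) ->
  L1 lambda (fun x : R => f x * p x).
Proof.
move=> mf fM; apply: (@L1_le _ (measurableTypeR R) R lambda _ (fun x : R => M * p x)).
- exact: measurable_funM.
- by move=> x; rewrite normrM (ger0_norm (p_ge0 x)) ler_wpM2r.
- exact: L1Z.
Qed.

(** The fundamental theorem on [- n - 1, n + 1] followed by dominated convergence; it supplies the
    integration by parts below. *)
Let int_derive0 (F f : R -> R) : (forall x : R, is_derive x (1 : R) F (f x)) -> continuous f ->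
  L1 lambda f -> F n%:R @[n --> \oo] --> 0 -> F (- n%:R) @[n --> \oo] --> 0 ->
  \int[lambda]_x f x = 0.
Proof.
move=> Ff cf Lf F1 F2.
have cF : continuous F.
  by move=> x; apply: differentiable_continuous; apply/derivable1_diffP; have [] := Ff x.
have E n : \int[lambda]_x (f x * \1_(`[(- n.+1%:R : R), n.+1%:R]) x) = F n.+1%:R - F (- n.+1%:R).
  have := @continuous_FTC2 R f F (- n.+1%:R) n.+1%:R; rewrite /Rintegral.
  move=> H; rewrite integral_mkcond in H.
  rewrite (_ : (fun x => _) = (EFin \o f) \_ `[(- n.+1%:R : R), n.+1%:R]); last first.
    apply/funext => x; rewrite patchE indicE; case: ifP => _ /=; first by rewrite mulr1.
    by rewrite mulr0.
  rewrite H//.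
  - by have : 0 < n.+1%:R :> R by []; lra.
  - exact: continuous_subspaceT.
  - split; first by move=> x _; have [] := Ff x.
    + by apply: cvg_at_right_filter; exact: cF.
    + by apply: cvg_at_left_filter; exact: cF.
  - by move=> x _; rewrite derive1E; have [_ ->] := Ff x.
have [_ H] : L1 lambda f /\ \int[lambda]_x (f x * \1_(`[(- n.+1%:R : R), n.+1%:R]) x) @[n --> \oo] --> \int[lambda]_x f x.
  apply: (@cvg_int_dominated _ (measurableTypeR R) R lambda _ f (fun x => `|f x|) _ _ (L1_norm Lf)).
  - move=> n; apply: measurable_funM; first exact: continuous_measurable_fun.
    exact: measurable_indic.
  - move=> x; apply: cvg_near_cst; near=> n.
    rewrite indicE mem_set ?mulr1//= in_itv/= -ler_norml.
    rewrite (@le_trans _ _ n%:R) ?ler_nat//.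
    by near: n; exact: nbhs_infty_ger.
  - move=> n x; rewrite normrM ler_piMr// indicE.
    by case: (_ \in _); rewrite ?normr1 ?normr0.
have H2 : F n.+1%:R - F (- n.+1%:R) @[n --> \oo] --> (0 : R).
  rewrite -[X in _ --> X]subr0; apply: cvgB.
    by rewrite (cvg_shiftS (fun n => F n%:R)).
  by rewrite (cvg_shiftS (fun n => F (- n%:R))).
by rewrite (funext E) in H; exact: cvg_unique H H2.
Unshelve. all: by end_near. Qed.

Let cvg_p0 (s : R) : s ^+ 2 = 1 -> p (s * n%:R) @[n --> \oo] --> 0.
Proof.
move=> s1.
apply: (@cvg_dist_le _ _ (fun n => (2 * k) * (n%:R)^-1)).
- near=> n; rewrite subr0 ger0_norm// pE exprMn s1 mul1r.
  have n0 : 1 <= n%:R :> R by near: n; exact: nbhs_infty_ger.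
  rewrite (_ : 2 * k / n%:R = k * (2 / n%:R)); last by ring.
  apply: ler_wpM2l; first exact: ltW.
  rewrite expRN.
  rewrite -[X in X <= _]div1r ler_pdivrMr ?expR_gt0//.
  have := expR_ge1Dx (n%:R ^+ 2 / 2 : R).
  set a := n%:R in n0 *; move=> h.
  apply: (@le_trans _ _ (2 / a * (1 + a ^+ 2 / 2))); last first.
    by rewrite ler_wpM2l// divr_ge0//; lra.
  have -> : 2 / a * (1 + a ^+ 2 / 2) = 2 / a + a by field; lra.
  have : 0 <= 2 / a by rewrite divr_ge0//; lra.
  lra.
- rewrite -[X in _ --> X](mulr0 (2 * k)); apply: cvgMr.
  exact: cvg_natV0.
Unshelve. all: by end_near. Qed.

Let G (c t : R) := \int[lambda]_x (cos (t * x + c) * p x).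

Let L1_cos (t c : R) : L1 lambda (fun x : R => cos (t * x + c) * p x).
Proof.
apply: (@L1_mul_p _ 1); last by move=> x; exact: cos_max.
by apply: continuous_measurable_fun => x; apply: continuous_comp; [|exact: continuous_cos];
  apply: cvgD; [apply: cvgMr; exact: cvg_id|exact: cvg_cst].
Qed.

Let L1_xsin (t c : R) : L1 lambda (fun x : R => x * sin (t * x + c) * p x).
Proof.
apply: (@L1_le _ (measurableTypeR R) R lambda _ (fun x : R => `|x| * p x)) => //.
- apply: measurable_funM => //; apply: measurable_funM => //.
  by apply: continuous_measurable_fun => x; apply: continuous_comp; [|exact: continuous_sin];
    apply: cvgD; [apply: cvgMr; exact: cvg_id|exact: cvg_cst].
- move=> x; rewrite !normrM (ger0_norm (p_ge0 x)) ler_wpM2r// ler_piMr//.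
  exact: sin_max.
Qed.

(** Since p' = - x p, the function sin (t x + c) p x has derivative t cos (t x + c) p x - x sin (t x
    + c) p x, whose integral vanishes. *)
Let int_xsin (t c : R) : \int[lambda]_x (x * sin (t * x + c) * p x) = t * G c t.
Proof.
apply/eqP; rewrite eq_sym -subr_eq0 /G -(intZ t (L1_cos t c)) -(intB (L1Z t (L1_cos t c)) (L1_xsin t c)).
apply/eqP; apply: (@int_derive0 (fun x => sin (t * x + c) * p x)).
- by move=> x; have dp := is_derive_p x; apply: is_derive_eq; rewrite /GRing.scale/=; ring.
- move=> x; apply: cvgB.
    apply: cvgMr; apply: cvgM; last exact: cp.
    apply: continuous_comp; last exact: continuous_cos.
    by apply: cvgD; [apply: cvgMr; exact: cvg_id|exact: cvg_cst].
  apply: cvgM; last exact: cp.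
  apply: cvgM; first exact: cvg_id.
  apply: continuous_comp; last exact: continuous_sin.
  by apply: cvgD; [apply: cvgMr; exact: cvg_id|exact: cvg_cst].
- exact: (L1B (L1Z t (L1_cos t c)) (L1_xsin t c)).
- apply: (@cvg_dist_le _ _ (fun n => p (1 * n%:R))).
  + near=> n; rewrite subr0 mul1r normrM (ger0_norm (p_ge0 _)) ler_piMl//.
    exact: sin_max.
  + by apply: cvg_p0; rewrite expr1n.
- apply: (@cvg_dist_le _ _ (fun n => p (-1 * n%:R))).
  + near=> n; rewrite subr0 mulN1r normrM (ger0_norm (p_ge0 _)) ler_piMl//.
    exact: sin_max.
  + by apply: cvg_p0; rewrite sqrrN expr1n.
Unshelve. all: by end_near. Qed.

(** Differentiation under the integral sign, dominated by |x| p x, followed by integration by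
    parts. *)
Let is_derive_G (c t : R) : is_derive t (1 : R) (G c) (- (t * G c t)).
Proof.
pose f (t x : R) := cos (t * x + c) * p x.
have df (t1 x : R) : is_derive t1 (1 : R) (f ^~ x) (- (x * sin (t1 * x + c) * p x)).
  by rewrite /f; apply: is_derive_eq; rewrite /GRing.scale/=; ring.
have d1E (t0 x : R) : partial1of2 f t0 x = - (x * sin (t0 * x + c) * p x).
  by rewrite partial1of2E; have [_ ->] := df t0 x.
have tI : `]t - 1, t + 1[%classic t by rewrite /= in_itv/=; apply/andP; split; lra.
have I1 x : `]t - 1, t + 1[%classic x -> lambda.-integrable setT (EFin \o f x).
  by move=> _; exact: L1_cos.
have I2 (x y : R) : `]t - 1, t + 1[%classic x -> setT y -> derivable (f ^~ y) x 1.
  by move=> _ _; have [] := df x y.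
have I3 (x y : R) : `]t - 1, t + 1[%classic x -> setT y -> `|partial1of2 f x y| <= `|y| * p y.
  move=> _ _; rewrite d1E normrN !normrM (ger0_norm (p_ge0 y)) ler_wpM2r// ler_piMr//.
  exact: sin_max.
have I4 (y : R) : 0 <= `|y| * p y by rewrite mulr_ge0.
apply: DeriveDef.
  exact: (@derivable_under_integral R _ (measurableTypeR R) lambda f setT measurableT
   t (t - 1) (t + 1) tI I1 I2 (fun y : R => `|y| * p y) I4 L1xp I3).
rewrite -derive1E (@differentiation_under_integral R _ (measurableTypeR R) lambda f setT measurableT
   t (t - 1) (t + 1) tI I1 I2 (fun y : R => `|y| * p y) I4 L1xp I3).
under eq_Rintegral do rewrite d1E -mulN1r.
by rewrite intZ// int_xsin mulN1r.
Qed.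

(** By the differential equation, G c t exp (t^2 / 2) is constant in t; at t = 0 it is cos c because
    p has mass 1. *)
Lemma int_cos_gaussian (t c : R) :
  \int[lambda]_x (cos (t * x + c) * normal_pdf 0 1 x) = expR (- (t ^+ 2 / 2)) * cos c.
Proof.
have E : G c t * expR (t ^+ 2 / 2) = G c 0 * expR (0 ^+ 2 / 2).
  apply: (@is_derive_0_is_cst R (fun t => G c t * expR (t ^+ 2 / 2))) => x.
  have := is_derive_G c x; move=> dG.
  by apply: is_derive_eq; rewrite /GRing.scale/=; field.
have G0 : G c 0 = cos c.
  rewrite /G; under eq_Rintegral do rewrite mul0r add0r.
  by rewrite intZ// {1}/Rintegral integral_normal_pdf /= mulr1.
move: E; rewrite G0 expr0n /= mul0r expR0 mulr1 => E.
by rewrite -/(G c t) -E expRN mulrC mulfK// gt_eqF// expR_gt0.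
Qed.

Lemma int_normal_prob (f : R -> R) : L1 (normal_prob 0 1 : probability (measurableTypeR R) R) f ->
  \int[(normal_prob 0 1 : probability (measurableTypeR R) R)]_x f x = \int[lambda]_x (f x * p x).
Proof.
move=> Lf.
pose N : probability (measurableTypeR R) R := normal_prob 0 1.
have dom : N `<< lambda := @normal_prob_dominates R 0 1.
have H := @Radon_Nikodym_change_of_variables _ (measurableTypeR R) R N lambda dom (EFin \o f) setT measurableT Lf.
rewrite /Rintegral -[in LHS]H; congr fine; apply: ae_eq_integral => //.
- apply: emeasurable_funM => //; first exact: measurable_int Lf.
- apply/measurable_EFinP; apply: measurable_funM => //; exact: L1_measurable Lf.
have E : ae_eq lambda setT (Radon_Nikodym (charge_of_finite_measure N) lambda) (EFin \o p).
  apply: integral_ae_eq => //.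
  - exact: Radon_Nikodym_integrable.
  - exact/measurable_EFinP.
  - by move=> A _ mA; rewrite -Radon_Nikodym_integral.
apply: filterS E => x /(_ I) E _.
by rewrite E /= EFinM.
Qed.

Lemma normal_cos (t c : R) :
  \int[(normal_prob 0 1 : probability (measurableTypeR R) R)]_x (cos (t * x + c)) = expR (- (t ^+ 2 / 2)) * cos c.
Proof.
rewrite int_normal_prob ?int_cos_gaussian//; apply: (@L1_bounded _ _ _ _ _ 1).
  by apply: continuous_measurable_fun => x; apply: continuous_comp; [|exact: continuous_cos];
    apply: cvgD; [apply: cvgMr; exact: cvg_id|exact: cvg_cst].
by move=> x; exact: cos_max.
Qed.
End gaussian_cosine.

(** * Weak convergence from tightness and cosine transforms *)

Section weak_convergence.
Context {R : realType}.
Variables (mu_ : nat -> probability R R) (mu : probability R R).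
Variable C : R.
Hypothesis tight : \forall n \near \oo, L1 (mu_ n) (fun x : R => `|x|) /\
  \int[mu_ n]_x `|x| <= C.
Hypothesis cvg_cos : forall t c : R,
  \int[mu_ n]_x cos (t * x + c) @[n --> \oo] --> \int[mu]_x cos (t * x + c).

(** Convergence is demanded against all cosines with phase and not only for psi itself: this makes
    the class stable under multiplication by a sine. *)
Let good (psi : R -> R) := [/\ measurable_fun setT psi, exists M, forall x, `|psi x| <= M &
  forall t c : R, \int[mu_ n]_x (psi x * cos (t * x + c)) @[n --> \oo] -->
     \int[mu]_x (psi x * cos (t * x + c))].

Let mcos (t c : R) : measurable_fun setT (fun x : R => cos (t * x + c)).
Proof.
by apply: continuous_measurable_fun => x; apply: continuous_comp; [|exact: continuous_cos];
  apply: cvgD; [apply: cvgMr; exact: cvg_id|exact: cvg_cst].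
Qed.

Let L1cos (nu : probability R R) psi t c : good psi -> L1 nu (fun x : R => psi x * cos (t * x + c)).
Proof.
move=> [mpsi [M psiM] _]; apply: (@L1_bounded _ _ _ _ _ M).
  by apply: measurable_funM => //; exact: mcos.
by move=> x; rewrite normrM (le_trans _ (psiM x))// ler_piMr// cos_max.
Qed.

Let good_cst (a : R) : good (fun=> a).
Proof.
split; first exact: measurable_cst.
  by exists `|a|.
move=> t c.
have L (nu : probability R R) : L1 nu (fun x : R => cos (t * x + c)).
  by apply: (@L1_bounded _ _ _ _ _ 1) => // x; exact: cos_max.
under eq_fun do rewrite intZ//.
by rewrite intZ//; apply: cvgMr; exact: cvg_cos.
Qed.

Let goodD (psi1 psi2 : R -> R) : good psi1 -> good psi2 -> good (fun x => psi1 x + psi2 x).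
Proof.
move=> g1 g2; have [m1 [M1 h1] c1] := g1; have [m2 [M2 h2] c2] := g2.
split; first exact: measurable_funD.
  by exists (M1 + M2) => x; rewrite (le_trans (ler_normD _ _))// lerD.
move=> t c.
have E (nu : probability R R) : \int[nu]_x ((psi1 x + psi2 x) * cos (t * x + c)) =
    \int[nu]_x (psi1 x * cos (t * x + c)) + \int[nu]_x (psi2 x * cos (t * x + c)).
  rewrite -intD; [|exact: L1cos|exact: L1cos].
  by apply: eq_Rintegral => x _; rewrite mulrDl.
rewrite (funext (fun n => E (mu_ n))) (E mu).
by apply: cvgD.
Qed.

(** Product-to-sum formula: sin (b x) cos (t x + c) is half a difference of sines of frequencies t +
    b and t - b, and phase shifts by pi / 2 turn these back into cosines. *)
Let good_sin (b : R) (psi : R -> R) : good psi -> good (fun x => sin (b * x) * psi x).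
Proof.
move=> g; have [m [M h] cc] := g.
have msin : measurable_fun setT (fun x : R => sin (b * x)).
  by apply: continuous_measurable_fun => x; apply: continuous_comp; [|exact: continuous_sin];
    apply: cvgMr; exact: cvg_id.
split; first exact: measurable_funM.
  by exists M => x; rewrite normrM (le_trans _ (h x))// ler_piMl// sin_max.
move=> t c.
have E (nu : probability R R) : \int[nu]_x (sin (b * x) * psi x * cos (t * x + c)) =
    2^-1 * \int[nu]_x (psi x * cos ((t + b) * x + (c - pi / 2))) +
    2^-1 * \int[nu]_x (psi x * cos ((t - b) * x + (c + pi / 2))).
  rewrite -!intZ; [|exact: L1cos|exact: L1cos].
  rewrite -intD; [|exact/L1Z/L1cos|exact/L1Z/L1cos].
  apply: eq_Rintegral => x _.
  rewrite addrA addrA cosBpihalf cosDpihalf.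
  rewrite (_ : (t + b) * x + c = (t * x + c) + b * x); last by ring.
  rewrite (_ : (t - b) * x + c = (t * x + c) - b * x); last by ring.
  by rewrite sinD sinB; field.
rewrite (funext (fun n => E (mu_ n))) (E mu).
by apply: cvgD; apply: cvgMr; exact: cc.
Qed.

(** The recursion defining [binE] multiplies only by q and 1 - q, which are affine in sin (b x), so
    the closure properties suffice without expanding into trigonometric polynomials. *)
Let good_binE (b : R) N (g : nat -> R) : good (fun x => binE ((1 + sin (b * x)) / 2) N g).
Proof.
elim: N g => [|N IH] g /=; first exact: good_cst.
have H (psi1 psi2 : R -> R) : good psi1 -> good psi2 ->
    good (fun x => (1 + sin (b * x)) / 2 * psi1 x + (1 - (1 + sin (b * x)) / 2) * psi2 x).
  move=> g1 g2.
  rewrite (_ : (fun x => _) = fun x => (2^-1 * psi1 x + sin (b * x) * (2^-1 * psi1 x)) +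
      (2^-1 * psi2 x + sin (b * x) * (- 2^-1 * psi2 x))); last first.
    by apply/funext => x; field.
  have gZ (a : R) psi : good psi -> good (fun x => a * psi x).
    move=> gp; have [mp [M hM] cM] := gp; split; first exact: measurable_funM.
      by exists (`|a| * M) => x; rewrite normrM ler_wpM2l.
    move=> t c.
    have E (nu : probability R R) : \int[nu]_x (a * psi x * cos (t * x + c)) =
        a * \int[nu]_x (psi x * cos (t * x + c)).
      by rewrite -intZ; [apply: eq_Rintegral => x _; rewrite mulrA|exact: L1cos].
    by rewrite (funext (fun n => E (mu_ n))) (E mu); apply: cvgMr.
  by apply: goodD; apply: goodD; do ?apply: good_sin; apply: gZ.
exact: H.
Qed.

(** For |x| <= A the argument x / A lies in [-1, 1], inside [- pi / 2, pi / 2], and its sine in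
    [- sin 1, sin 1]. Clamping to this range changes nothing there and keeps [asin] away from the
    end points -1 and 1. *)
Let y0 : R := sin 1.
Let clamp (y : R) := Num.max (- y0) (Num.min y0 y).

Let y0_gt0 : 0 < y0.
Proof. by apply: sin2_gt0; rewrite ltr01 /= ltr1n. Qed.

Let y0_lt1 : y0 < 1.
Proof.
rewrite /y0 lt_neqAle sin_le1 andbT; apply/eqP => h.
have := cos1_gt0 R; have := cos2Dsin2 (1 : R); rewrite h; nra.
Qed.

(** Substituting z = (1 + sin (x / A)) / 2 turns f on [- A, A] into a continuous function of z in
    [0, 1], which Bernstein polynomials approximate. These average values of f, hence inherit the
    bound M on the whole line. *)
Lemma trig_approx (f : R -> R) (M A e : R) : continuous f -> (forall x, `|f x| <= M) ->
    0 < A -> 0 < e -> exists N g,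
  (forall x, `|x| <= A -> `|binE ((1 + sin (A^-1 * x)) / 2) N g - f x| <= e) /\
  (forall x, `|binE ((1 + sin (A^-1 * x)) / 2) N g| <= M).
Proof.
move=> cf fM A0 e0.
pose h (z : R) := f (A * asin (clamp (2 * z - 1))).
have ch : continuous h.
  move=> z.
  have c1 : clamp (2 * x - 1) @[x --> z] --> clamp (2 * z - 1).
    apply: (@continuous_max _ _ (cst (- y0)) (cst y0 \min (fun x => 2 * x - 1))).
      exact: cvg_cst.
    apply: continuous_min; first exact: cvg_cst.
    by apply: cvgB; [apply: cvgMr; exact: cvg_id|exact: cvg_cst].
  have c2 : {for clamp (2 * z - 1), continuous (@asin R)}.
    apply: continuous_asin; rewrite /clamp.
    rewrite lt_max gt_max gt_min ltrN2 y0_lt1 /= andbT.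
    by rewrite (lt_trans _ ltr01)// oppr_lt0.
  have c3 : A * asin (clamp (2 * x - 1)) @[x --> z] --> A * asin (clamp (2 * z - 1)).
    by apply: cvgMr; exact: (cvg_comp _ _ c1 c2).
  exact: (cvg_comp _ _ c3 (cf _)).
have [N N0 HN] := bernstein_approx ch (fun z => fM _) e0.
have q01 x : 0 <= (1 + sin (A^-1 * x)) / 2 <= 1.
  by have := sin_le1 (A^-1 * x); have := sin_geN1 (A^-1 * x); lra.
exists N, (fun j => h (j%:R / N%:R)); split => x.
  move=> xA; have := HN _ (q01 x); congr (`|_ - _| <= _).
  rewrite /h; congr f.
  rewrite (_ : 2 * _ - 1 = sin (A^-1 * x)); last by field.
  have x1 : -1 <= A^-1 * x <= 1.
    by rewrite -ler_norml normrM ger0_norm ?invr_ge0 ?(ltW A0)// mulrC ler_pdivrMr// mul1r.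
  have pi2 : 1 <= pi / 2 :> R := pihalf_ge1 R.
  have xpi : A^-1 * x \in `[(- (pi / 2)), pi / 2] by rewrite in_itv /=; lra.
  have one_pi : (1 : R) \in `[(- (pi / 2)), pi / 2] by rewrite in_itv /=; lra.
  have None_pi : (-1 : R) \in `[(- (pi / 2)), pi / 2] by rewrite in_itv /=; lra.
  have s1 : sin (A^-1 * x) <= y0.
    have [_ h1] := andP x1; move: h1; rewrite le_eqVlt => /predU1P[->//|h1].
    by rewrite ltW// ltr_sin.
  have s2 : - y0 <= sin (A^-1 * x).
    have [h1 _] := andP x1; move: h1; rewrite /y0 -sinN le_eqVlt => /predU1P[<-//|h1].
    by rewrite ltW// ltr_sin.
  rewrite /clamp min_r// max_r// sinK// mulrA divff ?mul1r// gt_eqF//.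
have M0 : 0 <= M by exact: le_trans (fM 0).
rewrite -[X in _ <= X](binE_cst ((1 + sin (A^-1 * x)) / 2) N M).
by apply: le_norm_binE => // j _; exact: fM.
Qed.

Lemma cvg_int_of_cos (f : R -> R) (M : R) : continuous f -> (forall x, `|f x| <= M) ->
  \int[mu_ n]_x f x @[n --> \oo] --> \int[mu]_x f x.
Proof.
move=> cf fM.
have M0 : 0 <= M by exact: le_trans (fM 0).
have mf : measurable_fun setT f by exact: continuous_measurable_fun.
have Lf (nu : probability R R) : L1 nu f by exact: (@L1_bounded _ _ _ _ _ M).
have mnorm : measurable_fun setT (fun x : R => `|x|) by exact: measurableT_comp.
(* Equal to 1 where |x| >= n > 0. The moment bound makes its integral at most C / n along the
   sequence of laws; under the limit law it tends to 0 by dominated convergence. *)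
pose tail (n : nat) (x : R) : R := Num.min 1 (n%:R^-1 * `|x|).
have tail01 n x : 0 <= tail n x <= 1.
  by rewrite le_min ge_min ler01 lexx /= andbT mulr_ge0// invr_ge0.
have mtail n : measurable_fun setT (tail n).
  apply: measurable_minr; first exact: measurable_cst.
  exact: measurable_funM.
have Ltail (nu : probability R R) n : L1 nu (tail n).
  by apply: (@L1_bounded _ _ _ _ _ 1) => // x; have /andP[? ?] := tail01 n x; rewrite ger0_norm.
have tail_cvg : \int[mu]_x tail n x @[n --> \oo] --> 0.
  have -> : 0 = \int[mu]_x (0 : R) by rewrite int0.
  apply: (cvg_int_dominated _ _ (L1_cst mu 1) _).2.
  - by move=> n; exact: mtail.
  - move=> x; apply: (@cvg_dist_le _ _ (fun n => n%:R^-1 * `|x|)).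
      near=> n; rewrite subr0 ger0_norm; last by case/andP: (tail01 n x).
      by rewrite /tail ge_min lexx orbT.
    by rewrite -[X in _ --> X](mul0r `|x|); apply: cvgMl; exact: cvg_natV0.
  - by move=> n x; have /andP[? ?] := tail01 n x; rewrite ger0_norm.
apply/cvgrPdist_le => e e0.
(* Replacing f by q costs at most e / 8 + e / 8 under each of the two laws, and the convergence for
   q costs e / 8: five eighths of e in all. *)
have e1 : 0 < e / 8 by rewrite divr_gt0.
have tail_small : exists2 A : nat, (0 < A)%N & 2 * M * A%:R^-1 * C <= e / 8 /\
    2 * M * \int[mu]_x tail A x <= e / 8.
  have h1 : 2 * M * n%:R^-1 * C @[n --> \oo] --> 0.
    rewrite -[X in _ --> X](mul0r C); apply: cvgMl.
    by rewrite -[X in _ --> X](mulr0 (2 * M)); apply: cvgMr; exact: cvg_natV0.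
  have h2 : 2 * M * \int[mu]_x tail n x @[n --> \oo] --> 0.
    by rewrite -[X in _ --> X](mulr0 (2 * M)); apply: cvgMr.
  move/cvgrPdist_le/(_ _ e1) : h1 => h1; move/cvgrPdist_le/(_ _ e1) : h2 => h2.
  near \oo => A; exists A.
    by near: A; exists 1%N.
  split.
    apply: (le_trans (ler_norm _)); rewrite -normrN -sub0r; near: A; exact: h1.
  apply: (le_trans (ler_norm _)); rewrite -normrN -sub0r; near: A; exact: h2.
have [A A0 [tA1 tA2]] := tail_small.
have A0' : 0 < A%:R :> R by rewrite ltr0n.
have [N [g [g1 g2]]] := trig_approx cf fM A0' e1.
pose q x := binE ((1 + sin (A%:R^-1 * x)) / 2) N g.
have gq : good q := good_binE A%:R^-1 N g.
have [mq _ cq] := gq.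
have Lq (nu : probability R R) : L1 nu q by exact: (@L1_bounded _ _ _ _ _ M).
have fq (nu : probability R R) : `|\int[nu]_x f x - \int[nu]_x q x| <=
    e / 8 + 2 * M * \int[nu]_x tail A x.
  rewrite -intB// -intZ// -[e / 8](int_cst nu) -intD//; [|exact: L1_cst|exact: L1Z].
  apply: le_norm_int.
  - exact: L1B.
  - by apply: L1D; [exact: L1_cst|exact: L1Z].
  - move=> x; have [xA|xA] := leP `|x| A%:R.
      rewrite distrC (le_trans (g1 x xA))// lerDl mulr_ge0//.
        by rewrite mulr_ge0.
      by case/andP: (tail01 A x).
    have -> : tail A x = 1.
      by rewrite /tail min_l// mulrC ler_pdivlMr// mul1r ltW.
    rewrite mulr1 (le_trans (ler_normB _ _))//; move: (fM x) (g2 x); rewrite -/(q x); lra.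
have {}cq : \int[mu_ n]_x q x @[n --> \oo] --> \int[mu]_x q x.
  have := cq 0 0.
  have E (nu : probability R R) : \int[nu]_x (q x * cos (0 * x + 0)) = \int[nu]_x q x.
    by apply: eq_Rintegral => x _; rewrite mul0r addr0 cos0 mulr1.
  by rewrite (funext (fun n => E (mu_ n))) (E mu).
move/cvgrPdist_le/(_ _ e1) : cq => cq.
near=> n.
have [L C1] : L1 (mu_ n) (fun x : R => `|x|) /\ \int[mu_ n]_x `|x| <= C by near: n.
have cqn : `|\int[mu]_x q x - \int[mu_ n]_x q x| <= e / 8 by near: n.
have tn : 2 * M * \int[mu_ n]_x tail A x <= e / 8.
  apply: le_trans tA1; rewrite -[_ * C]mulrA ler_wpM2l ?mulr_ge0//.
  apply: (@le_trans _ _ (A%:R^-1 * \int[mu_ n]_x `|x|)).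
    rewrite -intZ//; apply: le_int => //; first exact: L1Z.
    by move=> x; rewrite /tail ge_min lexx orbT.
  by rewrite ler_wpM2l// invr_ge0 ltW.
have := fq (mu_ n); have := fq mu.
move: cqn tn tA2; rewrite !ler_norml.
set a := \int[mu]_x q x; set b := \int[mu_ n]_x q x; set c := \int[mu]_x f x.
set a' := \int[mu_ n]_x f x => *.
lra.
Unshelve. all: by end_near. Qed.

End weak_convergence.

(* Tightness reduces continuous bounded functions to polynomials in
   sin (x / B), whose integrals are combinations of cosine transforms. *)
Lemma weak_cvg_of_cos {R : realType} (mu_ : nat -> probability R R)
    (mu : probability (measurableTypeR R) R) (C : R) :
    (\forall n \near \oo, L1 (mu_ n) (fun x : R => `|x|) /\ \int[mu_ n]_x `|x| <= C) ->
    (forall t c : R, \int[mu_ n]_x cos (t * x + c) @[n --> \oo] -->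
       \int[mu]_x cos (t * x + c)) ->
  weakly_converges mu_ mu.
Proof.
move=> tight cvg_cos f cf [M fM].
have mid : measurable_fun setT (id : measurableTypeR R -> R) by exact: measurable_id.
(* The limit law is transported along the identity to the measurable type of the other laws. *)
pose mu' : probability R R := distribution mu (RV_of mu mid).
have E (g : R -> R) (B : R) : continuous g -> (forall x, `|g x| <= B) ->
    \int[mu']_x g x = \int[mu]_x g x.
  move=> cg gB; rewrite (int_distribution (X := RV_of mu mid))//.
    exact: continuous_measurable_fun.
  apply: (@L1_bounded _ _ _ _ _ B); last by move=> x; exact: gB.
  exact: continuous_measurable_fun.
rewrite -(E f M cf fM); apply: (cvg_int_of_cos (C := C) _ _ cf fM) => // t c.
rewrite (E (fun x => cos (t * x + c)) 1)//; last by move=> x; exact: cos_max.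
by move=> x; apply: continuous_comp; [|exact: continuous_cos];
  apply: cvgD; [apply: cvgMr; exact: cvg_id|exact: cvg_cst].
Qed.

(** * A Lindeberg estimate *)

Section same_law.
Context {d : measure_display} {T : measurableType d} {R : realType}.
Variable P : probability T R.

Lemma int_same_law (X X' : T -> R) (f : R -> R) :
    measurable_fun setT X -> measurable_fun setT X' ->
    (forall B, measurable B -> P (X @^-1` B) = P (X' @^-1` B)) ->
    measurable_fun setT f -> L1 P (f \o X') ->
  L1 P (f \o X) /\ \int[P]_w f (X w) = \int[P]_w f (X' w).
Proof.
move=> mX mX' law mf LfX'.
have E (g : R -> \bar R) : (forall x, 0 <= g x)%E -> measurable_fun setT g ->
    (\int[P]_w g (X w) = \int[P]_w g (X' w))%E.
  move=> g0 mg.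
  rewrite -(@ge0_integral_distribution _ _ _ _ _ P (RV_of P mX) g)//.
  rewrite -(@ge0_integral_distribution _ _ _ _ _ P (RV_of P mX') g)//.
  by apply: eq_measure_integral => A mA _; exact: law.
have LfX : L1 P (f \o X).
  apply/integrableP; split; first by apply/measurable_EFinP; exact: measurableT_comp.
  move/integrableP : LfX' => [_]; rewrite (E (fun x => `|(f x)%:E|%E))//.
  by do 2 apply: measurableT_comp => //.
split => //.
rewrite -(int_distribution (X := RV_of P mX))// -(int_distribution (X := RV_of P mX'))//.
by congr fine; apply: eq_measure_integral => A mA _; exact: law.
Qed.

End same_law.

Section lindeberg.
Context {d : measure_display} {T : measurableType d} {R : realType}.
Variable P : probability T R.
Variable Y : nat -> T -> R.
Hypothesis mY : forall i, measurable_fun setT (Y i).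
Hypothesis indY : forall k, mutually_independent P
  (fun i : 'I_k => g_sigma_algebra_preimage (Y i)).
Hypothesis lawY : forall i B, measurable B -> P (Y i @^-1` B) = P (Y 0%N @^-1` B).
Variables m v : R.
Hypothesis L2Y : L1 P (fun w => (Y 0%N w - m) ^+ 2).
Hypothesis meanY : \int[P]_w (Y 0%N w - m) = 0.
Hypothesis varY : \int[P]_w (Y 0%N w - m) ^+ 2 = v.

Definition truncated_variance (al : R) : R :=
  \int[P]_w ((Y 0%N w - m) ^+ 2 * Num.min 1 (al * `|Y 0%N w - m|)).

Let mtv (al : R) : measurable_fun setT
  (fun w => (Y 0%N w - m) ^+ 2 * Num.min 1 (al * `|Y 0%N w - m|)).
Proof.
have mYm : measurable_fun setT (fun w => Y 0%N w - m) by exact: measurable_funB.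
apply: measurable_funM; first exact: measurable_funX.
apply: measurable_minr; first exact: measurable_cst.
by apply: measurable_funM => //; exact: measurableT_comp.
Qed.

Let tv_le (al : R) w : 0 <= al ->
  `|(Y 0%N w - m) ^+ 2 * Num.min 1 (al * `|Y 0%N w - m|)| <= (Y 0%N w - m) ^+ 2.
Proof.
move=> al0; have h : 0 <= Num.min 1 (al * `|Y 0%N w - m|).
  by rewrite le_min ler01 mulr_ge0.
rewrite ger0_norm; last exact: mulr_ge0 (sqr_ge0 _) h.
by apply: ler_piMr; rewrite ?sqr_ge0 ?ge_min ?lexx.
Qed.

Let L1tv (al : R) : 0 <= al ->
  L1 P (fun w => (Y 0%N w - m) ^+ 2 * Num.min 1 (al * `|Y 0%N w - m|)).
Proof. by move=> al0; apply: (L1_le (mtv al) _ L2Y) => w; exact: tv_le. Qed.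

(** Dominated convergence under (Y - m)^2: for identically distributed summands this is all of
    Lindeberg's condition. *)
Lemma truncated_variance_cvg0 (al : nat -> R) : (forall n, 0 <= al n) ->
  al n @[n --> \oo] --> 0 -> truncated_variance (al n) @[n --> \oo] --> 0.
Proof.
move=> al0 alcvg; rewrite -(int0 P).
apply: (cvg_int_dominated _ _ L2Y _).2.
- by move=> n; exact: mtv.
- move=> w; rewrite -(mulr0 ((Y 0%N w - m) ^+ 2)); apply: cvgMr.
  apply: (@cvg_dist_le _ _ (fun n => al n * `|Y 0%N w - m|)).
    apply: nearW => n; rewrite subr0 ger0_norm; first by rewrite ge_min lexx orbT.
    by rewrite le_min ler01 mulr_ge0.
  by rewrite -[X in _ --> X](mul0r `|Y 0%N w - m|); apply: cvgMl.
- by move=> n w; exact: tv_le.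
Qed.

Let L1Y : L1 P (fun w => Y 0%N w - m).
Proof. by apply: L1_sqr => //; exact: measurable_funB. Qed.

Let L1lw (th al : R) : `|th| <= al -> L1 P (fun w => lindeberg_weight (th * (Y 0%N w - m))) /\
  \int[P]_w lindeberg_weight (th * (Y 0%N w - m)) <= th ^+ 2 * truncated_variance al.
Proof.
move=> thal; have al0 : 0 <= al by exact: le_trans thal.
have h w : lindeberg_weight (th * (Y 0%N w - m)) <=
    th ^+ 2 * ((Y 0%N w - m) ^+ 2 * Num.min 1 (al * `|Y 0%N w - m|)).
  rewrite /lindeberg_weight exprMn mulrA.
  apply: ler_wpM2l; first exact: mulr_ge0 (sqr_ge0 _) (sqr_ge0 _).
  by rewrite le_min !ge_min lexx /= normrM ler_wpM2r ?orbT.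
have h0 w : 0 <= lindeberg_weight (th * (Y 0%N w - m)).
  by rewrite mulr_ge0 ?sqr_ge0// le_min ler01 normr_ge0.
have L : L1 P (fun w => lindeberg_weight (th * (Y 0%N w - m))).
  apply: (L1_le _ _ (L1Z (th ^+ 2) (L1tv al0))); last by move=> w; rewrite ger0_norm.
  have mYm : measurable_fun setT (fun w => th * (Y 0%N w - m)).
    by apply: measurable_funM => //; exact: measurable_funB.
  apply: measurable_funM; first exact: measurable_funX.
  by apply: measurable_minr; [exact: measurable_cst|exact: measurableT_comp].
split=> //; rewrite -intZ; last exact: L1tv.
by apply: le_int => //; apply: L1Z; exact: L1tv.
Qed.

Let mcosY i (th : R) : measurable_fun setT (fun w => cos (th * (Y i w - m))).
Proof.
apply: measurableT_comp; first exact: continuous_measurable_fun (@continuous_cos R).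
by apply: measurable_funM => //; exact: measurable_funB.
Qed.

Let msinY i (th : R) : measurable_fun setT (fun w => sin (th * (Y i w - m))).
Proof.
apply: measurableT_comp; first exact: continuous_measurable_fun (@continuous_sin R).
by apply: measurable_funM => //; exact: measurable_funB.
Qed.

(** The cosine mean and the Gaussian factor share the expansion 1 - v th^2 / 2. The remainders are
    the Lindeberg weight and (v th^2 / 2)^2; a factor th^2 is split off so that they can be
    summed. *)
Let int_cosY i (th al : R) : `|th| <= al ->
  `|\int[P]_w cos (th * (Y i w - m)) - expR (- (v * th ^+ 2 / 2))| <=
     th ^+ 2 * (3 * truncated_variance al + al ^+ 2 * v ^+ 2).
Proof.
move=> thal; have al0 : 0 <= al by exact: le_trans thal.
have v0 : 0 <= v by rewrite -varY; apply: int_ge0 => w; exact: sqr_ge0.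
have mf : measurable_fun setT (fun y : R => cos (th * (y - m))).
  apply: measurableT_comp; first exact: continuous_measurable_fun (@continuous_cos R).
  by apply: measurable_funM => //; exact: measurable_funB.
have Lcos : L1 P (fun w => cos (th * (Y 0%N w - m))).
  by apply: (@L1_bounded _ _ _ _ _ 1); [exact: mcosY|move=> w; exact: cos_max].
have [_ ->] := int_same_law (mY i) (mY 0%N) (lawY i) mf Lcos.
have [Llw intlw] := L1lw thal.
have L1q : L1 P (fun w => 1 - (th ^+ 2 / 2) * (Y 0%N w - m) ^+ 2).
  by apply: L1B; [exact: L1_cst|exact: L1Z].
have h1 : `|\int[P]_w cos (th * (Y 0%N w - m)) - (1 - v * th ^+ 2 / 2)| <=
    3 * (th ^+ 2 * truncated_variance al).
  have -> : 1 - v * th ^+ 2 / 2 = \int[P]_w (1 - (th ^+ 2 / 2) * (Y 0%N w - m) ^+ 2).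
    by rewrite intB ?int_cst ?intZ ?varY//; [ring|exact: L1_cst|exact: L1Z].
  rewrite -intB//; apply: (@le_trans _ _ (\int[P]_w (3 * lindeberg_weight (th * (Y 0%N w - m))))).
    apply: le_norm_int; [exact: L1B|exact: L1Z|move=> w].
    rewrite (_ : th ^+ 2 / 2 * _ = (th * (Y 0%N w - m)) ^+ 2 / 2); last by field.
    exact: norm_cos_taylor.
  by rewrite intZ// ler_wpM2l.
have h2 : `|expR (- (v * th ^+ 2 / 2)) - (1 - v * th ^+ 2 / 2)| <= th ^+ 2 * (al ^+ 2 * v ^+ 2).
  apply: (le_trans (norm_expRN_taylor _)).
    by rewrite divr_ge0// mulr_ge0// sqr_ge0.
  rewrite (_ : _ ^+ 2 = th ^+ 2 * (th ^+ 2 / 4 * v ^+ 2)); last by field.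
  rewrite ler_wpM2l ?sqr_ge0// ler_wpM2r ?sqr_ge0//.
  have : th ^+ 2 <= al ^+ 2 by rewrite -[th ^+ 2]real_normK ?num_real// ler_sqr ?nnegrE.
  by have := sqr_ge0 th; lra.
move: h1 h2; rewrite !ler_norml => h1 h2; lra.
Qed.

Let int_sinY i (th al : R) : `|th| <= al ->
  `|\int[P]_w sin (th * (Y i w - m))| <= th ^+ 2 * (3 * truncated_variance al).
Proof.
move=> thal.
have mf : measurable_fun setT (fun y : R => sin (th * (y - m))).
  apply: measurableT_comp; first exact: continuous_measurable_fun (@continuous_sin R).
  by apply: measurable_funM => //; exact: measurable_funB.
have Lsin : L1 P (fun w => sin (th * (Y 0%N w - m))).
  by apply: (@L1_bounded _ _ _ _ _ 1); [exact: msinY|move=> w; exact: sin_max].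
have [_ ->] := int_same_law (mY i) (mY 0%N) (lawY i) mf Lsin.
have [Llw intlw] := L1lw thal.
have -> : \int[P]_w sin (th * (Y 0%N w - m)) =
    \int[P]_w (sin (th * (Y 0%N w - m)) - th * (Y 0%N w - m)).
  by rewrite intB ?intZ ?meanY ?mulr0 ?subr0//; exact: L1Z.
apply: (@le_trans _ _ (\int[P]_w (3 * lindeberg_weight (th * (Y 0%N w - m))))).
  apply: le_norm_int; [by apply: L1B => //; exact: L1Z|exact: L1Z|move=> w].
  exact: norm_sin_taylor.
by rewrite intZ// mulrCA ler_wpM2l.
Qed.

(* The summands are replaced one at a time by Gaussian factors. *)
Lemma lindeberg_cos (th : nat -> R) (al c : R) k : (forall i, (i < k)%N -> `|th i| <= al) ->
  `|\int[P]_w cos (\sum_(i < k) th i * (Y i w - m) + c) -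
    expR (- (v * (\sum_(i < k) th i ^+ 2) / 2)) * cos c| <=
  (\sum_(i < k) th i ^+ 2) * (6 * truncated_variance al + al ^+ 2 * v ^+ 2).
Proof.
have v0 : 0 <= v by rewrite -varY; apply: int_ge0 => w; exact: sqr_ge0.
elim: k => [|k IH] thal.
  under eq_Rintegral do rewrite big_ord0 add0r.
  by rewrite !big_ord0 int_cst mulr0 mul0r oppr0 expR0 mul1r subrr normr0 mul0r.
have {}IH := IH (fun i ik => thal i (ltnW ik)).
have thk := thal k (ltnSn k).
pose X w := \sum_(i < k) th i * (Y i w - m) + c.
have mXp : measurable_fun setT (X : g_sigma_algebraType (past Y k) -> R).
  apply: measurable_funD; last exact: measurable_cst.
  apply: measurable_sum => i; apply: measurable_funM; first exact: measurable_cst.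
  apply: measurable_funB; last exact: measurable_cst.
  exact: measurable_past.
have mX : measurable_fun setT (X : T -> R).
  apply: measurable_funD; last exact: measurable_cst.
  by apply: measurable_sum => i; apply: measurable_funM => //; exact: measurable_funB.
have mc := continuous_measurable_fun (@continuous_cos R).
have ms := continuous_measurable_fun (@continuous_sin R).
have maff : measurable_fun setT (fun y : R => th k * (y - m)).
  by apply: measurable_funM => //; exact: measurable_funB.
(* Addition formula for the cosine; each product of expectations comes from the independence of
   [Y k] and the past. *)
have E : \int[P]_w cos (\sum_(i < k.+1) th i * (Y i w - m) + c) =
   (\int[P]_w cos (X w)) * (\int[P]_w cos (th k * (Y k w - m))) -
   (\int[P]_w sin (X w)) * (\int[P]_w sin (th k * (Y k w - m))).
  have Lc : L1 P (fun w => cos (X w) * cos (th k * (Y k w - m))).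
    apply: (@L1_bounded _ _ _ _ _ 1); last by move=> w; rewrite normrM mulr_ile1 ?cos_max.
    by apply: measurable_funM; [exact: measurableT_comp|exact: mcosY].
  have Ls : L1 P (fun w => sin (X w) * sin (th k * (Y k w - m))).
    apply: (@L1_bounded _ _ _ _ _ 1); last by move=> w; rewrite normrM mulr_ile1 ?sin_max.
    by apply: measurable_funM; [exact: measurableT_comp|exact: msinY].
  rewrite -(@int_mul_past _ _ _ P Y mY indY k (fun w => cos (X w)) (fun y => cos (th k * (y - m))) 1 1); first last.
  - by move=> y; exact: cos_max.
  - by move=> y; exact: cos_max.
  - exact: measurableT_comp.
  - exact: measurableT_comp.
  rewrite -(@int_mul_past _ _ _ P Y mY indY k (fun w => sin (X w)) (fun y => sin (th k * (y - m))) 1 1); first last.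
  - by move=> y; exact: sin_max.
  - by move=> y; exact: sin_max.
  - exact: measurableT_comp.
  - exact: measurableT_comp.
  rewrite -intB//; apply: eq_Rintegral => w _.
  by rewrite big_ord_recr/= -cosD /X; congr cos; ring.
rewrite E !big_ord_recr/=.
have hc := int_cosY k thk; have hs := int_sinY k thk.
set A := \int[P]_w cos (X w); set B := \int[P]_w sin (X w).
rewrite -/A in IH.
have A1 : `|A| <= 1.
  rewrite -(int_cst P 1); apply: le_norm_int.
  - by apply: (@L1_bounded _ _ _ _ _ 1); [exact: measurableT_comp|move=> w; exact: cos_max].
  - exact: L1_cst.
  - by move=> w; exact: cos_max.
have B1 : `|B| <= 1.
  rewrite -(int_cst P 1); apply: le_norm_int.
  - by apply: (@L1_bounded _ _ _ _ _ 1); [exact: measurableT_comp|move=> w; exact: sin_max].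
  - exact: L1_cst.
  - by move=> w; exact: sin_max.
set s := \sum_(i < k) th i ^+ 2 in IH *.
set Ck := \int[P]_w cos (th k * (Y k w - m)) in hc *.
set Sk := \int[P]_w sin (th k * (Y k w - m)) in hs *.
have -> : expR (- (v * (s + th k ^+ 2) / 2)) = expR (- (v * s / 2)) * expR (- (v * th k ^+ 2 / 2)).
  by rewrite -expRD; congr expR; field.
set e1 := expR (- (v * s / 2)) in IH *; set e2 := expR (- (v * th k ^+ 2 / 2)) in hc *.
have e2_le1 : `|e2| <= 1.
  rewrite ger0_norm ?expR_ge0// -expR0 ler_expR oppr_le0 divr_ge0//.
  by rewrite mulr_ge0// sqr_ge0.
(* Since |e2|, |A| and |B| are at most 1, the induction error passes through unamplified and the
   errors of the last factor add to it. *)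
have -> : A * Ck - B * Sk - e1 * e2 * cos c = (A - e1 * cos c) * e2 + (A * (Ck - e2) - B * Sk) by ring.
have g1 : `|(A - e1 * cos c) * e2| <= `|A - e1 * cos c| by rewrite normrM ler_piMr.
have g2 : `|A * (Ck - e2)| <= `|Ck - e2| by rewrite normrM ler_piMl.
have g3 : `|B * Sk| <= `|Sk| by rewrite normrM ler_piMl.
have g4 := ler_normB (A * (Ck - e2)) (B * Sk).
have g5 := ler_normD ((A - e1 * cos c) * e2) (A * (Ck - e2) - B * Sk).
have : (s + th k ^+ 2) * (6 * truncated_variance al + al ^+ 2 * v ^+ 2) =
 s * (6 * truncated_variance al + al ^+ 2 * v ^+ 2) +
 (th k ^+ 2 * (3 * truncated_variance al + al ^+ 2 * v ^+ 2) + th k ^+ 2 * (3 * truncated_variance al)) by ring.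
move=> ->; lra.
Qed.

End lindeberg.

(** * The Laplace exponent *)

Section exponential_bounds.
Context {R : realType}.
Implicit Types s t y z : R.

Lemma expB1_ge0 t : 0 <= t -> 0 <= 1 - expR (- t).
Proof. by move=> t0; rewrite subr_ge0 -expR0 ler_expR oppr_le0. Qed.

Lemma expB1_le1 t : 1 - expR (- t) <= 1.
Proof. by rewrite gerBl expR_ge0. Qed.

Lemma expB1_le t : 1 - expR (- t) <= t.
Proof. by have := expR_ge1Dx (- t); lra. Qed.

Lemma expRN_le_inv t : 0 <= t -> expR (- t) <= (1 + t)^-1.
Proof.
move=> t0; rewrite expRN lef_pV2 ?posrE ?expR_gt0 ?expR_ge1Dx//; lra.
Qed.

Lemma mul_expRN_le1 t : t * expR (- t) <= 1.
Proof.
rewrite expRN ler_pdivrMr ?expR_gt0// mul1r.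
by apply: (le_trans _ (expR_ge1Dx t)); lra.
Qed.

(** The bound does not depend on s, so the Poisson transform and the Laplace exponent differ by a
    bounded amount. For y < 1 it combines y - x <= y^2 and x >= y / 2 with t exp (- t) <= 1 at t = s
    y / 2. *)
Lemma poisson_laplace_gap s y : 0 <= s -> 0 <= y ->
  0 <= expR (- (s * (1 - expR (- y)))) - expR (- (s * y)) <= 2 * Num.min 1 y.
Proof.
move=> s0 y0; have xy := expB1_le y; have x0 := expB1_ge0 y0.
set x := 1 - expR (- y) in xy x0 *.
rewrite subr_ge0 ler_expR lerN2 ler_wpM2l//=.
have e0 := expR_ge0 (- (s * y)).
have e1 : expR (- (s * x)) <= 1 by rewrite -expR0 ler_expR oppr_le0 mulr_ge0.
have [y1|y1] := leP 1 y; first lra.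
have yx : y - x <= y ^+ 2.
  by have := norm_expRN_taylor y0; rewrite ler_norml /x; lra.
have x2 : y / 2 <= x.
  have h := expRN_le_inv y0.
  have : (1 + y)^-1 = 1 - y / (1 + y) by field; lra.
  have : y / 2 <= y / (1 + y) by rewrite ler_wpM2l// lef_pV2 ?posrE; lra.
  rewrite /x; lra.
have -> : expR (- (s * y)) = expR (- (s * x)) * expR (- (s * (y - x))).
  by rewrite -expRD; congr expR; ring.
have h1 : 1 - expR (- (s * (y - x))) <= s * y ^+ 2.
  by rewrite (le_trans (expB1_le _))// ler_wpM2l.
have h2 : expR (- (s * x)) <= expR (- (s * (y / 2))).
  by rewrite ler_expR lerN2 ler_wpM2l.
have h3 := mul_expRN_le1 (s * (y / 2)).
rewrite (_ : _ - _ = expR (- (s * x)) * (1 - expR (- (s * (y - x))))); last by ring.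
apply: (@le_trans _ _ (expR (- (s * (y / 2))) * (s * y ^+ 2))).
  apply: ler_pM => //; rewrite ?expR_ge0//.
  by rewrite expB1_ge0// mulr_ge0// subr_ge0.
rewrite (_ : _ * _ = 2 * (y * (s * (y / 2) * expR (- (s * (y / 2)))))); last by field.
by rewrite ler_wpM2l// ler_piMr.
Qed.

(** The left-hand side is at most 1 - 2^(- m) with m the integer part of t, and 2 <= e. The
    induction peels off one unit of t. *)
Lemma expB1_ge_steps I t : 0 <= t ->
  \sum_(0 <= i < I) 2^-1 ^+ i.+1 * (i.+1%:R <= t)%R%:R <= 1 - expR (- t).
Proof.
elim: I t => [|I IH] t t0; first by rewrite big_nil expB1_ge0.
have [t1|t1] := leP 1 t; last first.
  rewrite big1 ?expB1_ge0// => i _; have [h|_] := leP (i.+1%:R) t; last by rewrite mulr0.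
  have : 1 <= i.+1%:R :> R by rewrite ler1n.
  lra.
rewrite big_nat_recl// t1 mulr1 expr1.
have E i : 2^-1 ^+ i.+2 * (i.+2%:R <= t)%R%:R = 2^-1 * (2^-1 ^+ i.+1 * (i.+1%:R <= t - 1)%R%:R) :> R.
  by rewrite lerBrDr natr1 exprS mulrA.
rewrite (eq_bigr _ (fun i _ => E i)) -mulr_sumr.
have := IH (t - 1) _; rewrite subr_ge0 => /(_ t1).
set S := \sum_(_ <= _ < _) _.
have -> : expR (- (t - 1)) = expR (- t) * expR 1 by rewrite -expRD; congr expR; ring.
have : 2 <= expR (1 : R) by have := expR_ge1Dx (1 : R); lra.
have := expR_ge0 (- t); nra.
Qed.

(** Dyadic telescoping: the step from level I to I + 1 is min (t, 2 u) <= u [u <= t] + min (t, u)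
    with u = 2^(- I - 1). *)
Lemma min1_le_steps I t : 0 <= t ->
  Num.min 1 t <= \sum_(0 <= i < I) 2^-1 ^+ i.+1 * (2^-1 ^+ i.+1 <= t)%R%:R +
     Num.min t (2^-1 ^+ I).
Proof.
move=> t0; elim: I => [|I IH]; first by rewrite big_nil add0r expr0 minC.
apply: (le_trans IH); rewrite big_nat_recr//= -addrA lerD2l.
have h0 : 0 < (2^-1 : R) ^+ I.+1 by rewrite exprn_gt0// invr_gt0.
have h1 : (2^-1 : R) ^+ I = 2^-1 ^+ I.+1 + 2^-1 ^+ I.+1 by rewrite exprS; field.
have [h|h] := leP (2^-1 ^+ I.+1) t.
  by rewrite mulr1 [leRHS](_ : _ = 2^-1 ^+ I) ?ge_min ?lexx ?orbT// h1; congr (_ + _); rewrite min_r.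
rewrite mulr0 add0r ge_min; apply/orP; left; lra.
Qed.

Lemma sum_half I : \sum_(0 <= i < I) (2^-1 : R) ^+ i.+1 = 1 - 2^-1 ^+ I.
Proof.
elim: I => [|I IH]; first by rewrite big_nil expr0 subrr.
by rewrite big_nat_recr//= IH exprS; field.
Qed.

Lemma sum_nat_half I : \sum_(0 <= i < I) (2^-1 : R) ^+ i.+1 * i.+1%:R <= 2.
Proof.
suff -> : \sum_(0 <= i < I) (2^-1 : R) ^+ i.+1 * i.+1%:R = 2 - (I%:R + 2) * 2^-1 ^+ I.
  by rewrite gerBl mulr_ge0// ?addr_ge0// exprn_ge0// invr_ge0.
elim: I => [|I IH]; first by rewrite big_nil expr0; ring.
by rewrite big_nat_recr//= IH -natr1 exprS; field.
Qed.

Lemma cvg_half : (2^-1 : R) ^+ I @[I --> \oo] --> 0.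
Proof. by apply: cvg_expr; rewrite ger0_norm ?invr_ge0// invf_lt1 ?ltr1n. Qed.

Lemma ln_natS_le (i : nat) : ln (i.+1%:R : R) <= i.+1%:R.
Proof. by apply/ltW/ln_sublinear. Qed.

End exponential_bounds.

Section levy_integrals.
Context {R : realType}.
Variable nu : {measure set R -> \bar R}.
Hypothesis levy : is_levy_measure nu.
Local Notation pos y := (Num.max 0 y).

Lemma pos_ge0 (y : R) : 0 <= pos y. Proof. by rewrite le_max lexx. Qed.

Lemma measurable_pos : measurable_fun setT (fun y : R => pos y).
Proof. by apply: measurable_maxr => //; exact: measurable_cst. Qed.

(** Precomposing with [pos] extends functions vanishing at 0, so that integrals over the half-line
    become integrals over R, to which the calculus of [L1] applies without domains. *)
Lemma int_itv_pos (f : R -> R) : f 0 = 0 ->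
  \int[nu]_(y in `]0, +oo[) f y = \int[nu]_y f (pos y).
Proof.
move=> f0; rewrite Rintegral_mkcond; apply: eq_Rintegral => y _.
rewrite patchE; case: ifPn => [|]; rewrite ?inE ?notin_setE /= in_itv/= andbT.
  by move=> y0; rewrite max_r// ltW.
by move=> /negP; rewrite -leNgt => y0; rewrite max_l.
Qed.

Lemma L1_min1 : L1 nu (fun y => Num.min 1 (pos y)).
Proof.
have m1 : measurable_fun setT (fun y : R => Num.min 1 (pos y)).
  by apply: measurable_minr; [exact: measurable_cst|exact: measurable_pos].
apply/integrableP; split; first exact/measurable_EFinP.
have [_] := levy.
suff -> : (\int[nu]_(y in `]0%R, +oo[) (Num.min 1 y)%:E =
  \int[nu]_x `|(EFin \o (fun y : R => Num.min 1%R (pos y))) x|)%E by [].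
rewrite integral_mkcond; apply: eq_integral => y _.
rewrite patchE /= ger0_norm; last by rewrite le_min ler01 pos_ge0.
case: ifPn => [|]; rewrite ?inE ?notin_setE /= in_itv/= andbT.
  by move=> y0; rewrite (max_r (ltW y0)).
move=> /negP; rewrite -leNgt => y0; rewrite (max_l y0) min_r//.
Qed.

Definition mass1 : R := \int[nu]_y Num.min 1 (pos y).

Local Notation phi := (laplace_exponent nu).

Lemma laplace_exponentE s : phi s = \int[nu]_y (1 - expR (- (s * pos y))).
Proof.
rewrite /laplace_exponent (int_itv_pos (f := fun y => 1 - expR (- (s * y))))//.
by rewrite mulr0 oppr0 expR0 subrr.
Qed.

Lemma momentE j : (0 < j)%N -> moment nu j = \int[nu]_y (pos y) ^+ j.
Proof.
by move=> j0; rewrite /moment (int_itv_pos (f := fun y => y ^+ j))// expr0n gtn_eqF.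
Qed.

Lemma measurable_expB1 (s : R) : measurable_fun setT (fun y : R => 1 - expR (- (s * pos y))).
Proof.
apply: measurable_funB; first exact: measurable_cst.
apply: measurableT_comp => //; apply: measurableT_comp => //.
by apply: measurable_funM; [exact: measurable_cst|exact: measurable_pos].
Qed.

Lemma expB1_le_min1 s (y : R) : 0 <= s -> 1 - expR (- (s * pos y)) <= (1 + s) * Num.min 1 (pos y).
Proof.
move=> s0; have y0 := pos_ge0 y; set x := pos y in y0 *.
have [x1|x1] := leP 1 x; first by have := expB1_le1 (s * x); lra.
have := expB1_le (s * x); nra.
Qed.

Lemma L1_expB1 s : 0 <= s -> L1 nu (fun y => 1 - expR (- (s * pos y))).
Proof.
move=> s0; apply: (L1_le (measurable_expB1 s) _ (L1Z (1 + s) L1_min1)) => y.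
rewrite ger0_norm; first exact: expB1_le_min1.
by rewrite expB1_ge0// mulr_ge0// pos_ge0.
Qed.

Lemma laplace_exponent_ge0 s : 0 <= s -> 0 <= phi s.
Proof.
move=> s0; rewrite laplace_exponentE; apply: int_ge0 => y.
by rewrite expB1_ge0// mulr_ge0// pos_ge0.
Qed.

Lemma le_laplace_exponent s t : 0 <= s -> s <= t -> phi s <= phi t.
Proof.
move=> s0 st; rewrite !laplace_exponentE; apply: le_int.
- exact: L1_expB1.
- by apply: L1_expB1; exact: le_trans st.
- by move=> y; rewrite lerD2l lerN2 ler_expR lerN2 ler_wpM2r// pos_ge0.
Qed.

Lemma bernoulli_expB1 (n : nat) (x : R) : 0 <= x ->
  1 - expR (- (n%:R * x)) <= n%:R * (1 - expR (- x)).
Proof.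
move=> x0; elim: n => [|n IH]; first by rewrite !mul0r oppr0 expR0 subrr.
rewrite -natr1 (_ : - (_ * x) = - (n%:R * x) + - x); last by ring.
rewrite expRD; have h1 := expB1_ge0 x0; have := expR_ge0 (- (n%:R * x)).
have : expR (- (n%:R * x)) <= 1 by rewrite -expR0 ler_expR oppr_le0 mulr_ge0.
nra.
Qed.

(** Subadditivity of 1 - exp (- x); it turns the unboundedness of the exponent at integers into its
    positivity at 1. *)
Lemma laplace_exponent_le_mul (n : nat) : phi n%:R <= n%:R * phi 1.
Proof.
rewrite !laplace_exponentE -intZ; last exact: L1_expB1.
apply: le_int; [exact: L1_expB1|by apply: L1Z; exact: L1_expB1|move=> y].
by rewrite mul1r; apply: bernoulli_expB1; exact: pos_ge0.
Qed.

Let ge_indic (y x : R) := (y <= x)%R%:R : R.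

Lemma ge_indicE y : ge_indic y = \1_(`[y, +oo[).
Proof.
apply/funext => x; rewrite /ge_indic indicE; congr (nat_of_bool _)%:R.
by apply/idP/idP => [yx|]; rewrite ?inE /= in_itv/= andbT.
Qed.

Lemma L1_ge_indic (y : R) : 0 < y -> L1 nu (fun x => (y <= pos x)%R%:R).
Proof.
move=> y0.
have E (x : R) : (y <= pos x)%R%:R = ge_indic y x.
  rewrite /ge_indic le_max; congr (nat_of_bool _)%:R.
  by rewrite (lt_geF y0).
apply: (@L1_le _ R R nu _ (fun x : R => (Num.min 1 y)^-1 * Num.min 1 (pos x))).
- rewrite (_ : (fun x => _) = \1_(`[y, +oo[)); last first.
    by rewrite -ge_indicE; apply/funext => x; rewrite E.
  exact: measurable_indic.
- move=> x; rewrite ger0_norm ?ler0n//.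
  have m0 : 0 < Num.min 1 y by rewrite lt_min ltr01 y0.
  have [yx|yx] := leP y (pos x).
    by rewrite mulrC ler_pdivlMr// mul1r le_min !ge_min lexx yx orbT.
  by rewrite mulr_ge0// ?invr_ge0 ?(ltW m0)// le_min ler01 pos_ge0.
- by apply: L1Z; exact: L1_min1.
Qed.

Lemma nu_tailE (y : R) : 0 < y -> nu_tail nu y = \int[nu]_x (y <= pos x)%R%:R.
Proof.
move=> y0; rewrite /nu_tail -[in LHS](setIT `[y, +oo[%classic) -integral_indic//.
congr fine; apply: eq_integral => x _; congr (_%:E).
rewrite -ge_indicE /ge_indic le_max; congr (nat_of_bool _)%:R.
by rewrite (lt_geF y0).
Qed.

Lemma nu_tail_ge0 (y : R) : 0 <= nu_tail nu y.
Proof. by rewrite fine_ge0. Qed.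

(* Layer-cake comparison of [1 - exp (- s y)] with sums of indicators of the
   half-lines [i / s, oo[ from below and [2 ^ - i / s, oo[ from above. *)
Lemma laplace_exponent_ge_tail (C : R) s : 0 < s ->
    (forall y, 0 < y -> - ln y - C <= nu_tail nu y) ->
  ln s - C - 2 <= phi s.
Proof.
move=> s0 tail.
(* Level i contributes the tail at (i + 1) / s, at least ln s - ln (i + 1) - C. With ln (i + 1) <= i
   + 1, the weights 2^(- i - 1) have total 1 - 2^(- I) and first moment at most 2. *)
have ge I : (ln s - C) * (1 - 2^-1 ^+ I) - 2 <= phi s.
  apply: (@le_trans _ _ (\sum_(0 <= i < I) 2^-1 ^+ i.+1 * nu_tail nu (i.+1%:R / s))).
    apply: (@le_trans _ _ (\sum_(0 <= i < I) (2^-1 ^+ i.+1 * (ln s - C) - 2^-1 ^+ i.+1 * i.+1%:R))).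
      rewrite sumrB -mulr_suml sum_half mulrC lerD2l lerN2; exact: sum_nat_half.
    apply: ler_sum => i _; rewrite -mulrBr ler_wpM2l ?exprn_ge0 ?invr_ge0//.
    apply: (le_trans _ (tail _ _)); last by rewrite divr_gt0.
    rewrite ln_div ?posrE//; have := @ln_natS_le R i; lra.
  have L i : L1 nu (fun y => 2^-1 ^+ i.+1 * (i.+1%:R / s <= pos y)%R%:R).
    by apply: L1Z; apply: L1_ge_indic; rewrite divr_gt0.
  rewrite (eq_bigr (fun i => \int[nu]_y (2^-1 ^+ i.+1 * (i.+1%:R / s <= pos y)%R%:R))); last first.
    by move=> i _; rewrite nu_tailE ?divr_gt0// intZ//; apply: L1_ge_indic; rewrite divr_gt0.
  rewrite -int_sum// laplace_exponentE; apply: le_int.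
  - exact: L1_sum.
  - by apply: L1_expB1; exact: ltW.
  - move=> y; apply: (le_trans _ (@expB1_ge_steps R I (s * pos y) _)).
      by apply: ler_sum => i _; rewrite ler_pdivrMr// [pos y * s]mulrC.
    by rewrite mulr_ge0 ?pos_ge0// ltW.
have : (ln s - C) * (1 - 2^-1 ^+ I) - 2 @[I --> \oo] --> (ln s - C) * (1 - 0) - 2.
  apply: cvgB; last exact: cvg_cst.
  by apply: cvgMr; apply: cvgB; [exact: cvg_cst|exact: cvg_half].
rewrite subr0 mulr1 => H; apply: (cvgr_to_le H); exact: nearW.
Qed.

Lemma laplace_exponent_le_tail (C y0 s : R) : 0 < y0 -> 0 <= C -> 1 <= s -> y0^-1 <= s ->
    (forall y, 0 < y -> y <= y0 -> nu_tail nu y <= - ln y + C) ->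
  phi s <= ln s + C + 2.
Proof.
move=> y00 C0 s1 sy0 tail.
have s0 : 0 < s by exact: lt_le_trans s1.
have hpos I : 0 < 2^-1 ^+ I / s by rewrite divr_gt0// exprn_gt0// invr_gt0.
have Lr I : L1 nu (fun y => Num.min (s * pos y) (2^-1 ^+ I)).
  apply: (@L1_le _ R R nu _ (fun y : R => (1 + s) * Num.min 1 (pos y))).
  - apply: measurable_minr; last exact: measurable_cst.
    by apply: measurable_funM; [exact: measurable_cst|exact: measurable_pos].
  - move=> y; have p0 := pos_ge0 y.
    rewrite ger0_norm ?le_min ?mulr_ge0 ?exprn_ge0 ?invr_ge0 ?(ltW s0)//.
    have h1 : 2^-1 ^+ I <= 1 :> R by rewrite exprn_ile1 ?invr_ge0// invf_le1 ?ler1n.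
    rewrite ge_min; apply/orP.
    by have [h|h] := leP 1 (pos y); [right|left]; nra.
  - by apply: L1Z; exact: L1_min1.
(* What the first I dyadic levels leave uncovered; it vanishes by dominated convergence. *)
have rem : \int[nu]_y Num.min (s * pos y) (2^-1 ^+ I) @[I --> \oo] --> 0.
  rewrite -[X in _ --> X](int0 nu); apply: (cvg_int_dominated _ _ (Lr 0%N) _).2.
  - by move=> n; exact: L1_measurable (Lr n).
  - move=> y; apply: (cvg_dist_le _ cvg_half); apply: nearW => n.
    rewrite subr0 ger0_norm ?ge_min ?lexx ?orbT//.
    by rewrite le_min mulr_ge0 ?pos_ge0 ?(ltW s0)// exprn_ge0// invr_ge0.
  - move=> n y; rewrite ger0_norm; last first.
      by rewrite le_min mulr_ge0 ?pos_ge0 ?(ltW s0)// exprn_ge0// invr_ge0.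
    rewrite expr0 le_min !ge_min lexx /=; apply/orP; right.
    by rewrite exprn_ile1 ?invr_ge0// invf_le1 ?ler1n.
have le I : phi s <= ln s + C + 2 + \int[nu]_y Num.min (s * pos y) (2^-1 ^+ I).
  have L i : L1 nu (fun y => 2^-1 ^+ i.+1 * (2^-1 ^+ i.+1 / s <= pos y)%R%:R).
    by apply: L1Z; exact: L1_ge_indic.
  apply: (@le_trans _ _ (\sum_(0 <= i < I) 2^-1 ^+ i.+1 * nu_tail nu (2^-1 ^+ i.+1 / s)
      + \int[nu]_y Num.min (s * pos y) (2^-1 ^+ I))).
    rewrite (eq_bigr (fun i => \int[nu]_y (2^-1 ^+ i.+1 * (2^-1 ^+ i.+1 / s <= pos y)%R%:R))); last first.
      by move=> i _; rewrite nu_tailE// intZ//; exact: L1_ge_indic.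
    rewrite -int_sum// -intD//; last exact: L1_sum.
    rewrite laplace_exponentE; apply: le_int.
    - by apply: L1_expB1; exact: ltW.
    - by apply: L1D => //; exact: L1_sum.
    - move=> y; apply: (@le_trans _ _ (Num.min 1 (s * pos y))).
        by rewrite le_min expB1_le1 expB1_le.
      apply: (le_trans (@min1_le_steps R I (s * pos y) _)).
        by rewrite mulr_ge0 ?pos_ge0// ltW.
      by rewrite lerD2r; apply: ler_sum => i _; rewrite ler_pdivrMr// [pos y * s]mulrC.
  rewrite lerD2r.
  apply: (@le_trans _ _ (\sum_(0 <= i < I) (2^-1 ^+ i.+1 * (ln s + C) + 2^-1 ^+ i.+1 * i.+1%:R))).
    apply: ler_sum => i _; rewrite -mulrDr ler_wpM2l ?exprn_ge0 ?invr_ge0//.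
    apply: (le_trans (tail _ (hpos _) _)).
      rewrite ler_pdivrMr//; apply: (@le_trans _ _ 1).
        by rewrite exprn_ile1 ?invr_ge0// invf_le1 ?ler1n.
      by move: sy0; rewrite -div1r ler_pdivrMr// mulrC.
    have lnE : ln (2^-1 ^+ i.+1) = - (i.+1%:R * ln 2) :> R.
      by rewrite lnXn ?invr_gt0// lnV ?posrE// mulNrn mulr_natl.
    rewrite ln_div ?posrE ?exprn_gt0 ?invr_gt0// lnE.
    have l2 : ln 2 <= 1 :> R by have := @le_ln1Dx R 1; rewrite -[1 + 1]/(2 : R); apply; lra.
    have : 0 <= i.+1%:R :> R by [].
    nra.
  rewrite big_split/= -mulr_suml sum_half.
  have := @sum_nat_half R I; have := @ln_ge0 R s s1.
  have : 0 <= 2^-1 ^+ I :> R by rewrite exprn_ge0// invr_ge0.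
  nra.
have : ln s + C + 2 + \int[nu]_y Num.min (s * pos y) (2^-1 ^+ I) @[I --> \oo] --> ln s + C + 2 + 0.
  by apply: cvgD => //; exact: cvg_cst.
rewrite addr0 => H; apply: (cvgr_to_ge H); exact: nearW.
Qed.

End levy_integrals.

Section landau_bounds.
Context {R : realType}.

Lemma bigO_at_infinity_bounded (f g : R -> R) (eps : R) : 0 < eps ->
    f = g +O_at_infinity (fun rho => rho `^ (- eps)) ->
  exists A C : R, 1 <= A /\ forall x, A <= x -> `|f x - g x| <= C.
Proof.
move=> eps0 /eqaddOP/bigO_exP[k k0 [A [_ HA]]].
exists (Num.max 1 (A + 1)), k; split; first by rewrite le_max lexx.
move=> x; rewrite ge_max => /andP[x1 xA].
have /HA : A < x by rewrite (lt_le_trans _ xA)// ltrDl.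
move=> /le_trans; apply; rewrite ler_piMr ?(ltW k0)//.
rewrite ger0_norm ?powR_ge0// -(powRr0 x) ler_powR// oppr_le0 ltW//.
Qed.

Lemma bigO_at_right0_bounded (f g : R -> R) (eps : R) : 0 < eps ->
    f = g +O_ (0^'+) (fun y => y `^ eps) ->
  exists y0 C : R, 0 < y0 <= 1 /\ forall y, 0 < y -> y <= y0 -> `|f y - g y| <= C.
Proof.
move=> eps0 /eqaddOP/bigO_exP[k k0 [r /= r0 Hr]].
exists (Num.min 1 (r / 2)), k; split.
  by rewrite lt_min ltr01 divr_gt0//= ge_min lexx.
move=> y y0; rewrite le_min => /andP[y1 yr].
have /Hr/(_ y0) : ball_ [eta Num.Def.normr] 0 r y.
  by rewrite /ball_ /= sub0r normrN ger0_norm ?ltW//; lra.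
move=> /le_trans; apply; rewrite ler_piMr ?(ltW k0)//.
by rewrite ger0_norm ?powR_ge0// -(powRr0 y) ger_powR ?y0//= ?ltW.
Qed.

End landau_bounds.

Section laplace_exponent_log.
Context {R : realType}.
Variable nu : {measure set R -> \bar R}.
Hypothesis levy : is_levy_measure nu.
Local Notation pos y := (Num.max 0 y).
Local Notation phi := (laplace_exponent nu).

(** The common form into which the four alternatives of [condition_L] are brought; the constant c
    and Euler's constant are absorbed into C. *)
Let log_bound := exists A C : R, 1 <= A /\ forall x, A <= x -> `|phi x - ln x| <= C.

Let tail_log_bound := exists y0 C : R, 0 < y0 <= 1 /\
  forall y, 0 < y -> y <= y0 -> `|nu_tail nu y + ln y| <= C.

Let log_of_tail : tail_log_bound -> log_bound.
Proof.
move=> [y0 [C [/andP[y00 y01] H]]].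
have C0 : 0 <= C by apply: le_trans (H y0 y00 (lexx _)).
exists y0^-1, (C - ln y0 + 2); split; first by rewrite -[leLHS]invr1 lef_pV2 ?posrE.
have l0 : ln y0 <= 0 by exact: ln_le0.
move=> x xy0.
have x1 : 1 <= x by apply: le_trans xy0; rewrite -[leLHS]invr1 lef_pV2 ?posrE.
have up : phi x <= ln x + C + 2.
  apply: (laplace_exponent_le_tail levy y00 C0 x1 xy0) => y y_gt0 yy0.
  by have := H y y_gt0 yy0; rewrite ler_norml; lra.
have low : ln x - (C - ln y0) - 2 <= phi x.
  apply: laplace_exponent_ge_tail => //; first exact: lt_le_trans x1.
  (* The lower comparison needs the tail at every y > 0. Beyond y0 its nonnegativity suffices, since
     C has been replaced by C - ln y0. *)
  move=> y y_gt0; have [yy0|yy0] := leP y y0.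
    by have := H y y_gt0 yy0; rewrite ler_norml; lra.
  apply: (le_trans _ (nu_tail_ge0 nu y)).
  have : ln y0 <= ln y by rewrite ler_ln ?posrE// ltW.
  lra.
by rewrite ler_norml; lra.
Qed.

Let exp_squash_preimage (x : R) : exp_squash @^-1` `[x, 1]%classic = [set y | x <= exp_squash y].
Proof.
apply/seteqP; split => y /=; rewrite in_itv/=; first by case/andP.
by move=> ->; rewrite /exp_squash gerBl expR_ge0.
Qed.

Lemma nu_tilde_tailE (y : R) : 0 < y -> nu_tilde_tail nu (exp_squash y) = nu_tail nu y.
Proof.
move=> y0; rewrite /nu_tilde_tail /nu_tilde /pushforward exp_squash_preimage /nu_tail.
congr (fine (nu _)); apply/seteqP; split => z /=; rewrite in_itv/= andbT.
  by rewrite /exp_squash lerD2l lerN2 ler_expR lerN2.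
by rewrite /exp_squash lerD2l lerN2 ler_expR lerN2.
Qed.

(** For 0 < y <= 1 the squashed point lies in [y / 2, y], so the logarithms differ by at most ln 2
    <= 1. *)
Let tail_of_tilde (y0 C : R) : 0 < y0 <= 1 ->
  (forall x, 0 < x -> x <= y0 -> `|nu_tilde_tail nu x + ln x| <= C) -> tail_log_bound.
Proof.
move=> y01 H; exists y0, (C + 1); split => // y y_gt0 yy0.
have y1 : y <= 1 by case/andP: y01 => _; exact: le_trans.
have x1 : exp_squash y <= y by exact: expB1_le.
have x2 : y / 2 <= exp_squash y.
  have h := expRN_le_inv (ltW y_gt0).
  have : (1 + y)^-1 = 1 - y / (1 + y) by field; lra.
  have : y / 2 <= y / (1 + y) by rewrite ler_wpM2l ?(ltW y_gt0)// lef_pV2 ?posrE; lra.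
  rewrite /exp_squash; lra.
have x0 : 0 < exp_squash y by apply: lt_le_trans x2; rewrite divr_gt0.
have := H _ x0 (le_trans x1 yy0); rewrite nu_tilde_tailE// !ler_norml.
have : ln (exp_squash y) <= ln y by rewrite ler_ln ?posrE.
have : ln (y / 2) <= ln (exp_squash y) by rewrite ler_ln ?posrE// divr_gt0.
rewrite ln_div ?posrE//.
have l2 : ln 2 <= 1 :> R by have := @le_ln1Dx R 1; rewrite -[1 + 1]/(2 : R); apply; lra.
lra.
Qed.

Let poissonE s : 0 <= s -> poisson_transform nu s =
  \int[nu]_y (1 - expR (- (s * (1 - expR (- pos y))))).
Proof.
move=> s0; rewrite /poisson_transform /nu_tilde.
have mexp : measurable_fun setT (@exp_squash R).
  apply: measurable_funB; first exact: measurable_cst.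
  by apply: measurableT_comp => //; exact: measurableT_comp.
have mg : measurable_fun (`[0, 1]%classic : set R) (fun x : R => (1 - expR (- (s * x)))%:E).
  apply/measurable_EFinP/measurable_funTS; apply: measurable_funB; first exact: measurable_cst.
  apply: continuous_measurable_fun => x.
  apply: (@cvg_comp _ _ _ (fun x : R => - (s * x)) (@expR R) _ _ _ _ (@continuous_expR R _)).
  by apply: cvgN; apply: cvgMr; exact: cvg_id.
have g0 : {in (`[0, 1]%classic : set R), forall x : R, (0 <= (1 - expR (- (s * x)))%:E)%E}.
  move=> x; rewrite inE /= in_itv/= => /andP[x0 _].
  by rewrite lee_fin expB1_ge0// mulr_ge0.
have mD : measurable (`[0, 1]%classic : set R) by exact: measurable_itv.
rewrite (@ge0_integral_pushforward _ _ R R R (@exp_squash R) mexp nu _ _ mD mg g0).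
rewrite integral_mkcond; congr fine; apply: eq_integral => y _.
rewrite patchE; case: ifPn => [|]; rewrite ?inE ?notin_setE /= in_itv/= /exp_squash gerBl expR_ge0 andbT subr_ge0 -[X in _ <= X]expR0 ler_expR oppr_le0.
  by move=> y0; rewrite max_r.
by move=> /negP; rewrite -ltNge => y0; rewrite max_l ?(ltW y0)// oppr0 expR0 subrr mulr0 oppr0 expR0 subrr.
Qed.

Let poisson_gap s : 0 <= s -> `|poisson_transform nu s - phi s| <= 2 * mass1 nu.
Proof.
move=> s0; rewrite poissonE// laplace_exponentE.
have Lp : L1 nu (fun y => 1 - expR (- (s * (1 - expR (- pos y))))).
  apply: (@L1_le _ R R nu _ (fun y : R => (1 + s) * Num.min 1 (pos y))).
  - apply: measurable_funB; first exact: measurable_cst.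
    apply: measurableT_comp => //; apply: measurableT_comp => //.
    apply: measurable_funM; first exact: measurable_cst.
    apply: measurable_funB; first exact: measurable_cst.
    apply: measurableT_comp => //; apply: measurableT_comp => //; exact: measurable_pos.
  - move=> y; have p0 := pos_ge0 y; have x0 := expB1_ge0 p0.
    rewrite ger0_norm; last by rewrite expB1_ge0// mulr_ge0.
    apply: (le_trans _ (expB1_le_min1 y s0)); rewrite lerD2l lerN2 ler_expR lerN2.
    by rewrite ler_wpM2l// expB1_le.
  - by apply: L1Z; exact: L1_min1.
rewrite -intB//; last exact: L1_expB1.
rewrite /mass1 -intZ; last exact: L1_min1.
apply: le_norm_int; [by apply: L1B => //; exact: L1_expB1|by apply: L1Z; exact: L1_min1|move=> y].
have := poisson_laplace_gap s0 (pos_ge0 y); rewrite ler_norml; lra.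
Qed.

(** The shift to j + 1 under the logarithm lets the bound cover j = 0. Below the threshold A of the
    asymptotics both terms are bounded, being monotone. *)
Lemma laplace_exponent_log : condition_L nu ->
  exists2 C : R, 0 <= C & forall j : nat, `|phi j%:R - ln j.+1%:R| <= C.
Proof.
move=> [c [eps [eps0 H]]].
have : log_bound.
  case: H => H.
  - have [A [C [A1 HA]]] := bigO_at_infinity_bounded eps0 H.
    exists A, (C + `|c|); split => // x /HA.
    by have := ler_norm c; have := ler_norm (- c); rewrite normrN !ler_norml; lra.
  - have [A [C [A1 HA]]] := bigO_at_infinity_bounded eps0 H.
    exists A, (C + `|c| + 2 * mass1 nu); split => // x Ax.
    have x0 : 0 <= x by apply: le_trans Ax; exact: le_trans A1.
    have := HA x Ax; have := poisson_gap x0.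
    by have := ler_norm c; have := ler_norm (- c); rewrite normrN !ler_norml; lra.
  - have [y0 [C [y01 Hy]]] := bigO_at_right0_bounded eps0 H.
    apply: log_of_tail; exists y0, (C + `|c - euler_gamma|); split => // y y_gt0 yy0.
    have := Hy y y_gt0 yy0; set c' := c - euler_gamma.
    rewrite (_ : - ln y + c - euler_gamma = - ln y + c'); last by rewrite /c'; ring.
    by have := ler_norm c'; have := ler_norm (- c'); rewrite normrN !ler_norml; lra.
  - have [y0 [C [y01 Hy]]] := bigO_at_right0_bounded eps0 H.
    apply: log_of_tail; apply: (tail_of_tilde (C := C + `|c - euler_gamma|) y01) => y y_gt0 yy0.
    have := Hy y y_gt0 yy0; set c' := c - euler_gamma.
    rewrite (_ : - ln y + c - euler_gamma = - ln y + c'); last by rewrite /c'; ring.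
    by have := ler_norm c'; have := ler_norm (- c'); rewrite normrN !ler_norml; lra.
move=> [A [C [A1 HA]]].
have A0 : 0 <= A by exact: le_trans A1.
have C0 : 0 <= C by exact: le_trans (HA A (lexx _)).
have pA := laplace_exponent_ge0 nu A0.
have lA : 0 <= ln (A + 1) by rewrite ln_ge0// lerDr.
exists (C + 1 + phi A + ln (A + 1)); first by lra.
move=> j; have [jA|jA] := leP A j%:R.
  have j0 : 0 < j%:R :> R by apply: lt_le_trans jA; exact: lt_le_trans A1.
  have l1 : ln j%:R <= ln j.+1%:R :> R by rewrite ler_ln ?posrE// ler_nat.
  have l2 : ln j.+1%:R <= ln j%:R + 1 :> R.
    rewrite -[j.+1%:R]natr1 (_ : j%:R + 1 = j%:R * (1 + j%:R^-1)); last by field; rewrite gt_eqF.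
    have h : 0 < j%:R^-1 :> R by rewrite invr_gt0.
    rewrite lnM ?posrE//.
    rewrite lerD2l; apply: (le_trans (@le_ln1Dx R _ _)); first by apply: lt_trans h; rewrite oppr_lt0.
    by rewrite invf_le1//; exact: le_trans jA.
  move: (HA _ jA) l1 l2 pA lA; rewrite !ler_norml.
  move: (phi j%:R) (phi A) (ln (A + 1)) (ln (j%:R : R)) (ln (j.+1%:R : R)) => p q r s t.
  by lra.
have p0 := laplace_exponent_ge0 nu (ler0n R j).
have p1 : phi j%:R <= phi A by apply: le_laplace_exponent => //; exact: ltW.
have l0 : 0 <= ln j.+1%:R :> R by rewrite ln_ge0// ler1n.
have l1 : ln j.+1%:R <= ln (A + 1).
  by rewrite ler_ln ?posrE// -?natr1 ?lerD2r ?(ltW jA)//; lra.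
move: p0 p1 l0 l1; rewrite ler_norml.
move: pA lA (phi j%:R) (phi A) (ln (A + 1)) (ln (j.+1%:R : R)) => _ _ p q r t.
by lra.
Qed.

Hypothesis cL : condition_L nu.

Lemma laplace_exponent_eventually_gt (B : R) : exists j : nat, (0 < j)%N /\ B < phi j%:R.
Proof.
have [C C0 HC] := laplace_exponent_log cL.
pose j := (Num.truncn (expR (B + C))).+1.
exists j; split=> //.
have jB : B + C < ln j.+1%:R.
  rewrite -[ltLHS]expRK ltr_ln ?posrE ?expR_gt0//.
  apply: (lt_trans (truncnS_gt _)); by rewrite ltr_nat.
by have := HC j; rewrite ler_norml; lra.
Qed.

Lemma laplace_exponent1_gt0 : 0 < phi 1.
Proof.
have [j [j0 Hj]] := laplace_exponent_eventually_gt 0.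
have := lt_le_trans Hj (laplace_exponent_le_mul levy j).
by rewrite pmulr_rgt0 ?ltr0n.
Qed.

End laplace_exponent_log.

Lemma L1_of_bounded_int (d : measure_display) (T : measurableType d) (R : realType)
    (mu : {measure set T -> \bar R}) (f_ : nat -> T -> R) (f : T -> R) (B : R) :
    (forall n, L1 mu (f_ n)) -> (forall n x, 0 <= f_ n x) ->
    (forall x, {homo f_^~ x : n m / (n <= m)%N >-> n <= m}) ->
    (forall x, f_ n x @[n --> \oo] --> f x) ->
    (forall n, \int[mu]_x f_ n x <= B) ->
  L1 mu f.
Proof.
move=> Lf f0 fnd ff fB.
have nd : nondecreasing_seq (fun n => \int[mu]_x f_ n x).
  by move=> n m nm; apply: le_int => // x; exact: fnd.
have cv : cvgn (fun n => \int[mu]_x f_ n x).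
  by apply: nondecreasing_is_cvgn => //; exists B => _ [n _ <-].
by have [] := int_monotone Lf f0 fnd ff cv.
Qed.

(** * First two moments of the Levy measure *)

Section levy_moments.
Context {R : realType}.
Variable nu : {measure set R -> \bar R}.
Hypothesis levy : is_levy_measure nu.
Local Notation pos y := (Num.max 0 y).
Local Notation phi := (laplace_exponent nu).

Let exp_tail : condition_R nu -> exists A k e : R, [/\ 1 <= A, 0 <= k, 0 < e &
  forall y, A <= y -> nu_tail nu y <= k * expR (- (e * y))].
Proof.
move=> [e [e0 [H|H]]].
  move/eqO_exP: H => [k k0 [A [_ HA]]].
  exists (Num.max 1 (A + 1)), k, e; split=> //; first by rewrite le_max lexx.
    exact: ltW.
  move=> y; rewrite ge_max => /andP[_ yA].
  have /HA : A < y by rewrite (lt_le_trans _ yA)// ltrDl.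
  by rewrite ger0_norm ?nu_tail_ge0// ger0_norm ?expR_ge0.
move/eqO_exP: H => [k k0 [r /= r0 Hr]].
(* For y >= 1 - ln r the squashed point 1 - exp (- y) is within r of 1, where the estimate on the
   squashed tail is available. *)
exists (Num.max 1 (1 - ln r)), k, e; split=> //; first by rewrite le_max lexx.
  exact: ltW.
move=> y; rewrite ge_max => /andP[y1 yr].
have ey : expR (- y) < r.
  rewrite -[r]lnK ?posrE// ltr_expR; lra.
have y0 : 0 < y by exact: lt_le_trans y1.
have /Hr : ball_ [eta Num.Def.normr] 1 r (exp_squash y).
  rewrite /ball_ /= /exp_squash opprB addrCA subrr addr0.
  by rewrite ger0_norm ?expR_ge0.
move=> /(_ _); rewrite nu_tilde_tailE// ger0_norm ?nu_tail_ge0//.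
rewrite ger0_norm ?powR_ge0// /exp_squash opprB addrCA subrr addr0.
rewrite [in X in _ * X]/powR gt_eqF ?expR_gt0// expRK mulrN; apply.
by rewrite gtrBl expR_gt0.
Qed.

(** The cube of exp (u / 3) >= u / 3. With three powers, i times the tail at i is of the summable
    order i^(- 2). *)
Lemma cube_expRN_le (u : R) : 0 < u -> expR (- u) <= 27 / u ^+ 3.
Proof.
move=> u0; rewrite expRN -[X in X <= _]div1r ler_pdivrMr ?expR_gt0//.
rewrite mulrAC ler_pdivlMr ?exprn_gt0// mul1r.
rewrite (_ : expR u = expR (u / 3) ^+ 3); last first.
  by rewrite -expRM_natl; congr expR; field.
have h : u / 3 <= expR (u / 3) by apply: (le_trans _ (expR_ge1Dx _)); lra.
have : (u / 3) ^+ 3 <= expR (u / 3) ^+ 3 by rewrite lerXn2r ?nnegrE ?expR_ge0// divr_ge0// ltW.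
rewrite (_ : (u / 3) ^+ 3 = u ^+ 3 / 27); last by field.
lra.
Qed.

(** Layer-cake bound for the square: beyond an integer a from which on the tail decays
    exponentially, x^2 is built from steps 2 i + 1 over the integers i <= x; below a it is compared
    with min (1, x). *)
Lemma L1_sqr_pos : condition_R nu -> L1 nu (fun y => (pos y) ^+ 2).
Proof.
move=> /exp_tail [A [k [e [A1 k0 e0 tail]]]].
pose a := (Num.truncn A).+1; have aA : A <= a%:R by apply/ltW/truncnS_gt.
have a0 : (0 < a)%N by [].
(* 81 = 3 * 27, from 2 i + 1 <= 3 i and the cubic bound; D / i^2 is then at most the telescoping
   term 2 D (1 / i - 1 / (i + 1)). *)
pose D := 81 * k / e ^+ 3.
have D0 : 0 <= D by apply: divr_ge0; [exact: mulr_ge0|exact/exprn_ge0/ltW].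
have layer (x : R) n : 0 <= x -> Num.min x (a + n)%:R ^+ 2 <=
    a%:R ^+ 2 * Num.min 1 x + \sum_(a <= i < a + n) (2 * i%:R + 1) * (i%:R <= x)%R%:R.
  move=> x0; have a1 : 1 <= a%:R :> R by rewrite ler1n.
  have [xa|xa] := ltP x a%:R.
    rewrite min_l; last by rewrite (le_trans (ltW xa))// ler_nat leq_addr.
    apply: (@le_trans _ _ (a%:R ^+ 2 * Num.min 1 x)).
      have a2 : 1 <= a%:R ^+ 2 :> R by rewrite expr_ge1.
      have [x1|x1] := leP 1 x; last first.
        by apply: (@le_trans _ _ x); [rewrite expr2 ler_piMl// ltW|rewrite ler_peMl].
      by rewrite mulr1 lerXn2r ?nnegrE// ltW.
    by rewrite lerDl; apply: sumr_ge0 => i _; rewrite mulr_ge0// addr_ge0// mulr_ge0.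
  rewrite (@min_l _ _ 1 x) ?(le_trans a1)// mulr1.
  elim: n => [|n IH]; first by rewrite addn0 big_geq// addr0 min_r.
  rewrite addnS big_nat_recr ?leq_addr//= addrA.
  have [Kx|Kx] := leP (a + n)%:R x.
    move: IH; rewrite min_r// mulr1 => IH.
    have h : 0 <= Num.min x (a + n).+1%:R by rewrite le_min x0 ler0n.
    have : Num.min x (a + n).+1%:R <= (a + n)%:R + 1 by rewrite natr1 ge_min lexx orbT.
    have : 0 <= (a + n)%:R :> R by [].
    nra.
  move: IH; rewrite mulr0 addr0 min_l ?(ltW Kx)// min_l//.
  by rewrite (le_trans (ltW Kx))// ler_nat.
have term i : (a <= i)%N -> (2 * i%:R + 1) * nu_tail nu i%:R <= 2 * D * (i%:R^-1 - i.+1%:R^-1).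
  move=> ai; have i0 : (0 < i)%N by exact: leq_trans ai.
  have i1 : 1 <= i%:R :> R by rewrite ler1n.
  have Ai : A <= i%:R by rewrite (le_trans aA)// ler_nat.
  have ei : 0 < e * i%:R by rewrite mulr_gt0// ltr0n.
  have h1 : nu_tail nu i%:R <= k * (27 / (e * i%:R) ^+ 3).
    by rewrite (le_trans (tail _ Ai))// ler_wpM2l// cube_expRN_le.
  apply: (@le_trans _ _ (3 * i%:R * (k * (27 / (e * i%:R) ^+ 3)))).
    by rewrite ler_pM ?nu_tail_ge0 ?addr_ge0 ?mulr_ge0//; lra.
  rewrite (_ : 3 * _ * _ = D * (i%:R ^+ 2)^-1); last first.
    by rewrite /D; field; rewrite !gt_eqF// ltr0n.
  rewrite (_ : 2 * D * _ = D * (2 * (i%:R^-1 - i.+1%:R^-1))); last by ring.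
  apply: ler_wpM2l => //.
  rewrite -natr1; set z := i%:R in i1 *.
  rewrite (_ : z^-1 - _ = (z * (z + 1))^-1); last by field; lra.
  have z2 : 0 < z ^+ 2 by rewrite exprn_gt0//; lra.
  have z3 : 0 < z * (z + 1) by rewrite mulr_gt0//; lra.
  by rewrite -[leLHS]div1r ler_pdivrMr// mulrAC ler_pdivlMr// mul1r; nra.
pose f_ (n : nat) (y : R) := Num.min (pos y) (a + n)%:R ^+ 2.
have mf n : measurable_fun setT (f_ n).
  apply: measurable_funX; apply: measurable_minr; first exact: measurable_pos.
  exact: measurable_cst.
have ipos i : (a <= i)%N -> 0 < i%:R :> R by move=> ai; rewrite ltr0n; exact: leq_trans ai.
have Lg n : L1 nu (fun y => a%:R ^+ 2 * Num.min 1 (pos y) +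
    \sum_(a <= i < a + n) (2 * i%:R + 1) * (i%:R <= pos y)%R%:R).
  apply: L1D; first by apply: L1Z; exact: L1_min1.
  rewrite (_ : (fun _ => _) = (fun y : R => \sum_(i <- index_iota a (a + n)) (if (a <= i)%N then (2 * i%:R + 1) * (i%:R <= pos y)%R%:R else 0))); last first.
    by apply/funext => y; rewrite !big_nat; apply: eq_bigr => i /andP[-> _].
  apply: L1_sum => i; have [ai|_] := leqP a i; last exact: L1_0.
  by apply: L1Z; apply: L1_ge_indic => //; exact: ipos.
have Lf n : L1 nu (f_ n).
  apply: (L1_le (mf n) _ (Lg n)) => y.
  by rewrite ger0_norm ?sqr_ge0// layer// pos_ge0.
apply: (@L1_of_bounded_int _ R R nu f_ _ (a%:R ^+ 2 * mass1 nu + 2 * D)) => //.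
- by move=> n y; exact: sqr_ge0.
- move=> y n m nm; rewrite /f_ lerXn2r ?nnegrE ?le_min ?pos_ge0 ?ler0n//.
  by rewrite !ge_min lexx /= ler_nat leq_add2l nm orbT.
- move=> y; apply: cvg_near_cst; near=> n; rewrite /f_ min_l//.
  apply: (@le_trans _ _ n%:R); last by rewrite ler_nat leq_addl.
  by near: n; exact: nbhs_infty_ger.
- move=> n; apply: (@le_trans _ _ (\int[nu]_y (a%:R ^+ 2 * Num.min 1 (pos y) +
    \sum_(a <= i < a + n) (2 * i%:R + 1) * (i%:R <= pos y)%R%:R))).
    by apply: le_int => // y; apply: layer; exact: pos_ge0.
  have Li i : L1 nu (fun y : R => if (a <= i)%N then (2 * i%:R + 1) * (i%:R <= pos y)%R%:R else 0).
    have [ai|_] := leqP a i; last exact: L1_0.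
    by apply: L1Z; apply: L1_ge_indic => //; exact: ipos.
  rewrite (_ : (fun _ => _) = (fun y : R => a%:R ^+ 2 * Num.min 1 (pos y) + \sum_(i <- index_iota a (a + n)) (if (a <= i)%N then (2 * i%:R + 1) * (i%:R <= pos y)%R%:R else 0))); last first.
    by apply/funext => y; congr (_ + _); rewrite !big_nat; apply: eq_bigr => i /andP[-> _].
  rewrite intD; [|by apply: L1Z; exact: L1_min1|exact: L1_sum].
  rewrite intZ; last exact: L1_min1.
  rewrite lerD2l int_sum// big_nat.
  apply: (@le_trans _ _ (\sum_(a <= i < a + n) 2 * D * (i%:R^-1 - i.+1%:R^-1))).
    rewrite [leRHS]big_nat; apply: ler_sum => i /andP[ai _].
    apply: (le_trans _ (term i ai)); rewrite ai intZ; last by apply: L1_ge_indic => //; exact: ipos.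
    by rewrite -nu_tailE//; exact: ipos.
  rewrite -mulr_sumr; apply: ler_piMr; first exact: mulr_ge0.
  under eq_bigr do rewrite -opprB.
  rewrite sumrN telescope_sumr ?leq_addr// opprB.
  have : 0 <= (a + n)%:R^-1 :> R by rewrite invr_ge0.
  have : a%:R^-1 <= 1 :> R by rewrite invf_le1 ?ltr0n// ler1n.
  lra.
Unshelve. all: by end_near. Qed.

Hypothesis cL : condition_L nu.
Hypothesis cR : condition_R nu.

Lemma L1_pos : L1 nu (fun y : R => pos y).
Proof.
apply: (@L1_le _ R R nu _ (fun y : R => Num.min 1 (pos y) + pos y ^+ 2)).
- exact: measurable_pos.
- move=> y; have y0 := pos_ge0 y; rewrite ger0_norm//.
  by have [y1|y1] := leP 1 (pos y); nra.
- by apply: L1D; [exact: L1_min1|exact: L1_sqr_pos].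
Qed.

Lemma moment1E : moment nu 1 = \int[nu]_y pos y.
Proof. by rewrite momentE//; apply: eq_Rintegral => y _; rewrite expr1. Qed.

Lemma laplace_exponent1_le_moment1 : phi 1 <= moment nu 1.
Proof.
rewrite moment1E laplace_exponentE; apply: le_int.
- exact: L1_expB1.
- exact: L1_pos.
- by move=> y; rewrite mul1r expB1_le.
Qed.

Lemma moment1_gt0 : 0 < moment nu 1.
Proof. exact: lt_le_trans (laplace_exponent1_gt0 levy cL) laplace_exponent1_le_moment1. Qed.

(** If m_2 vanished, min (1, y) <= min (y, 1 / n) + n y^2 would make the integral of min (1, y)
    vanish, against phi 1 > 0. *)
Lemma moment2_gt0 : 0 < moment nu 2.
Proof.
have m2 : 0 <= moment nu 2 by rewrite momentE//; apply: int_ge0 => y; exact: sqr_ge0.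
rewrite lt_def m2 andbT; apply/eqP => m20.
have Lr n : L1 nu (fun y => Num.min (pos y) n.+1%:R^-1).
  apply: (L1_le _ _ (L1_min1 levy)).
    by apply: measurable_minr; [exact: measurable_pos|exact: measurable_cst].
  move=> y; rewrite ger0_norm; last by rewrite le_min pos_ge0 invr_ge0 ler0n.
  rewrite le_min !ge_min lexx /=; apply/andP; split=> //.
  by apply/orP; right; rewrite invf_le1 ?ltr0n// ler1n.
have rem : \int[nu]_y Num.min (pos y) n.+1%:R^-1 @[n --> \oo] --> 0.
  rewrite -[X in _ --> X](int0 nu); apply: (cvg_int_dominated _ _ (Lr 0%N) _).2.
  - by move=> n; exact: L1_measurable (Lr n).
  - move=> y; apply: (cvg_dist_le _ (@cvg_harmonic R)); apply: nearW => n.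
    by rewrite subr0 ger0_norm ?ge_min ?lexx ?orbT// le_min pos_ge0 invr_ge0 ler0n.
  - move=> n y; rewrite ger0_norm; last by rewrite le_min pos_ge0 invr_ge0 ler0n.
    rewrite le_min !ge_min lexx /=; apply/orP; right.
    by rewrite invr1 invf_le1 ?ltr0n// ler1n.
have le n : mass1 nu <= \int[nu]_y Num.min (pos y) n.+1%:R^-1.
  rewrite -[leRHS]addr0 -[X in _ + X](mulr0 n.+1%:R) -[X in _ * X]m20 momentE//.
  rewrite -intZ; last exact: L1_sqr_pos.
  rewrite -intD//; last by apply: L1Z; exact: L1_sqr_pos.
  apply: le_int; [exact: L1_min1|by apply: L1D => //; apply: L1Z; exact: L1_sqr_pos|move=> y].
  have y0 := pos_ge0 y; have [yn|yn] := leP (pos y) n.+1%:R^-1.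
    by rewrite ge_min; apply/orP; right; rewrite lerDl mulr_ge0// sqr_ge0.
  apply: (@le_trans _ _ (pos y)); first by rewrite ge_min lexx orbT.
  apply: (@le_trans _ _ (n.+1%:R * pos y ^+ 2)); last by rewrite lerDr invr_ge0.
  rewrite expr2 mulrA ler_peMl// -ler_pdivrMl ?ltr0n// mulr1 ltW//.
have mass_le0 : mass1 nu <= 0 by apply: (cvgr_to_ge rem); exact: nearW.
have : phi 1 <= (1 + 1) * mass1 nu.
  rewrite laplace_exponentE /mass1 -intZ; last exact: L1_min1.
  apply: le_int; [exact: L1_expB1|by apply: L1Z; exact: L1_min1|move=> y].
  exact: expB1_le_min1.
by have := laplace_exponent1_gt0 levy cL; lra.
Qed.

Let difference_quotient (s y : R) : 0 < s -> 0 <= y ->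
  0 <= s^-1 * (1 - expR (- (s * y))) <= y /\
  `|s^-1 * (1 - expR (- (s * y))) - y| <= s * y ^+ 2.
Proof.
move=> s0 y0; have sy : 0 <= s * y by rewrite mulr_ge0// ltW.
split.
  apply/andP; split; first by rewrite mulr_ge0 ?expB1_ge0// invr_ge0 ltW.
  by rewrite mulrC ler_pdivrMr// mulrC expB1_le.
rewrite (_ : _ - y = - (s^-1 * (expR (- (s * y)) - (1 - s * y)))); last by field; rewrite gt_eqF.
rewrite normrN normrM ger0_norm ?invr_ge0 ?(ltW s0)// mulrC ler_pdivrMr//.
by apply: (le_trans (norm_expRN_taylor sy)); rewrite le_eqVlt; apply/orP; left; apply/eqP; ring.
Qed.

Let cvg_quotient (y : R) : 0 <= y ->
  (n.+1%:R^-1)^-1 * (1 - expR (- (n.+1%:R^-1 * y))) @[n --> \oo] --> y.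
Proof.
move=> y0; apply: (@cvg_dist_le _ _ (fun n => n.+1%:R^-1 * y ^+ 2)).
  by apply: nearW => n; apply: (difference_quotient _ y0).2; rewrite invr_gt0.
by rewrite -[X in _ --> X](mul0r (y ^+ 2)); apply: cvgMl; exact: cvg_harmonic.
Qed.

Lemma cvg_laplace_exponent_moment1 :
  (n.+1%:R^-1)^-1 * phi n.+1%:R^-1 @[n --> \oo] --> moment nu 1.
Proof.
have h n : 0 < n.+1%:R^-1 :> R by rewrite invr_gt0.
have E n : (n.+1%:R^-1)^-1 * phi n.+1%:R^-1 =
    \int[nu]_y ((n.+1%:R^-1)^-1 * (1 - expR (- (n.+1%:R^-1 * pos y)))).
  by rewrite laplace_exponentE intZ//; exact: (L1_expB1 levy (ltW (h n))).
rewrite (funext E) moment1E.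
apply: (cvg_int_dominated _ _ L1_pos _).2.
- by move=> n; apply: measurable_funM; [exact: measurable_cst|exact: measurable_expB1].
- by move=> y; exact: cvg_quotient (pos_ge0 y).
- move=> n y; have [/andP[d1 d2] _] := difference_quotient (h n) (pos_ge0 y).
  by rewrite ger0_norm.
Qed.

(** The second difference of the exponent is the integral of (1 - exp (- s y))^2. Divided by s^2 the
    integrand is dominated by y^2 and tends to it as s tends to 0. *)
Lemma cvg_laplace_exponent_moment2 :
  (n.+1%:R^-1)^-1 ^+ 2 * (2 * phi n.+1%:R^-1 - phi (2 * n.+1%:R^-1)) @[n --> \oo] --> moment nu 2.
Proof.
have h n : 0 < n.+1%:R^-1 :> R by rewrite invr_gt0.
have E n : (n.+1%:R^-1)^-1 ^+ 2 * (2 * phi n.+1%:R^-1 - phi (2 * n.+1%:R^-1)) =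
    \int[nu]_y ((n.+1%:R^-1)^-1 * (1 - expR (- (n.+1%:R^-1 * pos y)))) ^+ 2.
  set s := n.+1%:R^-1; have s0 : 0 <= s := ltW (h n).
  have L1s := L1_expB1 levy s0.
  have L2s : L1 nu (fun y => 1 - expR (- (2 * s * pos y))).
    by apply: L1_expB1 => //; rewrite mulr_ge0.
  rewrite !laplace_exponentE -intZ// -intB//; last exact: L1Z.
  rewrite -intZ; last by apply: L1B => //; exact: L1Z.
  apply: eq_Rintegral => y _.
  rewrite (_ : - (2 * s * pos y) = - (s * pos y) + - (s * pos y)) ?expRD; ring.
rewrite (funext E) momentE//.
apply: (cvg_int_dominated _ _ (L1_sqr_pos cR) _).2.
- move=> n; apply: measurable_funX; apply: measurable_funM; first exact: measurable_cst.
  exact: measurable_expB1.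
- move=> y; rewrite expr2; apply: cvgM; exact: cvg_quotient (pos_ge0 y).
- move=> n y; have [/andP[d1 d2] _] := difference_quotient (h n) (pos_ge0 y).
  by rewrite ger0_norm ?sqr_ge0// lerXn2r ?nnegrE ?pos_ge0.
Qed.

End levy_moments.

(** Fatou's lemma first gives the integrability of [f]; then [f] itself dominates and the limit
    passes under the integral. This avoids checking monotonicity in n of the difference
    quotients. *)
Lemma int_fatou {d : measure_display} {T : measurableType d} {R : realType}
    (mu : {measure set T -> \bar R}) (f_ : nat -> T -> R) (f : T -> R) (l : R) :
    (forall n, L1 mu (f_ n)) -> (forall n x, 0 <= f_ n x <= f x) ->
    (forall x, f_ n x @[n --> \oo] --> f x) ->
    \int[mu]_x f_ n x @[n --> \oo] --> l ->
  L1 mu f /\ \int[mu]_x f x = l.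
Proof.
move=> Lf f0f ff fl.
have mf n : measurable_fun setT (f_ n) := L1_measurable (Lf n).
have mfl : measurable_fun setT f by apply: measurable_fun_cvg => // x _; exact: ff.
have f0 x : 0 <= f x by have /andP[] := f0f 0%N x; exact: le_trans.
have L : L1 mu f.
  apply/integrableP; split; first exact/measurable_EFinP.
  have := @fatou _ _ _ mu setT measurableT (fun n => EFin \o f_ n).
  have limf x : limn_einf (fun n => (EFin \o f_ n) x) = (f x)%:E.
    have c : (fun n => (f_ n x)%:E) @ \oo --> (f x)%:E.
      by apply: cvg_EFin; [exact: nearW|exact: ff].
    by have [<- _] := cvg_limn_einf_sup c.
  have liml : limn_einf (fun n => \int[mu]_x (EFin \o f_ n) x)%E = l%:E.
    have c : (fun n => \int[mu]_x (EFin \o f_ n) x)%E @ \oo --> l%:E.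
      apply: cvg_EFin; last exact: fl.
      by apply: nearW => n; exact: (integrable_fin_num measurableT (Lf n)).
    by have [<- _] := cvg_limn_einf_sup c.
  under eq_integral do rewrite limf.
  rewrite liml => H; under eq_integral do rewrite /= ger0_norm//.
  apply: (le_lt_trans (H _ _)); last exact: ltry.
    by move=> n; exact/measurable_EFinP.
  by move=> n x _ /=; rewrite lee_fin; case/andP: (f0f n x).
split => //.
have [_ H] : L1 mu f /\ \int[mu]_x f_ n x @[n --> \oo] --> \int[mu]_x f x.
  apply: (cvg_int_dominated mf ff L) => n x.
  by have /andP[h1 h2] := f0f n x; rewrite ger0_norm.
exact: cvg_unique H fl.
Qed.

(** * Mean and second moment from a Laplace transform *)

Section laplace_moments.
Context {d : measure_display} {T : measurableType d} {R : realType}.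
Variable P : probability T R.
Variable nu : {measure set R -> \bar R}.
Hypothesis levy : is_levy_measure nu.
Hypothesis cL : condition_L nu.
Hypothesis cR : condition_R nu.
Local Notation phi := (laplace_exponent nu).
Local Notation m1 := (moment nu 1).
Local Notation m2 := (moment nu 2).
Variables (X : T -> R) (t : R).
Hypothesis mX : measurable_fun setT X.
Hypothesis X0 : forall w, 0 <= X w.
Hypothesis t0 : 0 <= t.
Hypothesis lapX : forall s, 0 <= s -> \int[P]_w expR (- (s * X w)) = expR (- (t * phi s)).

Lemma measurable_expRN (s : R) : measurable_fun setT (fun w => expR (- (s * X w))).
Proof.
apply: measurableT_comp => //; apply: measurableT_comp => //.
by apply: measurable_funM => //; exact: measurable_cst.
Qed.

Lemma L1_expRN (s : R) : 0 <= s -> L1 P (fun w => expR (- (s * X w))).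
Proof.
move=> s0; apply: (L1_bounded P (M := 1) (measurable_expRN s)) => w.
by rewrite ger0_norm ?expR_ge0// -expR0 ler_expR oppr_le0 mulr_ge0.
Qed.

Let s (n : nat) : R := n.+1%:R^-1.
Let s_gt0 n : 0 < s n. Proof. by rewrite invr_gt0. Qed.
Let s_cvg : s n @[n --> \oo] --> 0. Proof. exact: cvg_harmonic. Qed.

Let phi_cvg0 : t * phi (s n) @[n --> \oo] --> 0.
Proof.
rewrite -[X in _ --> X](mulr0 t); apply: cvgMr.
rewrite (_ : (fun n => phi (s n)) = fun n => s n * ((s n)^-1 * phi (s n))); last first.
  by apply/funext => n; rewrite mulrA divff ?mul1r// gt_eqF.
rewrite -[X in _ --> X](mul0r m1); apply: cvgM => //.
exact: cvg_laplace_exponent_moment1.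
Qed.

Let quot_cvg (a : nat -> R) (c : R) : (forall n, 0 <= a n) -> a n @[n --> \oo] --> 0 ->
  forall r : nat -> R, (forall n, 0 < r n) -> (r n)^-1 * a n @[n --> \oo] --> c ->
  (r n)^-1 * (1 - expR (- a n)) @[n --> \oo] --> c.
Proof.
move=> a0 acvg r r0 rc.
have H : (r n)^-1 * a n - (r n)^-1 * (1 - expR (- a n)) @[n --> \oo] --> 0.
  apply: (@cvg_dist_le _ _ (fun n => ((r n)^-1 * a n) * a n)).
    apply: nearW => n; rewrite subr0.
    rewrite (_ : _ - _ = (r n)^-1 * (expR (- a n) - (1 - a n))); last by ring.
    rewrite normrM ger0_norm ?invr_ge0 ?(ltW (r0 n))// -mulrA ler_wpM2l ?invr_ge0 ?(ltW (r0 n))//.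
    by rewrite -expr2 norm_expRN_taylor.
  by rewrite -[X in _ --> X](mulr0 c); apply: cvgM.
rewrite (_ : (fun n => _) = fun n => (r n)^-1 * a n -
    ((r n)^-1 * a n - (r n)^-1 * (1 - expR (- a n)))); last first.
  by apply/funext => n; rewrite opprB addrCA subrr addr0.
by rewrite -[X in _ --> X]subr0; exact: cvgB.
Qed.

Let pow_sub (x : R) n : 0 <= x -> 0 <= (s n)^-1 * (1 - expR (- (s n * x))) <= x.
Proof.
move=> x0; apply/andP; split.
  by rewrite mulr_ge0 ?expB1_ge0 ?invr_ge0 ?mulr_ge0// ltW.
by rewrite mulrC ler_pdivrMr// mulrC expB1_le.
Qed.

Let pow_cvg (x : R) : 0 <= x -> (s n)^-1 * (1 - expR (- (s n * x))) @[n --> \oo] --> x.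
Proof.
move=> x0; apply: quot_cvg => //.
- by move=> n; rewrite mulr_ge0// ltW.
- by rewrite -[X in _ --> X](mul0r x); apply: cvgMl.
- by apply: cvg_near_cst; apply: nearW => n; rewrite mulrA mulVf ?mul1r// gt_eqF.
Qed.

Lemma int_mean_of_laplace : L1 P X /\ \int[P]_w X w = t * m1.
Proof.
apply: (int_fatou (f_ := fun n w => (s n)^-1 * (1 - expR (- (s n * X w))))).
- move=> n; apply: L1Z; apply: L1B; first exact: L1_cst.
  by apply: L1_expRN; exact: ltW.
- by move=> n w; exact: pow_sub.
- by move=> w; exact: pow_cvg.
have E n : \int[P]_w ((s n)^-1 * (1 - expR (- (s n * X w)))) = (s n)^-1 * (1 - expR (- (t * phi (s n)))).
  rewrite intZ; last by apply: L1B; [exact: L1_cst|apply: L1_expRN; exact: ltW].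
  by rewrite intB ?int_cst ?lapX ?(ltW (s_gt0 n))//; [exact: L1_cst|apply: L1_expRN; exact: ltW].
rewrite (funext E); apply: quot_cvg => //.
- by move=> n; rewrite mulr_ge0// laplace_exponent_ge0// ltW.
- rewrite (_ : (fun n => _) = fun n => t * ((s n)^-1 * phi (s n))); last first.
    by apply/funext => n; rewrite mulrCA.
  by apply: cvgMr; exact: cvg_laplace_exponent_moment1.
Qed.

Lemma int_sqr_of_laplace : L1 P (fun w => X w ^+ 2) /\
  \int[P]_w X w ^+ 2 = t * m2 + (t * m1) ^+ 2.
Proof.
apply: (int_fatou (f_ := fun n w => ((s n)^-1 * (1 - expR (- (s n * X w)))) ^+ 2)).
- move=> n; apply: (L1_bounded P (M := (s n)^-1 ^+ 2)).
    apply: measurable_funX; apply: measurable_funM; first exact: measurable_cst.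
    by apply: measurable_funB; [exact: measurable_cst|exact: measurable_expRN].
  move=> w; have sX : 0 <= s n * X w by rewrite mulr_ge0// ltW.
  rewrite ger0_norm ?sqr_ge0// exprMn ler_piMr ?sqr_ge0//.
  by rewrite exprn_ile1 ?expB1_ge0// expB1_le1.
- move=> n w; have /andP[h1 h2] := pow_sub n (X0 w).
  by rewrite sqr_ge0/= lerXn2r ?nnegrE.
- by move=> w; rewrite expr2; apply: cvgM; exact: pow_cvg.
pose r n := t * (2 * phi (s n) - phi (2 * s n)).
have s0 n : 0 <= s n by exact: ltW.
have s20 n : 0 <= 2 * s n by rewrite mulr_ge0.
have p2 n : 0 <= 2 * phi (s n) - phi (2 * s n).
  rewrite !laplace_exponentE -intZ; last exact: L1_expB1.
  rewrite -intB; [|by apply: L1Z; exact: L1_expB1|exact: L1_expB1].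
  apply: int_ge0 => y; have := sqr_ge0 (1 - expR (- (s n * Num.max 0 y))).
  rewrite (_ : - (2 * s n * _) = - (s n * Num.max 0 y) + - (s n * Num.max 0 y)); last by ring.
  rewrite expRD; set z := expR _; nra.
have r0 n : 0 <= r n by rewrite mulr_ge0.
(* With a and b the Laplace transforms at s and 2 s, 1 - 2 a + b = (1 - a)^2 + (b - a^2) and a^2 = b
   exp (- r). Divided by s^2, the two parts yield the squared mean (t m_1)^2 and the variance t
   m_2. *)
have E n : \int[P]_w ((s n)^-1 * (1 - expR (- (s n * X w)))) ^+ 2 =
    ((s n)^-1 * (1 - expR (- (t * phi (s n))))) ^+ 2 +
    expR (- (t * phi (2 * s n))) * ((s n)^-1 ^+ 2 * (1 - expR (- r n))).
  transitivity ((s n)^-1 ^+ 2 * (1 - 2 * expR (- (t * phi (s n))) + expR (- (t * phi (2 * s n))))).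
    have LA := L1_expRN (s0 n); have LB := L1_expRN (s20 n).
    have LC : L1 P (fun w => 1 - 2 * expR (- (s n * X w))).
      by apply: L1B; [exact: L1_cst|exact: L1Z].
    transitivity (\int[P]_w ((s n)^-1 ^+ 2 * ((1 - 2 * expR (- (s n * X w))) + expR (- (2 * s n * X w))))).
      apply: eq_Rintegral => w _.
      rewrite (_ : - (2 * s n * _) = - (s n * X w) + - (s n * X w)); last by ring.
      by rewrite expRD; ring.
    rewrite intZ; last exact: L1D.
    rewrite intD// intB; [|exact: L1_cst|exact: L1Z].
    by rewrite intZ// int_cst !lapX.
  have -> : expR (- r n) = expR (- (t * phi (s n))) ^+ 2 * expR (t * phi (2 * s n)).
    by rewrite expr2 -!expRD /r; congr expR; ring.
  have h : expR (- (t * phi (2 * s n))) * expR (t * phi (2 * s n)) = 1.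
    by rewrite -expRD addNr expR0.
  set a := expR (- (t * phi (s n))); set b := expR (- _) in h *; set c := expR _ in h *.
  rewrite (_ : b * (_ * (1 - a ^+ 2 * c)) = (s n)^-1 ^+ 2 * (b - a ^+ 2 * (b * c))); last by ring.
  by rewrite h; ring.
rewrite (funext E) addrC; apply: cvgD.
  rewrite expr2; apply: cvgM; apply: quot_cvg => //.
  - by move=> n; rewrite mulr_ge0// laplace_exponent_ge0.
  - rewrite (_ : (fun n => _) = fun n => t * ((s n)^-1 * phi (s n))); last first.
      by apply/funext => n; rewrite mulrCA.
    by apply: cvgMr; exact: cvg_laplace_exponent_moment1.
  - by move=> n; rewrite mulr_ge0// laplace_exponent_ge0.
  - rewrite (_ : (fun n => _) = fun n => t * ((s n)^-1 * phi (s n))); last first.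
      by apply/funext => n; rewrite mulrCA.
    by apply: cvgMr; exact: cvg_laplace_exponent_moment1.
have rc : (s n)^-1 ^+ 2 * r n @[n --> \oo] --> t * m2.
  rewrite (_ : (fun n => _) = fun n => t * ((s n)^-1 ^+ 2 * (2 * phi (s n) - phi (2 * s n)))); last first.
    by apply/funext => n; rewrite mulrCA.
  by apply: cvgMr; exact: cvg_laplace_exponent_moment2.
rewrite -[X in _ --> X]mul1r; apply: cvgM.
  have h n : `|expR (- (t * phi (2 * s n))) - 1| <= 2 * (t * phi (s n)).
    have h1 : 0 <= t * phi (2 * s n) by rewrite mulr_ge0// laplace_exponent_ge0.
    have h2 := expB1_ge0 h1; have h3 := expB1_le (t * phi (2 * s n)).
    have : t * phi (2 * s n) <= t * (2 * phi (s n)) by rewrite ler_wpM2l// -subr_ge0.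
    rewrite distrC ger0_norm//; lra.
  apply: (@cvg_dist_le _ _ (fun n => 2 * (t * phi (s n)))); first exact: nearW.
  by rewrite -[X in _ --> X](mulr0 2); apply: cvgMr.
have s2E n : (s n)^-1 ^+ 2 = (s n ^+ 2)^-1 by rewrite exprVn.
rewrite (_ : (fun n => _) = fun n => (s n ^+ 2)^-1 * (1 - expR (- r n))); last first.
  by apply/funext => n; rewrite s2E.
apply: quot_cvg => //.
- rewrite (_ : r = fun n => s n ^+ 2 * ((s n)^-1 ^+ 2 * r n)); last first.
    by apply/funext => n; rewrite s2E mulrA divff ?mul1r// expf_neq0// gt_eqF.
  rewrite -[X in _ --> X](mul0r (t * m2)); apply: cvgM => //.
  by rewrite -[X in _ --> X](mul0r 0); rewrite [X in X @ _ --> _](_ : _ = fun n => s n * s n)//; apply: cvgM.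
- by move=> n; rewrite exprn_gt0.
- by rewrite (_ : (fun n => _) = fun n => (s n)^-1 ^+ 2 * r n)//; apply/funext => n; rewrite s2E.
Qed.

End laplace_moments.

(** * Gaps and cells *)

Lemma card_le_injection (I J : finType) (A : {set I}) (B : {set J}) (r : I -> J -> Prop) :
    (forall a, a \in A -> exists2 b, b \in B & r a b) ->
    (forall a a' b, a \in A -> a' \in A -> r a b -> r a' b -> a = a') ->
  (#|A| <= #|B|)%N.
Proof.
move=> ex inj; have [->|[a0 a0A]] := set_0Vmem A; first by rewrite cards0.
have [b0 _ _] := ex _ a0A.
have exb a : exists b, a \in A -> b \in B /\ r a b.
  have [aA|aA] := boolP (a \in A); last by exists b0.
  by have [b bB rab] := ex _ aA; exists b.
have [f fP] := choice exb.
rewrite -(card_in_imset (f := f)); last first.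
  by move=> a a' aA a'A ff; apply: (inj _ _ (f a) aA a'A); [|rewrite ff]; apply fP.
by apply/subset_leq_card/fintype.subsetP => _ /imsetP[a aA ->]; apply fP.
Qed.

Section gaps.
Context {R : realType}.
Variable C : set R.

(** Lying in the same component of [0, 1] minus C, expressed by the order alone. It is reflexive
    exactly at the points of [0, 1] off C, so [same_gap a a] says that a lies in some gap. *)
Definition same_gap (a b : R) : Prop :=
  `[Num.min a b, Num.max a b] `<=` `[0, 1] `\` C.

Lemma same_gapC a b : same_gap a b -> same_gap b a.
Proof. by rewrite /same_gap minC maxC. Qed.

Lemma same_gap_segment a b z : same_gap a b -> a <= z <= b -> ([set` `[0, 1]] `\` C) z.
Proof.
move=> + /andP[az zb]; apply => /=; rewrite in_itv/=.
by rewrite ge_min az le_max zb orbT.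
Qed.

Lemma same_gap_refl a : ([set` `[0, 1]] `\` C) a -> same_gap a a.
Proof.
move=> Aa z /=; rewrite in_itv/= minxx maxxx => /andP[az za].
by have -> : z = a by apply/eqP; rewrite eq_le za az.
Qed.

Lemma same_gapP a b : ([set` `[0, 1]] `\` C) a ->
  connected_component ([set` `[0, 1]] `\` C) a b <-> same_gap a b.
Proof.
move=> Aa; split.
  move=> Gb z /= zab.
  have /connected_intervalP itvG := @component_connected _ ([set` `[0, 1]] `\` C) a.
  apply: (@connected_component_sub _ ([set` `[0, 1]] `\` C) a z).
  have Ga := connected_component_refl Aa.
  move: zab; rewrite in_itv/=.
  by have [ab|ba] := leP a b; [move/(itvG _ _ Ga Gb)|move/(itvG _ _ Gb Ga)].
move=> sab; apply: (@connected_component_max _ _ `[Num.min a b, Num.max a b]) => //.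
- by rewrite /= in_itv/= ge_min le_max !lexx.
- by apply/connected_intervalP; exact: interval_is_interval.
- by rewrite /= in_itv/= ge_min le_max !lexx !orbT.
Qed.

Lemma same_gap_memr a b : same_gap a b -> ([set` `[0, 1]] `\` C) b.
Proof. by apply; rewrite /= in_itv/= ge_min le_max !lexx !orbT. Qed.

Lemma same_gap_meml a b : same_gap a b -> ([set` `[0, 1]] `\` C) a.
Proof. by move/same_gapC/same_gap_memr. Qed.

Lemma same_gap_trans a b c : same_gap a b -> same_gap b c -> same_gap a c.
Proof.
move=> sab sbc; have Aa := same_gap_meml sab; have Ab := same_gap_meml sbc.
by apply/same_gapP => //; apply: (connected_component_trans (y := b)); apply/same_gapP.
Qed.

Context {n : nat}.
Variable x : 'I_n -> R.

(* One sample point, the one of least index, represents each nonempty block. *)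
Definition block_leaders : {set 'I_n} :=
  [set i : 'I_n | `[< same_gap (x i) (x i) >] &&
     [forall j : 'I_n, (j < i)%N ==> ~~ `[< same_gap (x j) (x i) >]]]%SET.

Lemma block_leaderP i : same_gap (x i) (x i) ->
  exists2 j, j \in block_leaders & same_gap (x j) (x i).
Proof.
elim/(@ltn_ind): {i}(i : nat) {-2}i (erefl (i : nat)) => k IH i ik sii.
have [iB|] := boolP (i \in block_leaders); first by exists i.
rewrite inE (asboolT sii)/= => /forallPn[j].
rewrite negb_imply negbK => /andP[ji /asboolP sji].
have jk : (j < k)%N by rewrite -ik.
have [l lB slj] := IH _ jk _ erefl (same_gap_trans sji (same_gapC sji)).
by exists l => //; exact: same_gap_trans slj sji.
Qed.

Lemma block_leaders_inj i j : i \in block_leaders -> j \in block_leaders ->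
  same_gap (x i) (x j) -> i = j.
Proof.
rewrite !inE => /andP[_ /forallP Hi] /andP[_ /forallP Hj] sij.
apply: val_inj; have [ij|ji|//] := ltngtP i j.
- by move: (Hj i); rewrite ij (asboolT sij).
- by move: (Hi j); rewrite ji (asboolT (same_gapC sij)).
Qed.

(** Sending a leader to its component is injective and reaches every occupied gap, so the sorting
    and the block sizes drop out of the count. *)
Lemma number_of_partsE : number_of_parts C x = #|block_leaders|.
Proof.
rewrite /number_of_parts /composition size_map size_sort.
pose f i := connected_component (`[0, 1]%classic `\` C) (x i).
have -> : occupied_gaps C x = [set` [fset f i | i in block_leaders]%fset].
  apply/seteqP; split=> G /=.
    move=> [[y Ay <-] [i Gi]].
    have [j jB sji] : exists2 j, j \in block_leaders & same_gap (x j) (x i).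
      by apply: block_leaderP; apply: same_gap_refl; exact: connected_component_sub Gi.
    apply/imfsetP; exists j => //=.
    have Aj := same_gap_meml sji.
    rewrite (same_connected_component Gi); apply/esym.
    by apply: same_connected_component; apply/same_gapP.
  move=> /imfsetP[i/= iB ->]; have Ai : (`[0, 1]%classic `\` C) (x i).
    by move: iB; rewrite inE => /andP[/asboolP/same_gap_memr].
  by split; [exists (x i)|exists i; exact: connected_component_refl].
rewrite set_fsetK card_in_imfset/=; last first.
  move=> i j iB jB fij; apply: block_leaders_inj => //.
  have Ai k : k \in block_leaders -> (`[0, 1]%classic `\` C) (x k).
    by rewrite inE => /andP[/asboolP/same_gap_memr].
  by apply/same_gapP; [exact: Ai|rewrite -/(f i) fij; exact/connected_component_refl/Ai].
by rewrite cardE; apply: perm_size; apply: uniq_perm; rewrite ?enum_uniq// => i; rewrite !mem_enum.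
Qed.

End gaps.

(** * Nonempty blocks against occupied cells *)

Section cells.
Context {R : realType} {n M : nat}.
Variables (C : set R) (x : 'I_n -> R) (c : nat -> R).
Hypothesis c_mono : forall i j, (i <= j)%N -> c i <= c j.

Definition in_cell (k : nat) (y : R) : bool := c k <= y < c k.+1.

Definition occupied_cells : {set 'I_M} :=
  [set k : 'I_M | [exists i : 'I_n, in_cell k (x i)]]%SET.

Lemma in_cell_inj k l y : in_cell k y -> in_cell l y -> k = l.
Proof.
move=> /andP[ky yk] /andP[ly yl]; have [kl|lk|//] := ltngtP k l.
- by have := c_mono kl; rewrite leNgt (le_lt_trans ly).
- by have := c_mono lk; rewrite leNgt (le_lt_trans ky).
Qed.

Lemma exists_cell y : c 0%N <= y -> y < c M -> exists k : 'I_M, in_cell k y.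
Proof.
move=> c0y; elim: M => [|m IH]; first by rewrite ltNge c0y.
move=> ycm; have [ym|my] := ltP y (c m).
  by have [k ck] := IH ym; exists (widen_ord (leqnSn m) k).
by exists ord_max; rewrite /in_cell my.
Qed.

(** The end points of a cell belong to C, so the gap of a point of the cell stays within it:
    distinct cells with such points have distinct leaders. Every other occupied cell contains a
    point in no gap, to which it is charged. *)
Lemma card_occupied_cells_le : (forall k, C (c k)) ->
  (#|occupied_cells| <= number_of_parts C x +
     #|[set i : 'I_n | ~~ `[< same_gap C (x i) (x i) >]]%SET|)%N.
Proof.
move=> cC; rewrite number_of_partsE.
pose K1 := [set k : 'I_M | [exists i : 'I_n,
  in_cell k (x i) && `[< same_gap C (x i) (x i) >]]]%SET.
pose K2 := [set k : 'I_M | [exists i : 'I_n,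
  in_cell k (x i) && ~~ `[< same_gap C (x i) (x i) >]]]%SET.
have sub : occupied_cells \subset (K1 :|: K2)%SET.
  apply/fintype.subsetP => k; rewrite !inE => /existsP[i ki].
  apply/orP; have [s|s] := boolP `[< same_gap C (x i) (x i) >]; [left|right];
  by apply/existsP; exists i; rewrite ki.
apply: (leq_trans (subset_leq_card sub)).
apply: (leq_trans (leq_card_setU _ _)); apply: leq_add.
- apply: (@card_le_injection _ _ _ _ (fun (k : 'I_M) (i : 'I_n) => is_true (in_cell k (x i)))).
    move=> k; rewrite inE => /existsP[i /andP[/andP[ki ik] /asboolP sii]].
    have [j jB sji] := block_leaderP sii; exists j => //.
    rewrite /in_cell leNgt; apply/andP; split.
      apply/negP => jk; have ckji : x j <= c k <= x i by rewrite (ltW jk).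
      by have [_] := same_gap_segment sji ckji; apply.
    rewrite ltNge; apply/negP => jk.
    have ckij : x i <= c k.+1 <= x j by rewrite (ltW ik).
    by have [_] := same_gap_segment (same_gapC sji) ckij; apply.
  by move=> k l i _ _ ki li; apply/val_inj/(in_cell_inj ki li).
- apply: (@card_le_injection _ _ _ _ (fun (k : 'I_M) (i : 'I_n) => is_true (in_cell k (x i)))).
    by move=> k; rewrite inE => /existsP[i /andP[ki s]]; exists i => //; rewrite inE.
  by move=> k l i _ _ ki li; apply/val_inj/(in_cell_inj ki li).
Qed.

Hypothesis c_sep : forall i j z, C z -> x i < z < x j -> exists k, x i < c k < x j.

Lemma same_cell_no_point k i j z : in_cell k (x i) -> in_cell k (x j) -> C z ->
  ~ (x i < z < x j).
Proof.
move=> /andP[ki ik] /andP[kj jk] Cz /(c_sep Cz)[l /andP[il lj]].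
have kl : (k < l)%N.
  rewrite ltnNge; apply/negP => /c_mono lk.
  by have := lt_le_trans il (le_trans lk ki); rewrite ltxx.
by have := lt_le_trans jk (le_trans (c_mono kl) (ltW lj)); rewrite ltxx.
Qed.

(** Two leaders cannot share a cell: a point of C lies strictly between them, hence by [c_sep] so
    does a grid point. Leaders beyond the last grid point are counted apart. *)
Lemma number_of_parts_le_cells : c 0%N = 0 ->
  (number_of_parts C x <= #|occupied_cells| + #|[set i : 'I_n | (c M <= x i)%R]%SET|)%N.
Proof.
move=> c0; rewrite number_of_partsE.
have sub : block_leaders C x \subset ([set i in block_leaders C x | (x i < c M)%R] :|:
    [set i : 'I_n | (c M <= x i)%R])%SET.
  by apply/fintype.subsetP => i iB; rewrite !inE in iB *; rewrite iB/= ltNge orNb.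
apply: (leq_trans (subset_leq_card sub)).
apply: (leq_trans (leq_card_setU _ _)); rewrite leq_add2r.
apply: (@card_le_injection _ _ _ _ (fun (i : 'I_n) (k : 'I_M) => is_true (in_cell k (x i)))).
  move=> i; rewrite !inE => /andP[/andP[/asboolP/same_gap_memr[+ _] _] iM].
  rewrite /= in_itv/= => /andP[x0 _].
  have [|k ck] := @exists_cell (x i) _ iM; first by rewrite c0.
  by exists k => //; rewrite inE; apply/existsP; exists i.
move=> i j k /setIdP[iB _] /setIdP[jB _] ki kj.
apply: (block_leaders_inj iB jB); apply: contrapT => nsij.
have Ai l : l \in block_leaders C x -> (`[0, 1]%classic `\` C) (x l).
  by rewrite inE => /andP[/asboolP/same_gap_memr].
have [/=xi0 xiC] := Ai _ iB; have [/=xj0 xjC] := Ai _ jB.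
(* Otherwise the closed segment would avoid C, as neither end point is in C, and the two leaders
   would share a gap. *)
have [z [zC zij]] : exists z, C z /\ Num.min (x i) (x j) < z < Num.max (x i) (x j).
  apply: contrapT => nz; apply: nsij => z /= zij; split.
    move: xi0 xj0 zij; rewrite /= !in_itv/=; case: (leP (x i) (x j)) => _; lra.
  move=> Cz; apply: nz; exists z; split=> //; move: zij; rewrite in_itv/=.
  have zi : z != x i by apply/eqP => zi; apply: xiC; rewrite -zi.
  have zj : z != x j by apply/eqP => zj; apply: xjC; rewrite -zj.
  by case: (leP (x i) (x j)) => _ /andP[h1 h2]; rewrite !lt_neqAle h1 h2 !andbT (eq_sym _ z) ?zi ?zj.
move: zij; have [ij|ji] := leP (x i) (x j) => zij.
- exact: same_cell_no_point ki kj zC zij.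
- exact: same_cell_no_point kj ki zC zij.
Qed.

(* Of three sample points on the closed range the middle one separates the
   outer two, so that no cell contains three. *)
Lemma card_points_in_le_cells : injective x -> c 0%N = 0 ->
  (#|[set i : 'I_n | [&& ~~ `[< same_gap C (x i) (x i) >], (0 <= x i)%R, (x i < c M)%R &
     (x i <= 1)%R]]%SET| <= 2 * #|occupied_cells|)%N.
Proof.
move=> xinj c0.
set D := [set i : 'I_n | _]%SET.
have DC i : i \in D -> C (x i) /\ 0 <= x i < c M.
  rewrite inE => /and4P[/asboolP si x0 xM x1]; split; last by rewrite x0.
  apply: contrapT => nC; apply: si; apply: same_gap_refl; split=> //=.
  by rewrite in_itv/= x0.
have sub : D \subset (\bigcup_(k in occupied_cells) [set i in D | in_cell k (x i)])%SET.
  apply/fintype.subsetP => i iD; have [_ /andP[x0 xM]] := DC _ iD.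
  have [|k ck] := @exists_cell (x i) _ xM; first by rewrite c0.
  apply/finset.bigcupP; exists k; last by rewrite inE iD.
  by rewrite inE; apply/existsP; exists i.
apply: (leq_trans (subset_leq_card sub)).
apply: (@leq_trans (\sum_(k in occupied_cells) #|[set i in D | in_cell k (x i)]%SET|)).
  elim/big_rec2: _ => [|k s B _ IH]; first by rewrite cards0.
  by apply: (leq_trans (leq_card_setU _ _)); rewrite leq_add2l.
rewrite mulnC -sum_nat_const; apply: leq_sum => k _; rewrite leqNgt; apply/negP.
move=> /card_gt2P[i [j [l [[+ + +] [ij jl li]]]]].
move=> /setIdP[iD ki] /setIdP[jD kj] /setIdP[lD kl].
have [Ci _] := DC _ iD; have [Cj _] := DC _ jD; have [Cl _] := DC _ lD.
have nle a b : a != b -> x a < x b \/ x b < x a.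
  by move=> /eqP ab; apply/orP; rewrite -neq_lt; apply/eqP => /xinj.
have no a b e : in_cell k (x a) -> in_cell k (x b) -> C (x e) -> x a < x e -> x e < x b -> False.
  move=> ka kb Ce ae eb; apply: (same_cell_no_point ka kb Ce); exact/andP.
case: (nle _ _ ij) => h1; case: (nle _ _ jl) => h2; case: (nle _ _ li) => h3.
- by have := lt_trans h1 (lt_trans h2 h3); rewrite ltxx.
- exact: (no i l j).
- exact: (no l j i).
- exact: (no i j l).
- exact: (no j i l).
- exact: (no j l i).
- exact: (no l i j).
- by have := lt_trans h1 (lt_trans h3 h2); rewrite ltxx.
Qed.

End cells.

(** * Measurability of the number of parts *)

Section number_of_parts_measurable.
Context {R : realType} {d1 d2 : measure_display} {T1 : measurableType d1} {T2 : measurableType d2}.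
Context {n : nat}.
Variables (u : 'I_n -> T1 -> R) (X : T2 -> set R).
Hypothesis mu_ : forall i, measurable_fun setT (u i).
Hypothesis closedX : forall w, closed (X w).
Hypothesis mX : forall O, open O -> measurable [set w | X w `&` O !=set0].

Let mui i (B : set R) : measurable B -> measurable [set z : T1 * T2 | B (u i z.1)].
Proof.
move=> mB; rewrite -[X in measurable X]setTI.
exact: (measurableT_comp (mu_ i) measurable_fst).
Qed.

Let avoid (p q : R) : set (T1 * T2) := [set z | ~ (X z.2 `&` `]p, q[%classic !=set0)].

Let m_avoid p q : measurable (avoid p q).
Proof.
apply: measurableC; have := mX (@interval_open _ (BRight p) (BLeft q) isT isT) => mh.
rewrite -[X in measurable X]setTI.
exact: (@measurable_snd _ _ T1 T2 measurableT _ mh).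
Qed.

Let open_around (U : set R) p : open U -> U p ->
  exists r : rat, exists s : rat,
    [/\ ratr r < p, p < ratr s & forall z, ratr r < z < ratr s -> U z].
Proof.
move=> oU Up; have /nbhs_ballP[e /= e0 sub] := open_nbhs_nbhs (conj oU Up).
have [|r] := @rat_in_itvoo R (p - e) p; first by rewrite ltrBlDr ltrDl.
have [|s] := @rat_in_itvoo R p (p + e); first by rewrite ltrDl.
rewrite !in_itv/= => /andP[ps se] /andP[re rp]; exists r, s; split=> // z /andP[rz zs].
by apply: sub; rewrite /ball/= ltr_distlC (lt_trans re rz) (lt_trans zs se).
Qed.

(** As X is closed, the segment can be enlarged a little at both ends without meeting X. Hence two
    points of [0, 1] share a gap when some open interval with rational end points contains both and
    misses X: a countable union of observable events. *)
Lemma measurable_same_gap i j :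
  measurable [set z : T1 * T2 | same_gap (X z.2) (u i z.1) (u j z.1)].
Proof.
pose unit k := [set z : T1 * T2 | (`[0, 1]%classic : set R) (u k z.1)].
pose near r s k := [set z : T1 * T2 | (`]r, s[%classic : set R) (u k z.1)].
have -> : [set z : T1 * T2 | same_gap (X z.2) (u i z.1) (u j z.1)] =
  unit i `&` unit j `&` \bigcup_(r : rat) \bigcup_(s : rat)
   (avoid (ratr r) (ratr s) `&` (near (ratr r) (ratr s) i `&` near (ratr r) (ratr s) j)).
  apply/seteqP; split=> -[w w'] /=.
    move=> sij.
    have [ui uiX] := same_gap_meml sij; have [uj ujX] := same_gap_memr sij.
    split; first by [].
    set a := Num.min (u i w) (u j w); set b := Num.max (u i w) (u j w).
    have oX : open (~` X w') by rewrite openC; exact: closedX.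
    have abI z : a <= z <= b -> ~ X w' z.
      by move=> zab; have [] := sij z; rewrite ?in_itv//= -/a -/b.
    have ab : a <= b by rewrite /a ge_min le_max lexx.
    have nXa : (~` X w') a by apply: abI; rewrite lexx ab.
    have nXb : (~` X w') b by apply: abI; rewrite lexx ab.
    have [r [s [ra sa rsX]]] := open_around oX nXa.
    have [r' [s' [rb sb rsX']]] := open_around oX nXb.
    have nearI k : a <= u k w <= b -> near (ratr r) (ratr s') k (w, w').
      by move=> /andP[ak kb]; rewrite /near/= in_itv/= (lt_le_trans ra ak) (le_lt_trans kb sb).
    exists r => //; exists s' => //; split; last first.
      by split; apply: nearI; rewrite ge_min le_max !lexx ?orbT.
    move=> [z []] /= Xz; rewrite in_itv/= => /andP[rz zs'].
    have [za|az] := ltP z a; first by apply: (rsX z) => //; rewrite rz (lt_trans za).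
    have [bz|zb] := ltP b z; first by apply: (rsX' z) => //; rewrite zs' (lt_trans rb).
    by apply: (abI z) => //; rewrite az.
  move=> [[ui uj] [r _ [s _ [av [ni nj]]]]] z /=; rewrite in_itv/= => zab.
  move: ui uj ni nj; rewrite /unit /near/= !in_itv/= => /andP[ui0 ui1] /andP[uj0 uj1].
  move=> /andP[ri si] /andP[rj sj]; split.
    by move: zab; case: (leP (u i w) (u j w)) => _; lra.
  move=> Xz; apply: av; exists z; split=> //=; rewrite in_itv/=.
  by move: zab; case: (leP (u i w) (u j w)) => _ /andP[h1 h2];
     rewrite ?(lt_le_trans ri h1) ?(lt_le_trans rj h1) ?(le_lt_trans h2 si) ?(le_lt_trans h2 sj).
apply: measurableI; first by apply: measurableI; exact: mui.
apply: bigcupT_measurable_rat => r; apply: bigcupT_measurable_rat => s.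
by apply: measurableI => //; apply: measurableI; exact: mui.
Qed.

Lemma measurable_number_of_parts :
  measurable_fun setT (fun z : T1 * T2 => (number_of_parts (X z.2) (u^~ z.1))%:R : R).
Proof.
pose E (i : 'I_n) := [set z : T1 * T2 | same_gap (X z.2) (u i z.1) (u i z.1)] `&`
  \bigcap_(j in [set j : 'I_n | (j < i)%N])
     ~` [set z : T1 * T2 | same_gap (X z.2) (u j z.1) (u i z.1)].
have -> : (fun z : T1 * T2 => (number_of_parts (X z.2) (u^~ z.1))%:R : R) =
    (fun z => \sum_(i < n) \1_(E i) z).
  apply/funext => z; rewrite number_of_partsE -sum1_card natr_sum big_mkcond/=.
  apply: eq_bigr => i _; rewrite indicE inE.
  case: ifPn => [/andP[/asboolP sii /forallP h]|].
    rewrite mem_set//; split=> //= j/= ji; apply/asboolP.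
    by rewrite asbool_neg; exact: (implyP (h j)).
  move=> h; rewrite memNset// => -[/= sii hj]; move: h.
  rewrite (asboolT sii)/= => /negP; apply; apply/forallP => j.
  by apply/implyP => ji; apply/negP => /asboolP; exact: (hj j ji).
apply: measurable_sum => i; apply: measurable_indic; apply: measurableI.
  exact: measurable_same_gap.
apply: fin_bigcap_measurable => // j _; apply: measurableC; exact: measurable_same_gap.
Qed.

End number_of_parts_measurable.

Lemma number_of_parts_le {R : realType} (C : set R) n (x : 'I_n -> R) :
  (number_of_parts C x <= n)%N.
Proof. by rewrite number_of_partsE (leq_trans (max_card _))// card_ord. Qed.

(** * Range and increments of a subordinator *)

Section subordinator_range.
Context {R : realType} {d : measure_display} {T : measurableType d}.
Variables (P : probability T R) (S : R -> {RV P >-> R}).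
Hypothesis subS : is_subordinator S.

Definition squashed (t : R) (w : T) : R := 1 - expR (- S t w).

Local Notation C := (closed_range (fun t w => S t w)).

Lemma subordinator_ge0 t w : 0 <= t -> 0 <= S t w.
Proof. by move=> t0; rewrite -(sub_start subS w); exact: (sub_nondecreasing subS). Qed.

Lemma le_squashed s t w : 0 <= s -> s <= t -> squashed s w <= squashed t w.
Proof.
by move=> s0 st; rewrite lerD2l lerN2 ler_expR lerN2; exact: (sub_nondecreasing subS).
Qed.

Lemma squashed0 w : squashed 0 w = 0.
Proof. by rewrite /squashed (sub_start subS) oppr0 expR0 subrr. Qed.

Lemma squashed_lt1 t w : squashed t w < 1.
Proof. by rewrite ltrBlDr ltrDl expR_gt0. Qed.

Lemma measurable_squashed t : measurable_fun setT (squashed t).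
Proof.
apply: measurable_funB => //; apply: measurableT_comp => //.
by apply: measurable_funN; exact: measurable_funPT.
Qed.

Lemma closed_range_squashed t w : 0 <= t -> C w (squashed t w).
Proof. by move=> t0; apply: subset_closure; exists t => //=; rewrite in_itv/= t0. Qed.

Lemma closed_closed_range w : closed (C w).
Proof. exact: closed_closure. Qed.

Lemma closed_range_meet (U : set R) w : open U ->
  C w `&` U !=set0 -> exists2 t, 0 <= t & U (squashed t w).
Proof.
move=> oU [z [Cz Uz]]; have [y []] := Cz U (open_nbhs_nbhs (conj oU Uz)).
by move=> [t]; rewrite /= in_itv/= andbT => t0 <- ?; exists t.
Qed.

Lemma squashed_right_nbhs (U : set R) t w : 0 <= t -> open U -> U (squashed t w) ->
  exists2 e, 0 < e & forall s, t < s -> s < t + e -> U (squashed s w).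
Proof.
move=> t0 oU Ut.
have c : squashed s w @[s --> t^'+] --> squashed t w.
  apply: cvgB; first exact: cvg_cst.
  apply: (@cvg_comp _ _ _ (fun s => - S s w) expR _ (nbhs (- S t w))); last exact: continuous_expR.
  by apply: cvgN; exact: (sub_right_continuous subS).
have : \forall s \near t^'+, U (squashed s w) := c _ (open_nbhs_nbhs (conj oU Ut)).
rewrite near_withinE => /nbhs_ballP[e /= e0 sub]; exists e => // s ts se.
by apply: sub => //; rewrite /ball/= ltr_distlC se (lt_trans _ ts)// ltrBlDr ltrDl.
Qed.

(** An open set meeting the closure contains the value at some time t, and by right-continuity also
    at a rational time after t. Negative rationals are sent to time 0. *)
Lemma measurable_closed_range_meet (O : set R) : open O ->
  measurable [set w | C w `&` O !=set0].
Proof.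
move=> oO.
have -> : [set w | C w `&` O !=set0] =
    \bigcup_(q : rat) (squashed (Num.max 0 (ratr q)) @^-1` O).
  apply/seteqP; split=> w /=.
    move=> /(closed_range_meet oO)[t t0 Ot].
    have [e e0 sub] := squashed_right_nbhs t0 oO Ot.
    have [|q] := @rat_in_itvoo R t (t + e); first by rewrite ltrDl.
    rewrite in_itv/= => /andP[tq qe]; exists q => //=.
    by rewrite (max_r _)//; [exact: sub|rewrite (le_trans t0)// ltW].
  move=> [q _ /= Oq]; exists (squashed (Num.max 0 (ratr q)) w); split=> //.
  by apply: closed_range_squashed; rewrite le_max lexx.
apply: bigcupT_measurable_rat => q; rewrite -[X in measurable X]setTI.
by apply: measurable_squashed => //; exact: open_measurable.
Qed.

(** For each pair of sample points with a range point in between, right-continuity gives an interval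
    of times whose values fall between them, and a mesh finer than its length hits it. There are
    finitely many pairs; the threshold depends on x and w. *)
Lemma grid_separates n (x : 'I_n -> R) w : \forall m \near \oo,
  forall i j z, C w z -> x i < z < x j ->
    exists k, x i < squashed (k%:R * m.+1%:R^-1) w < x j.
Proof.
apply: filter_forall => i; apply: filter_forall => j.
have [[z [Cz zij]]|no] := pselect (exists z, C w z /\ x i < z < x j); last first.
  by apply: nearW => m z Cz zij; exfalso; apply: no; exists z.
have oij := @interval_open R (BRight (x i)) (BLeft (x j)) isT isT.
have [|t t0 tij] := closed_range_meet oij (w := w).
  by exists z; split=> //=; rewrite in_itv.
have [e e0 sub] := squashed_right_nbhs t0 oij tij.
(* The first multiple of the mesh strictly after t. *)
near=> m => _ _ _; exists (Num.truncn (t * m.+1%:R)).+1.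
have tm := truncnS_gt (t * m.+1%:R : R).
have mt : (Num.truncn (t * m.+1%:R))%:R <= t * m.+1%:R :> R by rewrite truncn_le// mulr_ge0.
have me : e^-1 < m.+1%:R.
  rewrite (lt_trans (truncnS_gt _))// ltr_nat ltnS; near: m.
  by exists (Num.truncn e^-1).+1.
have m0 : 0 < m.+1%:R :> R by [].
have -> : (x i < squashed ((Num.truncn (t * m.+1%:R)).+1%:R * m.+1%:R^-1) w < x j) =
  (squashed ((Num.truncn (t * m.+1%:R)).+1%:R * m.+1%:R^-1) w \in `](x i), (x j)[).
  by rewrite in_itv.
apply: sub; first by rewrite ltr_pdivlMr.
rewrite ltr_pdivrMr// -natr1 mulrDl ler_ltD//.
by rewrite -ltr_pdivrMl// mulr1.
Unshelve. all: by end_near. Qed.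

Section increments.
Variable h : R.
Hypothesis h0 : 0 <= h.

Definition increment (k : nat) (w : T) : R := S (k.+1%:R * h) w - S (k%:R * h) w.

Lemma measurable_increment k : measurable_fun setT (increment k).
Proof. by apply: measurable_funB; exact: measurable_funPT. Qed.

Lemma independent_increment k : mutually_independent P
  (fun i : 'I_k => g_sigma_algebra_preimage (increment i)).
Proof.
apply: (sub_independent subS (t := fun i => i%:R * h)); first by rewrite mul0r.
by move=> i; rewrite ler_wpM2r// ler_nat.
Qed.

Lemma law_increment k B : measurable B ->
  P (increment k @^-1` B) = P (S h @^-1` B).
Proof.
move=> mB; rewrite -(sub_stationary subS (t := k%:R * h) _ h0 mB) ?mulr_ge0//.
by congr (P _); apply/funext => w; rewrite /increment /= -natr1 mulrDl mul1r.
Qed.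

Lemma increment_ge0 k w : 0 <= increment k w.
Proof.
rewrite subr_ge0; apply: (sub_nondecreasing subS); first exact: mulr_ge0.
by rewrite ler_wpM2r// ler_nat.
Qed.

Lemma sum_increment k w : \sum_(i < k) increment i w = S (k%:R * h) w.
Proof.
elim: k => [|k IH]; first by rewrite big_ord0 mul0r (sub_start subS).
by rewrite big_ord_recr/= IH addrC subrK.
Qed.

End increments.
End subordinator_range.

Section subordinator_laplace.
Context {R : realType} {d : measure_display} {T : measurableType d}.
Variables (P : probability T R) (S : R -> {RV P >-> R}) (nu : {measure set R -> \bar R}).
Hypothesis subS : is_subordinator S.
Hypothesis driftS : driftfree_with_levy_measure S nu.
Local Notation phi := (laplace_exponent nu).

Lemma laplace_subordinator t s : 0 <= t -> 0 <= s ->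
  \int[P]_w expR (- (s * S t w)) = expR (- (t * phi s)).
Proof.
move=> t0 s0; have [_ /(_ t s t0 s0)] := driftS.
by rewrite unlock /Rintegral => ->.
Qed.

Lemma laplace_increment h k s : 0 <= h -> 0 <= s ->
  \int[P]_w expR (- (s * increment S h k w)) = expR (- (h * phi s)).
Proof.
move=> h0 s0; rewrite -laplace_subordinator//.
have mf : measurable_fun setT (fun y : R => expR (- (s * y))).
  have m1 : measurable_fun setT (fun y : R => s * y) by exact: mulrl_measurable.
  by apply: (measurableT_comp (@measurable_expR R)); apply: measurable_funN.
have Lf : L1 P ((fun y => expR (- (s * y))) \o S h).
  apply: (@L1_bounded _ _ _ P _ 1) => [|w /=].
    by apply: measurableT_comp => //; exact: measurable_funPT.
  by rewrite ger0_norm ?expR_ge0// -expR0 ler_expR oppr_le0 mulr_ge0// (subordinator_ge0 subS).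
have law B (mB : measurable B) := law_increment subS h0 k mB.
have [_] := int_same_law (measurable_increment S h k) (measurable_funPT (S h)) law mf Lf.
by [].
Qed.

End subordinator_laplace.

(** * Occupancy of the cells *)

(** Serves twice: for the negatively correlated vacancies and for orthogonal martingale
    differences. *)
Lemma int_sqr_sum_le {d : measure_display} {T : measurableType d} {R : realType}
    (P : probability T R) (M : nat) (D : 'I_M -> T -> R) (B : 'I_M -> R) :
    (forall k l, L1 P (fun w => D k w * D l w)) ->
    (forall k l, \int[P]_w (D k w * D l w) <= (k == l)%:R * B k) ->
  L1 P (fun w => (\sum_k D k w) ^+ 2) /\
  \int[P]_w (\sum_k D k w) ^+ 2 <= \sum_k B k.
Proof.
move=> LD DB.
have E w : (\sum_k D k w) ^+ 2 = \sum_k \sum_l D k w * D l w.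
  by rewrite expr2 big_distrlr.
have -> : (fun w => (\sum_k D k w) ^+ 2) = (fun w => \sum_k \sum_l D k w * D l w).
  exact/funext.
split; first by apply: L1_sum => k; exact: L1_sum.
rewrite int_sum; last by move=> k; exact: L1_sum.
apply: ler_sum => k _; rewrite int_sum//.
apply: (@le_trans _ _ (\sum_l (k == l)%:R * B k)); first by apply: ler_sum => l _; exact: DB.
rewrite (bigD1 k)//= eqxx mul1r big1 ?addr0// => l /negPf; rewrite eq_sym => ->.
by rewrite mul0r.
Qed.

Section uniform_sample.
Context {R : realType} {d : measure_display} {T : measurableType d}.
Variable P : probability T R.
Context {n : nat}.
Variable u : 'I_n -> {RV P >-> R}.
Hypothesis iid : iid_uniform u.

Definition unif (B : set R) : R := fine (uniform_prob (@ltr01 R) B).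

Lemma unifE i B : measurable B -> P (u i @^-1` B) = (unif B)%:E.
Proof.
move=> mB; have [uni _] := iid; rewrite /unif -(uni i B mB).
by rewrite fineK//; exact: fin_num_measure.
Qed.

Lemma unif_itv (a b : R) : 0 <= a -> a <= b -> b <= 1 -> unif `[a, b[%classic = b - a.
Proof.
move=> a0 ab b1; rewrite /unif /uniform_prob integral_uniform_pdf.
have -> : `[a, b[%classic `&` `[0, 1]%classic = `[a, b[%classic :> set R.
  apply: setIidl => x /=; rewrite !in_itv/= => /andP[ax xb].
  by rewrite (le_trans a0 ax) (le_trans (ltW xb) b1).
under eq_integral.
  move=> x; rewrite inE/= in_itv/= => /andP[ax xb].
  rewrite /uniform_pdf (le_trans a0 ax) (le_trans (ltW xb) b1)/= subr0 invr1.
  over.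
rewrite integral_cst//= mul1e lebesgue_measure_itv/= lte_fin.
by case: ltP => [//|ba]; have -> : a = b; [apply/eqP; rewrite eq_le ab|rewrite subrr].
Qed.

Lemma vacancy_probability B : measurable B ->
  P [set w | forall i, ~ B (u i w)] = ((1 - unif B) ^+ n)%:E.
Proof.
move=> mB; have [_ ind] := iid.
have -> : [set w | forall i, ~ B (u i w)] =
    \bigcap_(i in [set` [set: 'I_n]%SET]) (u i @^-1` (~` B)).
  by apply/seteqP; split=> w /= h i; [move=> _; exact: h|apply: h; rewrite /= inE].
rewrite ind; last by move=> i _; exists (~` B); [exact: measurableC|rewrite setTI].
rewrite (eq_bigr (fun=> (1 - unif B)%:E)).
  by rewrite prodEFin; congr EFin; rewrite prodr_const cardsT card_ord.
move=> i _; rewrite preimage_setC probability_setC; last first.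
  by rewrite -[X in measurable X]setTI; exact: measurable_funPT.
by rewrite unifE.
Qed.

Lemma measurable_vacancy B : measurable B -> measurable [set w | forall i, ~ B (u i w)].
Proof.
move=> mB; have -> : [set w | forall i, ~ B (u i w)] =
    \bigcap_(i in [set: 'I_n]) (u i @^-1` (~` B)).
  by apply/seteqP; split=> w /= h i; [move=> _; exact: h|exact: h].
apply: fin_bigcap_measurable => // i _; rewrite -[X in measurable X]setTI.
by apply: measurable_funPT => //; exact: measurableC.
Qed.

Section occupancy.
Variables (M : nat) (c : nat -> R).
Hypothesis c_mono : forall i j, (i <= j)%N -> c i <= c j.
Hypothesis c0 : 0 <= c 0%N.
Hypothesis c1 : forall k, c k <= 1.

Definition hit_probability k : R := 1 - (1 - (c k.+1 - c k)) ^+ n.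

Let vac k := [set w | forall i, ~ `[c k, c k.+1[%classic (u i w)].

Let m_vac k : measurable (vac k).
Proof. by apply: measurable_vacancy; exact: measurable_itv. Qed.

Let c_ge0 k : 0 <= c k.
Proof. by rewrite (le_trans c0)// c_mono. Qed.

Let unif_cell k : unif `[c k, c k.+1[%classic = c k.+1 - c k.
Proof. by apply: unif_itv => //; exact: c_mono. Qed.

Let cell_le1 k : 0 <= c k.+1 - c k <= 1.
Proof. by rewrite subr_ge0 c_mono// lerBlDr (le_trans (c1 _))// lerDl. Qed.

Lemma occupied_cellsE w :
  #|occupied_cells (M := M) (fun i => u i w) c|%:R = \sum_(k < M) (1 - \1_(vac k) w) :> R.
Proof.
rewrite -sum1_card natr_sum big_mkcond/=; apply: eq_bigr => k _.
rewrite inE indicE; case: ifPn => [/existsP[i ki]|/existsPn h].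
  by rewrite memNset ?subr0// => /(_ i); apply; rewrite /= in_itv.
rewrite mem_set ?subrr// => i /=; rewrite in_itv/=; exact/negP/h.
Qed.

Let int_vac k : \int[P]_w (\1_(vac k) w : R) = (1 - (c k.+1 - c k)) ^+ n.
Proof. by rewrite int_indic// vacancy_probability ?unif_cell//; exact: measurable_itv. Qed.

Let int_vac2 k l : k != l -> \int[P]_w (\1_(vac k) w * \1_(vac l) w : R) <=
  (1 - (c k.+1 - c k)) ^+ n * (1 - (c l.+1 - c l)) ^+ n.
Proof.
move=> kl; pose B := `[c k, c k.+1[%classic `|` `[c l, c l.+1[%classic : set R.
have mB : measurable B by apply: measurableU; exact: measurable_itv.
have -> : (fun w => \1_(vac k) w * \1_(vac l) w : R) = \1_[set w | forall i, ~ B (u i w)].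
  apply/funext => w; rewrite -[LHS]/((\1_(vac k) \* \1_(vac l)) w) -indicI.
  congr (\1_ _ w); apply/seteqP; split=> {}w /=.
    by move=> [hk hl] i [ki|li]; [exact: (hk i)|exact: (hl i)].
  by move=> h; split=> i ki; apply: (h i); [left|right].
rewrite int_indic; last exact: measurable_vacancy.
rewrite vacancy_probability//= -exprMn.
have disj : `[c k, c k.+1[%classic `&` `[c l, c l.+1[%classic = set0 :> set R.
  rewrite -subset0 => y [/=]; rewrite !in_itv/= => ky ly.
  by move/eqP: kl; apply; exact: (@in_cell_inj _ c c_mono k l y).
have -> : unif B = (c k.+1 - c k) + (c l.+1 - c l).
  rewrite -!unif_cell /unif measureU//; [|exact: measurable_itv..].
  by rewrite fineD//; exact: fin_num_measure.
have := c1; have := cell_le1 k; have := cell_le1 l.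
set p := c k.+1 - c k; set q := c l.+1 - c l => /andP[q0 q1] /andP[p0 p1] _.
(* The two cells are disjoint pieces of [0, 1], so 1 - p - q is nonnegative and taking powers
   preserves the inequality. *)
have pq : p + q <= 1.
  move: kl; rewrite neq_lt => /orP[kl|lk].
  - have := c_mono kl; have := c1 l.+1; have := c_ge0 k; rewrite /p /q; lra.
  - have := c_mono lk; have := c1 k.+1; have := c_ge0 l; rewrite /p /q; lra.
by apply: lerXn2r; rewrite ?nnegrE; nra.
Qed.

Lemma hit_probability_ge0 k : 0 <= hit_probability k.
Proof.
have /andP[p0 p1] := cell_le1 k.
by rewrite subr_ge0 exprn_ile1//; [rewrite subr_ge0|rewrite gerBl].
Qed.

Lemma occupied_cells_mean :
  \int[P]_w #|occupied_cells (M := M) (fun i => u i w) c|%:R = \sum_(k < M) hit_probability k.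
Proof.
have Lvac k : L1 P (\1_(vac k) : T -> R).
  apply: (@L1_bounded _ _ _ P _ 1) => [|w]; first exact: measurable_indic.
  by rewrite indicE; case: (_ \in _); rewrite ?normr1 ?normr0.
under eq_Rintegral do rewrite occupied_cellsE.
rewrite int_sum; last by move=> k; apply: L1B => //; exact: L1_cst.
apply: eq_bigr => k _; rewrite intB//; last exact: L1_cst.
by rewrite int_cst int_vac.
Qed.

(* Vacancies of distinct cells are negatively correlated, since
   1 - p - q <= (1 - p) (1 - q). *)
Lemma occupied_cells_deviation :
  L1 P (fun w => (#|occupied_cells (M := M) (fun i => u i w) c|%:R
     - \sum_(k < M) hit_probability k) ^+ 2) /\
  \int[P]_w (#|occupied_cells (M := M) (fun i => u i w) c|%:R
     - \sum_(k < M) hit_probability k) ^+ 2 <= \sum_(k < M) hit_probability k.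
Proof.
pose v k := (1 - (c k.+1 - c k)) ^+ n.
pose D (k : 'I_M) w : R := v k - \1_(vac k) w.
have E w : #|occupied_cells (M := M) (fun i => u i w) c|%:R
     - \sum_(k < M) hit_probability k = \sum_k D k w.
  rewrite occupied_cellsE -sumrB; apply: eq_bigr => k _; rewrite /hit_probability /D /v; ring.
have -> : (fun w => (#|occupied_cells (M := M) (fun i => u i w) c|%:R
     - \sum_(k < M) hit_probability k) ^+ 2) = (fun w => (\sum_k D k w) ^+ 2).
  by apply/funext => w; rewrite E.
have Lvac k : L1 P (\1_(vac k) : T -> R).
  apply: (@L1_bounded _ _ _ P _ 1) => [|w]; first exact: measurable_indic.
  by rewrite indicE; case: (_ \in _); rewrite ?normr1 ?normr0.
have Lvac2 k l : L1 P (fun w => \1_(vac k) w * \1_(vac l) w : R).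
  apply: (@L1_bounded _ _ _ P _ 1) => [|w].
    by apply: measurable_funM; exact: measurable_indic.
  by rewrite !indicE; do 2 case: (_ \in _); rewrite ?(mul0r, mulr0, mulr1, normr1, normr0).
have DDE k l : (fun w => D k w * D l w) =
  (fun w => (v k * v l - v k * \1_(vac l) w) - (v l * \1_(vac k) w - \1_(vac k) w * \1_(vac l) w)).
  by apply/funext => w; rewrite /D; ring.
have LDD k l : L1 P (fun w => D k w * D l w).
  by rewrite DDE; do 2! apply: L1B; rewrite ?L1_cst//; exact: L1Z.
apply: int_sqr_sum_le => // k l; rewrite DDE.
rewrite intB; [|by apply: L1B; [exact: L1_cst|exact: L1Z]|by apply: L1B => //; exact: L1Z].
rewrite intB; [|exact: L1_cst|exact: L1Z].
rewrite intB; [|exact: L1Z|by []].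
rewrite int_cst !intZ// !int_vac -/(v k) -/(v l).
have [<-|kl] := eqVneq k l; last first.
  have klN : (k : nat) != l by [].
  by have := int_vac2 klN; rewrite -/(v k) -/(v l) mul0r; lra.
have -> : (fun w => \1_(vac k) w * \1_(vac k) w : R) = \1_(vac k).
  by apply/funext => w; rewrite indicE; case: (_ \in _); rewrite ?mulr0 ?mulr1.
(* Diagonal term: v - v^2 <= 1 - v because (1 - v)^2 >= 0. *)
rewrite int_vac -/(v k) mul1r /hit_probability -/(v k); have := sqr_ge0 (v k - 1).
have : 0 <= v k by have := hit_probability_ge0 k; have /andP[p0 p1] := cell_le1 k; rewrite /v exprn_ge0// subr_ge0.
nra.
Qed.

End occupancy.
End uniform_sample.

Lemma measurable_binE {d : measure_display} {T : measurableType d} {R : realType}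
    (q : T -> R) n (f : nat -> T -> R) :
    measurable_fun setT q -> (forall j, measurable_fun setT (f j)) ->
  measurable_fun setT (fun w => binE (q w) n (fun j => f j w)).
Proof.
move=> mq; elim: n f => [|n IH] f mf /=; first exact: mf.
apply: measurable_funD; apply: measurable_funM => //.
- by apply: (IH (fun j => f j.+1)) => j; exact: mf.
- exact: measurable_funB.
- exact: IH.
Qed.

Lemma binE_in01 {R : realType} (q : R) n f : 0 <= q <= 1 ->
  (forall j, (j <= n)%N -> 0 <= f j <= 1) -> 0 <= binE q n f <= 1.
Proof.
move=> q01 f01; rewrite binE_ge0//=; last by move=> j /f01/andP[].
by rewrite -[leRHS](binE_cst q n); apply: le_binE => // j /f01/andP[].
Qed.

(** * Compensation of the hitting probabilities *)

Section compensation.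
Context {R : realType} {d : measure_display} {T : measurableType d}.
Variables (P : probability T R) (S : R -> {RV P >-> R}) (nu : {measure set R -> \bar R}).
Hypothesis subS : is_subordinator S.
Hypothesis driftS : driftfree_with_levy_measure S nu.
Local Notation phi := (laplace_exponent nu).
Variables (h : R) (n : nat).
Hypothesis h0 : 0 <= h.

Let Y := increment S h.
Let mY := measurable_increment S h.
Let indY := independent_increment subS h0.
Local Notation Tk k := (g_sigma_algebraType (past Y k)).

Let mT {k} (f : Tk k -> R) : measurable_fun setT f -> measurable_fun setT (f : T -> R).
Proof.
by move=> mf; apply: (measurableT_comp mf (measurable_sub_sigma (past_measurable mY (k := k)))).
Qed.

(** Averaging over [Y k] with the past frozen. The success probability q is random but determined by
    the past, so each trial only multiplies the weight [H] by q or 1 - q, which leaves it bounded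
    and measurable for the past. *)
Lemma int_past_binE k (q H : Tk k -> R) (M : R) N (psi : nat -> R -> R) (e : nat -> R) :
    measurable_fun setT q -> (forall w, 0 <= q w <= 1) ->
    measurable_fun setT H -> (forall w, `|H w| <= M) ->
    (forall j, measurable_fun setT (psi j)) -> (forall j y, `|psi j y| <= 1) ->
    (forall j, \int[P]_w psi j (Y k w) = e j) ->
  \int[P]_w (H w * binE (q w) N (fun j => psi j (Y k w))) =
  \int[P]_w (H w * binE (q w) N e).
Proof.
move=> mq q01; elim: N H M psi e => [|N IH] H M psi e mH HM mpsi psi1 eE.
  rewrite /= (int_mul_past mY indY (M := M) (M' := 1))// eE.
  have LH : L1 P H by apply: (@L1_bounded _ _ _ P _ M) => //; exact: mT.
  rewrite mulrC -intZ//; congr Rintegral; apply/funext => w; exact: mulrC.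
have e1 j : `|e j| <= 1.
  rewrite -eE -(int_cst P 1); apply: le_norm_int => //; last exact: L1_cst.
  apply: (@L1_bounded _ _ _ P _ 1) => //; exact: measurableT_comp.
have M0 : 0 <= M by rewrite (le_trans _ (HM point)).
have mqT : measurable_fun setT (q : T -> R) by exact: mT.
have mHT : measurable_fun setT (H : T -> R) by exact: mT.
have mpY j : measurable_fun setT (fun w => psi j (Y k w)) by exact: measurableT_comp.
pose H1 w := H w * q w; pose H2 w := H w * (1 - q w).
have mH1 : measurable_fun setT H1 by exact: measurable_funM.
have mH2 : measurable_fun setT H2.
  by apply: measurable_funM => //; apply: measurable_funB.
have H1M w : `|H1 w| <= M.
  have /andP[? ?] := q01 w; rewrite normrM (le_trans _ (HM w))// ler_piMr//.
  by rewrite ger0_norm.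
have H2M w : `|H2 w| <= M.
  have /andP[? ?] := q01 w; rewrite normrM (le_trans _ (HM w))// ler_piMr//.
  by rewrite ger0_norm ?subr_ge0// gerBl.
have E (g : nat -> T -> R) : (fun w => H w * binE (q w) N.+1 (fun j => g j w)) =
    (fun w => H1 w * binE (q w) N (fun j => g j.+1 w) + H2 w * binE (q w) N (fun j => g j w)).
  by apply/funext => w; rewrite /= /H1 /H2; ring.
have L (K : T -> R) (g : nat -> T -> R) : measurable_fun setT K -> (forall w, `|K w| <= M) ->
    (forall j, measurable_fun setT (g j)) -> (forall j w, `|g j w| <= 1) ->
    L1 P (fun w => K w * binE (q w) N (fun j => g j w)).
  move=> mK KM mg g1; apply: (@L1_bounded _ _ _ P _ M) => [|w].
    by apply: measurable_funM => //; exact: measurable_binE.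
  rewrite normrM -[leRHS]mulr1 ler_pM//.
  by rewrite -[leRHS](binE_cst (q w) N); apply: le_norm_binE.
rewrite (E (fun j w => psi j (Y k w))) (E (fun j _ => e j)).
rewrite !intD; [|by apply: L => //; exact: mT..].
congr (_ + _); first by apply: (IH _ M (fun j => psi j.+1) (fun j => e j.+1)).
exact: (IH _ M).
Qed.

(** Given S, the probability that a sample point lies beyond the left end of cell k. *)
Definition survival k w : R := expR (- S (k%:R * h) w).

Lemma survival01 k w : 0 <= survival k w <= 1.
Proof.
by rewrite expR_ge0 -expR0 ler_expR oppr_le0 (subordinator_ge0 subS)// mulr_ge0.
Qed.

Definition cell_hit k w : R := hit_probability (n := n) (fun k => squashed S (k%:R * h) w) k.

(** Regenerative structure: the number j of points beyond the left end of the cell is binomial, and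
    each of them avoids the cell with probability exp (- Y k), independently. *)
Lemma cell_hitE k w :
  cell_hit k w = binE (survival k w) n (fun j => 1 - expR (- (j%:R * Y k w))).
Proof.
rewrite binEB binE_cst; congr (_ - _).
rewrite (eq_binE _ _ (g := fun j => expR (- Y k w) ^+ j)); last first.
  by move=> j; rewrite -mulrN -expRM_natl.
rewrite binE_pow; congr (_ ^+ _); rewrite /squashed /survival /Y /increment.
have -> : - S (k.+1%:R * h) w = - S (k%:R * h) w + - (S (k.+1%:R * h) w - S (k%:R * h) w).
  by ring.
by rewrite expRD; ring.
Qed.

(** The conditional mean of [cell_hit k] given the past: exp (- j Y k) is replaced by its
    expectation exp (- h phi j). *)
Definition cell_mean k w : R :=
  binE (survival k w) n (fun j => 1 - expR (- (h * phi j%:R))).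

Lemma cell_hit01 k w : 0 <= cell_hit k w <= 1.
Proof.
rewrite cell_hitE; apply: binE_in01 => [|j _]; first exact: survival01.
by rewrite expB1_le1 expB1_ge0// mulr_ge0// (increment_ge0 subS).
Qed.

Lemma cell_mean01 k w : 0 <= cell_mean k w <= 1.
Proof.
apply: binE_in01 => [|j _]; first exact: survival01.
by rewrite expB1_le1 expB1_ge0// mulr_ge0// laplace_exponent_ge0.
Qed.

Let m_survival l k : (l <= k)%N -> measurable_fun setT (survival l : Tk k -> R).
Proof.
move=> lk; apply: (measurableT_comp (@measurable_expR R)); apply: measurable_funN.
have -> : (S (l%:R * h) : T -> R) = (fun w => \sum_(i < l) Y i w).
  by apply/funext => w; rewrite (sum_increment subS).
by apply: measurable_sum => i; apply: measurable_past; exact: leq_trans lk.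
Qed.

Let m_psi j : measurable_fun setT (fun y : R => 1 - expR (- (j%:R * y))).
Proof.
apply: measurable_funB => //; apply: (measurableT_comp (@measurable_expR R)).
by apply: measurable_funN; exact: mulrl_measurable.
Qed.

Lemma measurable_cell_mean l k : (l <= k)%N ->
  measurable_fun setT (cell_mean l : Tk k -> R).
Proof. by move=> lk; apply: measurable_binE => //; exact: m_survival. Qed.

Lemma measurable_cell_hit l k : (l < k)%N -> measurable_fun setT (cell_hit l : Tk k -> R).
Proof.
move=> lk; have -> : cell_hit l = (fun w =>
    binE (survival l w) n (fun j => 1 - expR (- (j%:R * Y l w)))).
  by apply/funext => w; exact: cell_hitE.
apply: measurable_binE => [|j]; first by apply: m_survival; exact: ltnW.
by apply: (measurableT_comp (m_psi j)); exact: measurable_past.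
Qed.

Lemma int_past_cell_hit k (H : Tk k -> R) (M : R) :
    measurable_fun setT H -> (forall w, `|H w| <= M) ->
  \int[P]_w (H w * cell_hit k w) = \int[P]_w (H w * cell_mean k w).
Proof.
move=> mH HM.
(* The positive part makes psi bounded by 1 on all of R; increments are nonnegative, so its values
   at [Y k] do not change. *)
pose psi (j : nat) (y : R) := 1 - expR (- (j%:R * Num.max 0 y)).
have psiE j w : psi j (Y k w) = 1 - expR (- (j%:R * Y k w)).
  by rewrite /psi max_r// (increment_ge0 subS).
rewrite -(@int_past_binE k _ H M n psi) //.
- by apply: eq_Rintegral => w _; rewrite cell_hitE; congr (_ * _); exact: eq_binE.
- exact: m_survival.
- exact: survival01.
- move=> j; apply: (measurableT_comp (m_psi j)).
  by apply: measurable_maxr; [exact: measurable_cst|exact: measurable_id].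
- move=> j y; rewrite ger0_norm ?expB1_le1// expB1_ge0// mulr_ge0//.
  by rewrite le_max lexx.
- move=> j; under eq_Rintegral do rewrite psiE.
  rewrite intB ?int_cst; [|exact: L1_cst|].
    by congr (_ - _); rewrite (laplace_increment subS driftS).
  apply: (@L1_bounded _ _ _ P _ 1) => [|w].
    by apply: (measurableT_comp (@measurable_expR R)); apply: measurable_funN; apply: measurable_funM.
  by rewrite ger0_norm ?expR_ge0// -expR0 ler_expR oppr_le0 mulr_ge0// (increment_ge0 subS).
Qed.

Let L1_past k (f : T -> R) : (forall w, 0 <= f w <= 1) ->
  measurable_fun setT (f : Tk k -> R) -> L1 P f.
Proof.
move=> f01 mf; apply: (@L1_bounded _ _ _ P _ 1) => [|w]; first exact: (mT (k := k)).
by have /andP[? ?] := f01 w; rewrite ger0_norm.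
Qed.

(** At most n points lie beyond the left end of the cell, so j is replaced by n before averaging. *)
Lemma int_cell_hit_le k : \int[P]_w cell_hit k w <= h * phi n%:R.
Proof.
have Le : L1 P (fun w => expR (- (n%:R * Y k w))).
  apply: (@L1_bounded _ _ _ P _ 1) => [|w].
    by apply: (measurableT_comp (@measurable_expR R)); apply: measurable_funN; apply: measurable_funM.
  by rewrite ger0_norm ?expR_ge0// -expR0 ler_expR oppr_le0 mulr_ge0// (increment_ge0 subS).
apply: (@le_trans _ _ (1 - expR (- (h * phi n%:R)))); last exact: expB1_le.
rewrite -(laplace_increment subS driftS k)// -[X in X - _](int_cst P 1) -intB//; last exact: L1_cst.
apply: le_int.
- by apply: (@L1_past k.+1); [exact: cell_hit01|exact: measurable_cell_hit].
- by apply: L1B => //; exact: L1_cst.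
move=> w; rewrite cell_hitE -[leRHS](binE_cst (survival k w) n); apply: le_binE => [|j jn].
  exact: survival01.
by rewrite lerD2l lerN2 ler_expR lerN2 ler_wpM2r ?ler_nat// (increment_ge0 subS).
Qed.

Lemma L1_cell_hit k : L1 P (cell_hit k).
Proof. by apply: (@L1_past k.+1); [exact: cell_hit01|exact: measurable_cell_hit]. Qed.

Lemma L1_cell_mean k : L1 P (cell_mean k).
Proof. by apply: (@L1_past k.+1); [exact: cell_mean01|exact: measurable_cell_mean]. Qed.

(* The differences [cell_hit k - cell_mean k] are orthogonal martingale increments. *)
Lemma cell_hit_compensation M :
  L1 P (fun w => (\sum_(k < M) cell_hit k w - \sum_(k < M) cell_mean k w) ^+ 2) /\
  \int[P]_w (\sum_(k < M) cell_hit k w - \sum_(k < M) cell_mean k w) ^+ 2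
    <= M%:R * (h * phi n%:R).
Proof.
pose D (k : 'I_M) w : R := cell_hit k w - cell_mean k w.
have -> : (fun w => (\sum_(k < M) cell_hit k w - \sum_(k < M) cell_mean k w) ^+ 2) =
    (fun w => (\sum_k D k w) ^+ 2).
  by apply/funext => w; rewrite -sumrB.
have mD (k : 'I_M) l : (k < l)%N -> measurable_fun setT (D k : Tk l -> R).
  move=> kl; apply: measurable_funB; first exact: measurable_cell_hit.
  by apply: measurable_cell_mean; exact: ltnW.
have D1 k w : `|D k w| <= 1.
  have /andP[? ?] := cell_hit01 k w; have /andP[? ?] := cell_mean01 k w.
  rewrite /D ler_norml; apply/andP; split; lra.
have LDD k l : L1 P (fun w => D k w * D l w).
  apply: (@L1_bounded _ _ _ P _ 1) => [|w].
    by apply: measurable_funM; apply: (mT (k := M)); exact: mD.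
  by rewrite normrM -[leRHS]mulr1 ler_pM.
have L2 (f g : T -> R) : (forall w, 0 <= f w <= 1) -> (forall w, 0 <= g w <= 1) ->
    L1 P f -> L1 P g -> L1 P (fun w => f w * g w).
  move=> f01 g01 Lf Lg; apply: (@L1_bounded _ _ _ P _ 1) => [|w].
    by apply: measurable_funM; [exact: (L1_measurable Lf)|exact: (L1_measurable Lg)].
  have /andP[? ?] := f01 w; have /andP[? ?] := g01 w.
  by rewrite ger0_norm ?mulr_ge0// mulr_ile1.
have Lhh k := L2 _ _ (cell_hit01 k) (cell_hit01 k) (L1_cell_hit k) (L1_cell_hit k).
have Lmh k := L2 _ _ (cell_mean01 k) (cell_hit01 k) (L1_cell_mean k) (L1_cell_hit k).
have Lmm k := L2 _ _ (cell_mean01 k) (cell_mean01 k) (L1_cell_mean k) (L1_cell_mean k).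
have LDm (k l : 'I_M) : L1 P (fun w => D k w * cell_mean l w).
  apply: (@L1_bounded _ _ _ P _ 1) => [|w].
    by apply: measurable_funM; [apply: (mT (k := M)); exact: mD|exact: (L1_measurable (L1_cell_mean l))].
  have /andP[? ?] := cell_mean01 l w.
  by rewrite normrM -[leRHS]mulr1 ler_pM// ger0_norm.
have LDh (k l : 'I_M) : L1 P (fun w => D k w * cell_hit l w).
  apply: (@L1_bounded _ _ _ P _ 1) => [|w].
    by apply: measurable_funM; [apply: (mT (k := M)); exact: mD|exact: (L1_measurable (L1_cell_hit l))].
  have /andP[? ?] := cell_hit01 l w.
  by rewrite normrM -[leRHS]mulr1 ler_pM// ger0_norm.
have orth (k l : 'I_M) : (k < l)%N -> \int[P]_w (D k w * D l w) = 0.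
  move=> kl; have -> : (fun w => D k w * D l w) =
      (fun w => D k w * cell_hit l w - D k w * cell_mean l w).
    by apply/funext => w; rewrite -mulrBr.
  rewrite intB// (@int_past_cell_hit l (D k) 1) ?subrr//.
  exact: mD.
have DB (k l : 'I_M) : \int[P]_w (D k w * D l w) <= (k == l)%:R * \int[P]_w cell_hit k w.
  have [<-|kl] := eqVneq k l; last first.
    rewrite mul0r; move: kl; rewrite neq_lt => /orP[kl|lk]; first by rewrite orth.
    by under eq_Rintegral do rewrite mulrC; rewrite orth.
  (* The mixed term has the mean of [cell_mean] squared, so the second moment of D is E hit^2 - E
     mean^2 <= E hit, as hit takes values in [0, 1]. *)
  rewrite mul1r; have -> : (fun w => D k w * D k w) = (fun w =>
      (cell_hit k w * cell_hit k w - 2 * (cell_mean k w * cell_hit k w))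
      + cell_mean k w * cell_mean k w).
    by apply/funext => w; rewrite /D; ring.
  rewrite intD; [|by apply: L1B => //; exact: L1Z|by []].
  rewrite intB; [|by []|exact: L1Z].
  rewrite intZ// (@int_past_cell_hit k (cell_mean k) 1); last 2 first.
  - exact: measurable_cell_mean.
  - by move=> w; have /andP[? ?] := cell_mean01 k w; rewrite ger0_norm.
  have mm0 : 0 <= \int[P]_w (cell_mean k w * cell_mean k w).
    by apply: int_ge0 => w; rewrite -expr2 sqr_ge0.
  have hh : \int[P]_w (cell_hit k w * cell_hit k w) <= \int[P]_w cell_hit k w.
    apply: le_int => // [|w]; first exact: L1_cell_hit.
    by have /andP[? ?] := cell_hit01 k w; rewrite ler_piMr.
  lra.
have [L le] := int_sqr_sum_le LDD DB; split=> //; apply: (le_trans le).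
apply: (@le_trans _ _ (\sum_(k < M) h * phi n%:R)).
  by apply: ler_sum => k _; exact: int_cell_hit_le.
by rewrite sumr_const card_ord mulr_natl.
Qed.

End compensation.

(** * Logarithm of a binomial number *)

Section binomial_log.
Context {R : realType}.

Lemma ln_le_sub1 (y : R) : 0 < y -> ln y <= y - 1.
Proof. by move=> y0; have := @le_ln1Dx R (y - 1); rewrite (addrC 1) subrK; apply; lra. Qed.

(** Jensen for the concave logarithm, by its tangent at 1 + n q, the mean of j + 1. *)
Lemma binE_ln_le (q : R) n : 0 < q <= 1 ->
  binE q n (fun j => ln j.+1%:R) <= ln (1 + n%:R * q).
Proof.
move=> /andP[q0 q1]; have q01 : 0 <= q <= 1 by rewrite ltW.
have a0 : 0 < 1 + n%:R * q by rewrite ltr_wpDr// mulr_ge0// ltW.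
set a := 1 + n%:R * q in a0 *.
apply: (@le_trans _ _ (binE q n (fun j => (ln a - 1 + a^-1) + a^-1 * j%:R))).
  apply: le_binE => // j _.
  have j0 : 0 < j.+1%:R / a :> R by rewrite divr_gt0.
  have := ln_le_sub1 j0; rewrite ln_div ?posrE//.
  by rewrite -natr1 mulrDl mul1r (mulrC _ a^-1); lra.
rewrite binED binE_cst binEZ binE_id.
have -> : n%:R * q = a - 1 by rewrite /a addrC addKr.
by rewrite mulrBr mulVf ?gt_eqF//; lra.
Qed.

(** The bound ln y >= 1 - 1 / y with y = (j + 1) / (n q) reduces it to the inverse moment of j +
    1. *)
Lemma binE_ln_ge (q : R) n : (0 < n)%N -> 0 < q <= 1 ->
  ln (n%:R * q) <= binE q n (fun j => ln j.+1%:R).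
Proof.
move=> n0 /andP[q0 q1]; have q01 : 0 <= q <= 1 by rewrite ltW.
have a0 : 0 < n%:R * q by rewrite mulr_gt0// ltr0n.
set a := n%:R * q in a0 *.
apply: (@le_trans _ _ (binE q n (fun j => (ln a + 1) - a * j.+1%:R^-1))); last first.
  apply: le_binE => // j _.
  have j0 : 0 < a / j.+1%:R :> R by rewrite divr_gt0.
  have := ln_le_sub1 j0; rewrite ln_div ?posrE//.
  by move: (a / _) (ln a) (ln _) => z la lj; lra.
rewrite binEB binE_cst binEZ -addrA lerDl subr_ge0.
have /(binE_inv_le n) le : 0 < q <= 1 by rewrite q0.
apply: (@le_trans _ _ (a * (n.+1%:R * q)^-1)); first by rewrite ler_wpM2l// ltW.
rewrite ler_pdivrMr ?mul1r ?mulr_gt0//.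
by rewrite /a ler_wpM2r ?ler_nat ?ltW.
Qed.

(** About n exp (- s) points survive to level s, and the logarithm of this number is ln n - s. If n
    q > 1 the two preceding bounds differ by at most ln 2; otherwise the positive part is 0 and the
    mean at most 1. *)
Lemma binE_ln_approx (s : R) n : (0 < n)%N -> 0 <= s ->
  `|binE (expR (- s)) n (fun j => ln j.+1%:R) - Num.max 0 (ln n%:R - s)| <= 1.
Proof.
move=> n0 s0; set q := expR (- s).
have q0 : 0 < q by exact: expR_gt0.
have q1 : q <= 1 by rewrite -expR0 ler_expR oppr_le0.
have q01 : 0 < q <= 1 by rewrite q0.
have nR : 0 < n%:R :> R by rewrite ltr0n.
have lnq : ln (n%:R * q) = ln n%:R - s by rewrite lnM ?posrE// expRK.
have up := binE_ln_le n q01; have lo := binE_ln_ge n0 q01.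
have b0 : 0 <= binE q n (fun j => ln j.+1%:R).
  by apply: binE_ge0 => [|j _]; [rewrite ltW|rewrite ln_ge0// ler1n].
rewrite lnq in lo; have a0 : 0 < n%:R * q by rewrite mulr_gt0.
have ln2 : ln 2 <= 1 :> R by have := @ln_le_sub1 2 (ltr0Sn _ _); lra.
have [le1|gt1] := leP (n%:R * q) 1.
  have : ln (1 + n%:R * q) <= 1 by have := @ln_le_sub1 (1 + n%:R * q) ltac:(lra); lra.
  have : ln n%:R - s <= 0 by rewrite -lnq ln_le0.
  move=> l0 u1; rewrite max_l// subr0 ger0_norm//; exact: le_trans up u1.
have : ln (1 + n%:R * q) <= ln 2 + (ln n%:R - s).
  by rewrite -lnq -lnM ?posrE// ler_ln ?posrE; nra.
have l0 : 0 <= ln n%:R - s by rewrite -lnq ln_ge0// ltW.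
by move=> u1; rewrite max_r// ler_norml; apply/andP; split; lra.
Qed.

Variable nu : {measure set R -> \bar R}.
Hypothesis levy : is_levy_measure nu.
Hypothesis cL : condition_L nu.
Local Notation phi := (laplace_exponent nu).

Lemma cell_mean_approx : exists2 C1, 0 <= C1 & forall n h s, (0 < n)%N ->
    0 <= h -> h * phi n%:R ^+ 2 <= 1 -> 0 <= s ->
  `|binE (expR (- s)) n (fun j => 1 - expR (- (h * phi j%:R)))
     - h * Num.max 0 (ln n%:R - s)| <= C1 * h.
Proof.
have [C C0 CP] := laplace_exponent_log levy cL.
(* C comes from the approximation of phi j by ln (j + 1), one unit from the quadratic term h^2 phi^2
   <= h, and one from [binE_ln_approx]. *)
exists (C + 2) => [|n h s n0 h0 hphi s0]; first by rewrite addr_ge0.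
set q := expR (- s).
have q01 : 0 <= q <= 1 by rewrite expR_ge0 -expR0 ler_expR oppr_le0.
have B : `|binE q n (fun j => 1 - expR (- (h * phi j%:R)))
    - h * binE q n (fun j => ln j.+1%:R)| <= (C + 1) * h.
  rewrite -binEZ -binEB -(binE_cst q n ((C + 1) * h)).
  apply: le_norm_binE => // j jn.
  have pj0 : 0 <= phi j%:R by exact: laplace_exponent_ge0.
  have pjn : phi j%:R <= phi n%:R by apply: le_laplace_exponent; rewrite // ler_nat.
  have T := norm_expRN_taylor (mulr_ge0 h0 pj0).
  have hj : (h * phi j%:R) ^+ 2 <= h.
    have pp : phi j%:R ^+ 2 <= phi n%:R ^+ 2.
      by move: (phi j%:R) (phi n%:R) pj0 pjn => x y x0 xy; rewrite !expr2 ler_pM.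
    have : h * phi j%:R ^+ 2 <= 1 := le_trans (ler_wpM2l h0 pp) hphi.
    by move=> H; rewrite exprMn expr2 -mulrA ler_piMr.
  have hl : `|h * phi j%:R - h * ln j.+1%:R| <= h * C.
    by rewrite -mulrBr normrM ger0_norm// ler_wpM2l.
  have -> : 1 - expR (- (h * phi j%:R)) - h * ln j.+1%:R =
    - (expR (- (h * phi j%:R)) - (1 - h * phi j%:R)) + (h * phi j%:R - h * ln j.+1%:R).
    by ring.
  apply: (le_trans (ler_normD _ _)); rewrite normrN mulrDl mul1r addrC (mulrC C) lerD//.
  exact: le_trans T hj.
have A := binE_ln_approx n0 s0; rewrite -/q in A.
have -> : binE q n (fun j => 1 - expR (- (h * phi j%:R))) - h * Num.max 0 (ln n%:R - s) =
  (binE q n (fun j => 1 - expR (- (h * phi j%:R))) - h * binE q n (fun j => ln j.+1%:R))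
  + h * (binE q n (fun j => ln j.+1%:R) - Num.max 0 (ln n%:R - s)) by ring.
apply: (le_trans (ler_normD _ _)).
have : `|h * (binE q n (fun j => ln j.+1%:R) - Num.max 0 (ln n%:R - s))| <= h.
  by rewrite normrM ger0_norm// ler_piMr.
by move=> H; have := lerD B H; lra.
Qed.

End binomial_log.

(** A Riemann sum of mesh h = 1 / m of a nonincreasing function lies between the sums over right and
    left end points of unit intervals, which differ by psi 0 - psi N <= L. *)
Lemma ler_sum_blocks {R : realType} (psi : R -> R) (N m : nat) (h L : R) :
    h * m%:R = 1 -> 0 <= h -> (forall s t, 0 <= s -> s <= t -> psi t <= psi s) ->
    (forall t, 0 <= t -> 0 <= psi t <= L) ->
  `|\sum_(k < N * m) h * psi (k%:R * h) - \sum_(j < N) psi j%:R| <= L.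
Proof.
move=> hm h0 mono psiL.
have low : \sum_(j < N) psi j.+1%:R <= \sum_(k < N * m) h * psi (k%:R * h).
  elim: N => [|N IH]; first by rewrite mul0n !big_ord0.
  rewrite big_ord_recr/= mulSnr big_split_ord/= lerD//.
  apply: (@le_trans _ _ (\sum_(i < m) h * psi N.+1%:R)).
    by rewrite sumr_const card_ord -[_ *+ m]mulr_natl mulrA (mulrC m%:R) hm mul1r.
  apply: ler_sum => i _; rewrite ler_wpM2l//; apply: mono; first exact: mulr_ge0.
  rewrite natrD mulrDl natrM -mulrA (mulrC m%:R) hm mulr1 -natr1 lerD2l//.
  apply: (@le_trans _ _ (m%:R * h)); last by rewrite mulrC hm.
  by apply: ler_wpM2r => //; rewrite ler_nat; exact: ltnW.
have up : \sum_(k < N * m) h * psi (k%:R * h) <= \sum_(j < N) psi j%:R.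
  elim: N {low} => [|N IH]; first by rewrite mul0n !big_ord0.
  rewrite big_ord_recr/= mulSnr big_split_ord/= lerD//.
  apply: (@le_trans _ _ (\sum_(i < m) h * psi N%:R)); last first.
    by rewrite sumr_const card_ord -[_ *+ m]mulr_natl mulrA (mulrC m%:R) hm mul1r.
  apply: ler_sum => i _; rewrite ler_wpM2l//; apply: mono => //.
  by rewrite natrD mulrDl natrM -mulrA (mulrC m%:R) hm mulr1 lerDl mulr_ge0.
have tele : \sum_(j < N) psi j%:R - \sum_(j < N) psi j.+1%:R = psi 0 - psi N%:R.
  elim: N {low up} => [|N IH]; first by rewrite !big_ord0 !subrr.
  by rewrite !big_ord_recr/=; lra.
have := psiL 0 (lexx _); have /andP[? ?] := psiL N%:R (ler0n _ _) => /andP[? ?].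
by rewrite ler_norml; apply/andP; split; lra.
Qed.

Section counting.
Context {R : realType} {d : measure_display} {T : measurableType d} {I : finType}.
Variable p : I -> T -> bool.
Hypothesis mp : forall i, measurable [set z | p i z].

Lemma card_setE z : #|[set i | p i z]%SET|%:R = \sum_i \1_[set z | p i z] z :> R.
Proof.
rewrite -sum1_card natr_sum big_mkcond/=; apply: eq_bigr => i _.
by rewrite inE indicE; case: ifPn => pi; [rewrite mem_set|rewrite memNset//; exact/negP].
Qed.

Lemma measurable_card_set : measurable_fun setT (fun z => #|[set i | p i z]%SET|%:R : R).
Proof.
have -> : (fun z => #|[set i | p i z]%SET|%:R : R) = (fun z => \sum_i \1_[set z | p i z] z).
  by apply/funext => z; exact: card_setE.
by apply: measurable_sum => i; exact: measurable_indic.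
Qed.

Lemma measurable_exists : measurable [set z | [exists i, p i z]].
Proof.
have -> : [set z | [exists i, p i z]] = \bigcup_(i in [set: I]) [set z | p i z].
  by apply/seteqP; split=> z /= => [/existsP[i pi]|[i _ pi]]; [exists i|apply/existsP; exists i].
exact: fin_bigcup_measurable.
Qed.

Lemma L1_card_set (P : probability T R) : L1 P (fun z => #|[set i | p i z]%SET|%:R : R).
Proof.
apply: (@L1_bounded _ _ _ P _ #|I|%:R) => [|z]; first exact: measurable_card_set.
by rewrite ger0_norm// ler_nat max_card.
Qed.

Lemma int_card_set (P : probability T R) :
  \int[P]_z #|[set i | p i z]%SET|%:R = \sum_i fine (P [set z | p i z]).
Proof.
under eq_Rintegral do rewrite card_setE.
rewrite int_sum; first by apply: eq_bigr => i _; rewrite int_indic.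
move=> i; apply: (@L1_bounded _ _ _ P _ 1) => [|w]; first exact: measurable_indic.
by rewrite indicE; case: (_ \in _); rewrite ?normr1 ?normr0.
Qed.

End counting.

Lemma measurable_bool {d : measure_display} {T : measurableType d} (b : T -> bool) :
  measurable_fun setT b -> measurable [set z | b z].
Proof. by move=> mb; rewrite -[X in measurable X]setTI; exact: (mb measurableT [set true]). Qed.

Section uniform_ties.
Context {R : realType} {d : measure_display} {T : measurableType d}.
Variable P : probability T R.
Context {n : nat}.
Variable u : 'I_n -> {RV P >-> R}.
Hypothesis iid : iid_uniform u.

Lemma unif_ge0 B : 0 <= unif B :> R.
Proof. by rewrite fine_ge0// measure_ge0. Qed.

Lemma unif01 : unif `[0, 1[%classic = 1 :> R.
Proof. by rewrite unif_itv// subr0. Qed.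

Lemma probability_outside i : P [set w | ~~ (0 <= u i w < 1)] = 0%E.
Proof.
have -> : [set w | ~~ (0 <= u i w < 1)] = u i @^-1` (~` `[0, 1[%classic).
  by apply/seteqP; split=> w /=; rewrite in_itv/= => /negP.
have mB : measurable (u i @^-1` `[0, 1[%classic).
  by rewrite -[X in measurable X]setTI; apply: measurable_funPT => //; exact: measurable_itv.
by rewrite preimage_setC (probability_setC _ mB) (unifE iid)// unif01 subee.
Qed.

(** Two independent uniform points fall into the same one of m + 1 equal cells with probability 1 /
    (m + 1), for every m. *)
Lemma probability_tie i j : i != j -> P [set w | u i w == u j w] = 0%E.
Proof.
move=> ij; have [_ ind] := iid.
have mtie : measurable [set w | u i w == u j w].
  by apply: measurable_bool; apply: measurable_fun_eqr; exact: measurable_funPT.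
have mout : measurable [set w | ~~ (0 <= u i w < 1)].
  have -> : [set w | ~~ (0 <= u i w < 1)] = u i @^-1` (~` `[0, 1[%classic).
    by apply/seteqP; split=> w /=; rewrite in_itv/= => /negP.
  by rewrite -[X in measurable X]setTI; apply: measurable_funPT => //; exact: measurableC.
have bnd (m : nat) : (P [set w | u i w == u j w] <= (m.+1%:R^-1)%:E)%E.
  pose c (k : nat) : R := k%:R / m.+1%:R.
  pose B (k : nat) : set R := `[c k, c k.+1[%classic.
  have cm k l : (k <= l)%N -> c k <= c l by move=> kl; rewrite ler_wpM2r// ler_nat.
  pose E (k : nat) := (u i @^-1` B k) `&` (u j @^-1` B k).
  have PE (k : nat) : (k < m.+1)%N -> P (E k) = ((m.+1%:R^-1) ^+ 2)%:E.
    move=> km.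
    have -> : E k = \bigcap_(l in [set` [set i; j]%SET]) (u l @^-1` B k).
      apply/seteqP; split=> w; first by move=> [wi wj] l /=; rewrite !inE => /orP[]/eqP ->.
      by move=> h; split; apply: h; rewrite /= !inE eqxx ?orbT.
    rewrite ind; last by move=> l _; exists (B k); [exact: measurable_itv|rewrite setTI].
    rewrite big_setU1/= ?inE// big_set1 !(unifE iid); [|exact: measurable_itv..].
    have -> : unif (B k) = m.+1%:R^-1.
      rewrite unif_itv; first by rewrite /c -mulrBl -natr1 addrC addKr mul1r.
      - by rewrite divr_ge0.
      - exact: cm.
      - by rewrite ler_pdivrMr// mul1r ler_nat.
    by rewrite -EFinM -expr2.
  have mE k : measurable (E k).
    by apply: measurableI; rewrite -[X in measurable X]setTI; apply: measurable_funPT => //; exact: measurable_itv.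
  have sub : [set w | u i w == u j w] `<=`
      [set w | ~~ (0 <= u i w < 1)] `|` \big[setU/set0]_(k < m.+1) E k.
    move=> w /= /eqP uij; have [/andP[u0 u1]|] := boolP (0 <= u i w < 1); [right|by left].
    have [||k ck] := @exists_cell _ m.+1 c (u i w).
    - by rewrite /c mul0r.
    - by rewrite /c mulfV// pnatr_eq0.
    by rewrite (bigD1 k)//=; left; split; rewrite /B/= in_itv/= -?uij.
  apply: (@le_trans _ _ (P ([set w | ~~ (0 <= u i w < 1)] `|` \big[setU/set0]_(k < m.+1) E k))).
    by apply: le_measure => //; rewrite inE//; apply: measurableU => //; exact: bigsetU_measurable.
  apply: (le_trans (measureU2 _ _ _)) => //; first exact: bigsetU_measurable.
  rewrite [X in (X + _)%E](_ : _ = 0%E) ?add0e; last exact: probability_outside.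
  apply: (le_trans (@Boole_inequality _ _ _ P (fun k => E k) m.+1 _)) => //.
  rewrite (eq_bigr (fun=> ((m.+1%:R^-1) ^+ 2)%:E)); last by move=> k _; exact: PE.
  rewrite sumEFin lee_fin sumr_const card_ord -[_ *+ m.+1]mulr_natl expr2 mulrA mulfV ?mul1r//.
apply/eqP; rewrite eq_le measure_ge0 andbT.
have Pf : P [set w | u i w == u j w] \is a fin_num by exact: fin_num_measure.
rewrite -(fineK Pf) lee_fin leNgt; apply/negP => p0.
have := bnd (Num.truncn (fine (P [set w | u i w == u j w]))^-1).
rewrite -(fineK Pf) lee_fin leNgt => /negP; apply.
by rewrite -[ltRHS]invrK ltf_pV2 ?posrE ?invr_gt0// truncnS_gt.
Qed.

End uniform_ties.

(** * Subordinator and sample on separate copies of the space *)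

Section occupancy_coupling.
Context {R : realType} {d : measure_display} {T : measurableType d}.
Variables (P : probability T R) (S : R -> {RV P >-> R}).
Hypothesis subS : is_subordinator S.
Context {n : nat}.
Variable u : 'I_n -> {RV P >-> R}.
Hypothesis iid : iid_uniform u.
Local Notation PP := (P \x P)%E.
Local Notation C := (closed_range (fun t w => S t w)).
Local Notation x z := (fun i : 'I_n => u i z.2).

(* The first coordinate of [z] carries the subordinator, the second the sample. *)
Definition parts (z : T * T) : R := (number_of_parts (C z.1) (x z))%:R.

(** Counts the sample points in no gap: those on the closed range, and those outside [0, 1], where a
    uniform variable may still fall with probability 0. *)
Definition unboxed (z : T * T) : R :=
  #|[set i : 'I_n | ~~ `[< same_gap (C z.1) (u i z.2) (u i z.2) >]]%SET|%:R.

Let swap (z : T * T) : T * T := (z.2, z.1).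

Let mu_ i : measurable_fun setT (u i : T -> R).
Proof. exact: measurable_funPT. Qed.

Let mu2 i : measurable_fun setT (fun z : T * T => u i z.2).
Proof. by apply: (measurableT_comp (mu_ i)); exact: measurable_snd. Qed.

Let mS1 t : measurable_fun setT (fun z : T * T => squashed S t z.1).
Proof. by apply: (measurableT_comp (measurable_squashed S t)); exact: measurable_fst. Qed.

Let mswap : measurable_fun setT swap.
Proof. by apply: measurable_fun_pair; [exact: measurable_snd|exact: measurable_fst]. Qed.

Let mCO O : open O -> measurable [set w | C w `&` O !=set0].
Proof. exact: measurable_closed_range_meet. Qed.

Lemma measurable_parts : measurable_fun setT parts.
Proof.
have m := measurable_number_of_parts mu_ (@closed_closed_range _ _ _ P S) mCO.
exact: (measurableT_comp m mswap).
Qed.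

Lemma parts_le z : 0 <= parts z <= n%:R.
Proof. by rewrite ler0n ler_nat number_of_parts_le. Qed.

Lemma measurable_unboxed_set i : measurable [set z : T * T | ~~ `[< same_gap (C z.1) (u i z.2) (u i z.2) >]].
Proof.
have m := measurable_same_gap mu_ (@closed_closed_range _ _ _ P S) mCO i i.
have -> : [set z : T * T | ~~ `[< same_gap (C z.1) (u i z.2) (u i z.2) >]] =
    swap @^-1` (~` [set z : T * T | same_gap (C z.2) (u i z.1) (u i z.1)]).
  by apply/seteqP; split=> z /= => [/asboolPn|h] //; exact/asboolPn.
by rewrite -[X in measurable X]setTI; apply: mswap => //; exact: measurableC.
Qed.

Lemma measurable_beyond_set t i : measurable [set z : T * T | squashed S t z.1 <= u i z.2].
Proof. by apply: measurable_bool; exact: measurable_fun_ler. Qed.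

Definition beyond (t : R) (z : T * T) : R :=
  #|[set i : 'I_n | (squashed S t z.1 <= u i z.2)%R]%SET|%:R.

Definition grid (h : R) (w : T) (k : nat) : R := squashed S (k%:R * h) w.

Lemma le_grid h w k l : 0 <= h -> (k <= l)%N -> grid h w k <= grid h w l.
Proof.
move=> h0 kl; apply: (le_squashed subS); first exact: mulr_ge0.
by rewrite ler_wpM2r// ler_nat.
Qed.

Lemma grid0 h w : grid h w 0 = 0.
Proof. by rewrite /grid mul0r (squashed0 subS). Qed.

Lemma grid_end m w N : grid m.+1%:R^-1 w (N * m.+1) = squashed S N%:R w.
Proof. by rewrite /grid natrM mulfK// pnatr_eq0. Qed.

Definition occupied (h : R) (M : nat) (z : T * T) : R :=
  #|occupied_cells (M := M) (x z) (grid h z.1)|%:R.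

Let m_cell h (k : nat) : measurable [set z : T * T | [exists i : 'I_n, in_cell (grid h z.1) k (u i z.2)]].
Proof.
apply: measurable_exists => i; apply: measurable_bool; apply: measurable_and.
- exact: (measurable_fun_ler (mS1 _) (mu2 i)).
- exact: (measurable_fun_ltr (mu2 i) (mS1 _)).
Qed.

Lemma measurable_occupied h M : measurable_fun setT (occupied h M).
Proof. by apply: measurable_card_set => k; exact: m_cell. Qed.

Lemma occupied_le h M z : 0 <= occupied h M z <= M%:R.
Proof. by rewrite ler0n ler_nat -[leqRHS]card_ord max_card. Qed.

Lemma occupied_le_parts h M z : 0 <= h -> occupied h M z <= parts z + unboxed z.
Proof.
move=> h0; rewrite -natrD ler_nat; apply: card_occupied_cells_le => [k l kl|k].
  exact: le_grid.
by apply: closed_range_squashed; exact: mulr_ge0.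
Qed.

(** The threshold on m depends on z, so this inequality is integrated later through a vanishing
    excess. *)
Lemma parts_le_occupied N z : \forall m \near \oo,
  parts z <= occupied m.+1%:R^-1 (N * m.+1) z + beyond N%:R z.
Proof.
near=> m; rewrite -natrD ler_nat.
have h0 : 0 <= m.+1%:R^-1 :> R by [].
have := @number_of_parts_le_cells R n (N * m.+1) (C z.1) (x z) (grid m.+1%:R^-1 z.1).
rewrite grid_end.
apply; last exact: grid0.
  by move=> k l; exact: le_grid.
by near: m; exact: grid_separates.
Unshelve. all: by end_near. Qed.

Definition on_range (N : nat) (z : T * T) : R :=
  #|[set i : 'I_n | [&& ~~ `[< same_gap (C z.1) (u i z.2) (u i z.2) >], (0 <= u i z.2)%R,
      (u i z.2 < squashed S N%:R z.1)%R & (u i z.2 <= 1)%R]]%SET|%:R.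

Lemma on_range_le_occupied N z : injective (x z) -> \forall m \near \oo,
  on_range N z <= 2 * occupied m.+1%:R^-1 (N * m.+1) z.
Proof.
move=> inj; near=> m; rewrite -natrM ler_nat.
have h0 : 0 <= m.+1%:R^-1 :> R by [].
have := @card_points_in_le_cells R n (N * m.+1) (C z.1) (x z) (grid m.+1%:R^-1 z.1).
rewrite grid_end.
apply => //; last exact: grid0.
  by move=> k l; exact: le_grid.
by near: m; exact: grid_separates.
Unshelve. all: by end_near. Qed.

Lemma measurable_on_range_set N i : measurable [set z : T * T |
  [&& ~~ `[< same_gap (C z.1) (u i z.2) (u i z.2) >], (0 <= u i z.2)%R,
      (u i z.2 < squashed S N%:R z.1)%R & (u i z.2 <= 1)%R]].
Proof.
have -> : [set z : T * T |
  [&& ~~ `[< same_gap (C z.1) (u i z.2) (u i z.2) >], (0 <= u i z.2)%R,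
      (u i z.2 < squashed S N%:R z.1)%R & (u i z.2 <= 1)%R]] =
  [set z : T * T | ~~ `[< same_gap (C z.1) (u i z.2) (u i z.2) >]] `&`
  [set z : T * T | [&& 0 <= u i z.2, u i z.2 < squashed S N%:R z.1 & u i z.2 <= 1]].
  by apply/seteqP; split=> z /=; [by move=> /andP[h1 h2]|by move=> [h1 h2]; apply/andP].
apply: measurableI; first exact: measurable_unboxed_set.
apply: measurable_bool; apply: measurable_and.
  exact: measurable_fun_ler.
by apply: measurable_and; [exact: measurable_fun_ltr|exact: measurable_fun_ler].
Qed.

Lemma L1_on_range N : L1 PP (on_range N).
Proof. by apply: L1_card_set => i; exact: measurable_on_range_set. Qed.

Lemma L1_unboxed : L1 PP unboxed.
Proof. by apply: L1_card_set => i; exact: measurable_unboxed_set. Qed.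

Lemma L1_beyond t : L1 PP (beyond t).
Proof. by apply: L1_card_set => i; exact: measurable_beyond_set. Qed.

Lemma L1_parts : L1 PP parts.
Proof.
apply: (@L1_bounded _ _ _ _ _ n%:R) => [|z]; first exact: measurable_parts.
by have /andP[? ?] := parts_le z; rewrite ger0_norm.
Qed.

Lemma L1_occupied h M : L1 PP (occupied h M).
Proof.
apply: (@L1_bounded _ _ _ _ _ M%:R) => [|z]; first exact: measurable_occupied.
by have /andP[? ?] := occupied_le h M z; rewrite ger0_norm.
Qed.

End occupancy_coupling.

Section marginals.
Context {d : measure_display} {T : measurableType d} {R : realType}.
Variable P : probability T R.
Local Notation PP := (P \x P)%E.

Lemma int_fst (f : T -> R) (M : R) : measurable_fun setT f -> (forall w, `|f w| <= M) ->
  \int[PP]_z f z.1 = \int[P]_w f w.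
Proof.
move=> mf fM; have [||_ ->] := @int_prod _ _ T T R P P (fun z => f z.1).
- apply: (@L1_bounded _ _ _ _ _ M) => //.
  by apply: (measurableT_comp mf); exact: measurable_fst.
- by move=> w; exact: (L1_cst P (f w)).
- by apply: eq_Rintegral => w _; exact: (int_cst P (f w)).
Qed.

Lemma int_snd (f : T -> R) (M : R) : measurable_fun setT f -> (forall w, `|f w| <= M) ->
  \int[PP]_z f z.2 = \int[P]_w f w.
Proof.
move=> mf fM; have [||_ ->] := @int_prod _ _ T T R P P (fun z => f z.2).
- apply: (@L1_bounded _ _ _ _ _ M) => //.
  by apply: (measurableT_comp mf); exact: measurable_snd.
- by move=> w; apply: (@L1_bounded _ _ _ _ _ M).
- exact: (int_cst P (\int[P]_w f w)).
Qed.

Lemma probability_prod (A : set (T * T)) : measurable A ->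
  L1 P (fun w => fine (P [set w' | A (w, w')])) /\
  fine (PP A) = \int[P]_w fine (P [set w' | A (w, w')]).
Proof.
move=> mA.
have mAw w : measurable [set w' | A (w, w')].
  rewrite -[X in measurable X]setTI.
  exact: (@measurable_pair1 _ _ T T w measurableT _ mA).
have E w : \int[P]_w' (\1_A (w, w') : R) = fine (P [set w' | A (w, w')]).
  by rewrite -int_indic.
rewrite -int_indic//; have [||L ->] := @int_prod _ _ T T R P P (\1_A).
- apply: (@L1_bounded _ _ _ _ _ 1) => [|z]; first exact: measurable_indic.
  by rewrite indicE; case: (_ \in _); rewrite ?normr1 ?normr0.
- move=> w; apply: (@L1_bounded _ _ _ _ _ 1).
    exact: (@measurable_indic _ _ R setT [set w' | A (w, w')]).
  by move=> w'; rewrite indicE; case: (_ \in _); rewrite ?normr1 ?normr0.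
- split; last by apply: eq_Rintegral => w _.
  by move: L; congr L1; apply/funext => w.
Qed.

End marginals.

(** * From the number of parts to the occupied cells *)

Section parts_approximation.
Context {R : realType} {d : measure_display} {T : measurableType d}.
Variables (P : probability T R) (S : R -> {RV P >-> R}) (nu : {measure set R -> \bar R}).
Hypothesis subS : is_subordinator S.
Hypothesis driftS : driftfree_with_levy_measure S nu.
Local Notation phi := (laplace_exponent nu).
Local Notation PP := (P \x P)%E.
Local Notation C := (closed_range (fun t w => S t w)).

(* The expected length of the closed range below [squashed N]; it vanishes for
   want of drift, which is shown below by counting sample points. *)
Definition range_length (N : nat) : R :=
  \int[P]_w unif (C w `&` `[0, squashed S N%:R w[%classic).

Section fixed_sample_size.
Context {n : nat}.
Variable u : 'I_n -> {RV P >-> R}.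
Hypothesis iid : iid_uniform u.

Let mu_ i : measurable_fun setT (u i : T -> R).
Proof. exact: measurable_funPT. Qed.

Let Levy : is_levy_measure nu := driftS.1.

Let L1_exp t : 0 <= t -> L1 P (fun w => expR (- (1 * S t w))).
Proof.
move=> t0; apply: (@L1_bounded _ _ _ P _ 1) => [|w].
  apply: (measurableT_comp (@measurable_expR R)); apply: measurable_funN.
  by apply: measurable_funM.
by rewrite ger0_norm ?expR_ge0// -expR0 ler_expR oppr_le0 mulr_ge0// (subordinator_ge0 subS).
Qed.

(** Given S, a point is beyond time t with probability exp (- S t), whose mean is exp (- t phi
    1). *)
Lemma int_beyond_le t : 0 <= t ->
  \int[PP]_z beyond S u t z <= n%:R * expR (- (t * phi 1)).
Proof.
move=> t0; rewrite int_card_set; last exact: measurable_beyond_set.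
rewrite mulr_natl -[n in leRHS]card_ord -sumr_const; apply: ler_sum => i _.
have [L ->] := probability_prod P (measurable_beyond_set S u t i).
rewrite -(laplace_subordinator driftS t0 ler01).
apply: le_int => //; first exact: L1_exp.
move=> w /=; set c := squashed S t w.
have c0 : 0 <= c by rewrite -(squashed0 subS w); exact: le_squashed.
have c1 : c <= 1 by exact/ltW/squashed_lt1.
have mB (B : set R) : measurable B -> measurable (u i @^-1` B).
  by move=> mB; rewrite -[X in measurable X]setTI; exact: measurable_funPT.
pose B0 : set R := `[0, c[%classic.
have sub : [set w' | c <= u i w'] `<=` u i @^-1` (~` B0).
  by move=> w' /= h; rewrite /B0/= in_itv/= => /andP[_]; rewrite ltNge h.
have : (P [set w' | (c <= u i w')%R] <= P (u i @^-1` (~` B0)))%E.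
  apply: le_measure => //; rewrite inE.
    by apply: measurable_bool; exact: measurable_fun_ler.
  by apply: mB; apply: measurableC; exact: measurable_itv.
have mB0 : measurable (u i @^-1` B0) by apply: mB; exact: measurable_itv.
rewrite preimage_setC (probability_setC _ mB0).
rewrite (unifE iid); last exact: measurable_itv.
rewrite /B0 unif_itv// subr0 => h; rewrite -lee_fin fineK ?fin_num_measure//; last first.
  by apply: measurable_bool; exact: measurable_fun_ler.
by apply: (le_trans h); rewrite -EFinB lee_fin mul1r /c /squashed; lra.
Qed.

Lemma int_occupied h M : 0 <= h ->
  \int[PP]_z occupied S u h M z = \int[P]_w \sum_(k < M) cell_hit S h n k w.
Proof.
move=> h0; have [||_ ->] := @int_prod _ _ T T R P P (occupied S u h M).
- exact: L1_occupied.
- move=> w; apply: (@L1_bounded _ _ _ P _ M%:R) => [|w'].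
    exact: (measurableT_comp (measurable_occupied S u h M) (measurable_pair1 w)).
  by have /andP[? ?] := occupied_le S u h M (w, w'); rewrite ger0_norm.
- apply: eq_Rintegral => w _; rewrite /occupied /= (occupied_cells_mean iid)//.
  + by move=> k l; exact: le_grid.
  + by rewrite (grid0 subS).
  + by move=> k; exact/ltW/squashed_lt1.
Qed.

Lemma int_occupied_le h M : 0 <= h ->
  \int[PP]_z occupied S u h M z <= M%:R * (h * phi n%:R).
Proof.
move=> h0; rewrite int_occupied// int_sum; last first.
  by move=> k; exact: (L1_cell_hit subS).
rewrite mulr_natl -[M in leRHS]card_ord -sumr_const; apply: ler_sum => k _.
exact: (int_cell_hit_le subS driftS).
Qed.

Lemma int_on_range N : \int[PP]_z on_range S u N z = n%:R * range_length N.
Proof.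
rewrite int_card_set; last exact: measurable_on_range_set.
rewrite mulr_natl -[n in RHS]card_ord -sumr_const; apply: eq_bigr => i _.
have [_ ->] := probability_prod P (measurable_on_range_set subS u N i).
apply: eq_Rintegral => w _ /=.
have mB : measurable (C w `&` `[0, squashed S N%:R w[%classic).
  apply: measurableI; last exact: measurable_itv.
  by apply: closed_measurable; exact: closed_closed_range.
have := unifE iid i mB; move=> /(congr1 fine)/= <-; congr (fine (P _)).
apply/seteqP; split=> w' /=.
  move=> /and4P[/asboolPn h u0 us u1]; split; last by rewrite in_itv/= u0.
  by apply: contrapT => nC; apply: h; apply: same_gap_refl; split=> //=; rewrite in_itv/= u0.
move=> [Cu]; rewrite in_itv/= => /andP[u0 us]; apply/and4P; split=> //.
  by apply/asboolPn => /same_gap_memr[_]; apply.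
by rewrite (le_trans (ltW us))// ltW// squashed_lt1.
Qed.

Definition ties (w : T) : R :=
  #|[set ij : 'I_n * 'I_n | (ij.1 != ij.2) && (u ij.1 w == u ij.2 w)]%SET|%:R.

Definition outside (w : T) : R := #|[set i : 'I_n | ~~ (0 <= u i w < 1)%R]%SET|%:R.

Let m_ties (ij : 'I_n * 'I_n) :
  measurable [set w | (ij.1 != ij.2) && (u ij.1 w == u ij.2 w)].
Proof.
apply: measurable_bool; apply: measurable_and; first exact: measurable_cst.
exact: (measurable_fun_eqr (mu_ ij.1) (mu_ ij.2)).
Qed.

Let m_outside (i : 'I_n) : measurable [set w | ~~ (0 <= u i w < 1)].
Proof.
apply: measurable_bool; apply: measurable_neg; apply: measurable_and.
- by apply: measurable_fun_ler.
- by apply: measurable_fun_ltr.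
Qed.

Lemma int_ties : \int[PP]_z ties z.2 = 0.
Proof.
rewrite (@int_snd _ _ _ P ties #|{: 'I_n * 'I_n}|%:R); last 2 first.
- exact: measurable_card_set.
- by move=> w; rewrite ger0_norm// ler_nat max_card.
rewrite int_card_set// big1// => -[i j] _ /=.
have [->|ij] := eqVneq i j.
  by rewrite (_ : [set w | false && _] = set0) ?measure0//; apply/seteqP; split.
by rewrite (_ : [set w | true && _] = [set w | u i w == u j w]) ?(probability_tie iid ij).
Qed.

Lemma int_outside : \int[PP]_z outside z.2 = 0.
Proof.
rewrite (@int_snd _ _ _ P outside n%:R); last 2 first.
- exact: measurable_card_set.
- by move=> w; rewrite ger0_norm// ler_nat -[leqRHS]card_ord max_card.
rewrite int_card_set// big1// => i _.
by rewrite [P _](probability_outside iid).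
Qed.

Lemma L1_ties : L1 PP (fun z => ties z.2).
Proof.
apply: (@L1_bounded _ _ _ _ _ #|{: 'I_n * 'I_n}|%:R) => [|z].
  by apply: (@measurableT_comp _ _ _ _ _ _ ties _ snd); [exact: measurable_card_set|exact: measurable_snd].
by rewrite ger0_norm// ler_nat max_card.
Qed.

Lemma L1_outside : L1 PP (fun z => outside z.2).
Proof.
apply: (@L1_bounded _ _ _ _ _ n%:R) => [|z].
  by apply: (@measurableT_comp _ _ _ _ _ _ outside _ snd); [exact: measurable_card_set|exact: measurable_snd].
by rewrite ger0_norm// ler_nat -[leqRHS]card_ord max_card.
Qed.

Lemma ties_ge1 w : ~ injective (u^~ w) -> 1 <= ties w.
Proof.
move=> ninj; rewrite ler1n card_gt0; apply/set0Pn; apply: contrapT => no.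
apply: ninj => i j uij; apply/eqP; apply: contrapT => /negP ij.
by apply: no; exists (i, j); rewrite inE/= ij uij eqxx.
Qed.

Lemma unboxed_le N z : unboxed S u z <= outside z.2 + beyond S u N%:R z + on_range S u N z.
Proof.
rewrite -!natrD ler_nat.
set A := [set i : 'I_n | ~~ (0 <= u i z.2 < 1)%R]%SET.
set B := [set i : 'I_n | (squashed S N%:R z.1 <= u i z.2)%R]%SET.
set D := [set i : 'I_n | _]%SET.
have sub : D \subset (A :|: B :|: [set i : 'I_n | [&& ~~ `[< same_gap (C z.1) (u i z.2) (u i z.2) >],
      (0 <= u i z.2)%R, (u i z.2 < squashed S N%:R z.1)%R & (u i z.2 <= 1)%R]])%SET.
  apply/fintype.subsetP => i; rewrite !inE => ->/=.
  have [/andP[u0 u1]|//] := boolP (0 <= u i z.2 < 1).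
  by rewrite u0 (ltW u1) !andbT/= ltNge orbN.
apply: (leq_trans (subset_leq_card sub)).
apply: (leq_trans (leq_card_setU _ _)); rewrite leq_add2r; exact: leq_card_setU.
Qed.

Let mesh (m : nat) : R := m.+1%:R^-1.

Let mesh0 m : 0 <= mesh m. Proof. by rewrite /mesh. Qed.

Let mesh_cells N m x : (N * m.+1)%:R * (mesh m * x) = N%:R * x.
Proof. by rewrite natrM /mesh mulrA mulfK// pnatr_eq0. Qed.

(** Turns an inequality that holds eventually at each point into one for integrals: the positive
    excess is bounded and eventually 0 at each point. *)
Let cvg_excess (a b : T * T -> R) (o : nat -> T * T -> R) (M : R) :
    measurable_fun setT a -> measurable_fun setT b ->
    (forall m, measurable_fun setT (o m)) ->
    (forall z, a z <= M) -> (forall z, 0 <= b z) -> (forall m z, 0 <= o m z) -> 0 <= M ->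
    (forall z, \forall m \near \oo, a z <= o m z + b z) ->
  (forall m, L1 PP (fun z => Num.max 0 (a z - o m z - b z))) /\
  \int[PP]_z Num.max 0 (a z - o m z - b z) @[m --> \oo] --> 0.
Proof.
move=> ma mb mo aM b0 o0 M0 ev.
have mg m : measurable_fun setT (fun z => Num.max 0 (a z - o m z - b z)).
  apply: measurable_maxr; first exact: measurable_cst.
  by apply: measurable_funB => //; exact: measurable_funB.
have gM m z : `|Num.max 0 (a z - o m z - b z)| <= M.
  rewrite ger0_norm ?le_max ?lexx// ge_max M0/=.
  by have := aM z; have := b0 z; have := o0 m z; lra.
split=> [m|]; first by apply: (@L1_bounded _ _ _ _ _ M).
have g0 z : Num.max 0 (a z - o m z - b z) @[m --> \oo] --> (0 : R).
  apply: cvg_near_cst; near=> m; apply/max_l.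
  have : a z <= o m z + b z by near: m.
  lra.
have LM : L1 PP (fun=> M) by apply: (@L1_bounded _ _ _ _ _ `|M|).
have [_] := cvg_int_dominated mg g0 LM gM.
by rewrite int0.
Unshelve. all: by end_near. Qed.

(** Without ties a fine cell holds at most two sample points of the range, and the mean number of
    occupied cells is at most N phi n for every mesh. *)
Lemma range_length_le N : n%:R * range_length N <= 2 * (N%:R * phi n%:R).
Proof.
pose o m z := 2 * occupied S u (mesh m) (N * m.+1) z.
have occ0 m z : 0 <= occupied S u (mesh m) (N * m.+1) z.
  by have /andP[] := occupied_le S u (mesh m) (N * m.+1) z.
have on_le z : on_range S u N z <= n%:R by rewrite ler_nat -[leqRHS]card_ord max_card.
have ev z : \forall m \near \oo, on_range S u N z <= o m z + n%:R * ties z.2.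
  have [inj|ninj] := pselect (injective (u^~ z.2)).
    near=> m; have : on_range S u N z <= o m z by near: m; exact: on_range_le_occupied.
    by move=> /le_trans; apply; rewrite lerDl mulr_ge0.
  near=> m; have := occ0 m z; have := on_le z.
  by have := ler_wpM2l (ler0n R n) (ties_ge1 ninj); rewrite /o; lra.
have Lt : L1 PP (fun z => n%:R * ties z.2) by apply: L1Z; exact: L1_ties.
have Lo m : L1 PP (o m) by apply: L1Z; exact: L1_occupied.
have Lon := L1_on_range subS u N.
have [|||Lg cg] := @cvg_excess _ _ o _ (L1_measurable Lon) (L1_measurable Lt)
  (fun m => L1_measurable (Lo m)) on_le _ _ _ ev.
- by move=> z; rewrite mulr_ge0.
- by move=> m z; rewrite mulr_ge0.
- by [].
rewrite -subr_le0; apply: (cvgr_to_ge cg); apply: nearW => m.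
rewrite lerBlDr -int_on_range.
apply: (@le_trans _ _ (\int[PP]_z (Num.max 0 (on_range S u N z - o m z - n%:R * ties z.2)
   + (o m z + n%:R * ties z.2)))).
  apply: le_int => //; first by apply: L1D => //; exact: L1D.
  by move=> z; rewrite -lerBlDr opprD addrA le_max lexx orbT.
rewrite intD//; last exact: L1D.
rewrite intD// (intZ _ L1_ties) (intZ _ (L1_occupied _ _ _ _)).
rewrite int_ties mulr0 addr0 lerD2l ler_pM2l// -(mesh_cells N m).
exact: int_occupied_le.
Unshelve. all: by end_near. Qed.

Lemma int_parts_occupied N : exists2 e : nat -> R, e m @[m --> \oo] --> 0 &
  forall m, \int[PP]_z `|parts S u z - occupied S u (mesh m) (N * m.+1) z| <=
    2 * (n%:R * expR (- (N%:R * phi 1))) + n%:R * range_length N + e m.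
Proof.
pose o m z := occupied S u (mesh m) (N * m.+1) z.
have Lo m : L1 PP (o m) by exact: L1_occupied.
have Lp := L1_parts subS u; have Lb := L1_beyond S u N%:R.
have Lu := L1_unboxed subS u; have Lon := L1_on_range subS u N.
have [||||Lg cg] := @cvg_excess _ _ o n%:R (L1_measurable Lp) (L1_measurable Lb)
  (fun m => L1_measurable (Lo m)) _ _ _ _ (parts_le_occupied subS u N).
- by move=> z; have /andP[] := parts_le S u z.
- by move=> z; rewrite ler0n.
- by move=> m z; have /andP[] := occupied_le S u (mesh m) (N * m.+1) z.
- by [].
exists (fun m => \int[PP]_z Num.max 0 (parts S u z - o m z - beyond S u N%:R z)) => // m.
have Lob := L1D (L1D L1_outside Lb) Lon.
(* The two one-sided comparisons are added, so [beyond] is counted twice: directly, and inside the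
   bound for [unboxed]. *)
apply: (@le_trans _ _ (\int[PP]_z ((2 * beyond S u N%:R z + (outside z.2 + on_range S u N z))
  + Num.max 0 (parts S u z - o m z - beyond S u N%:R z)))).
  apply: le_int; first exact: (L1_norm (L1B Lp (Lo m))).
    by apply: L1D => //; apply: L1D; [exact: L1Z|exact: (L1D L1_outside Lon)].
  move=> z; have le1 := occupied_le_parts subS u (N * m.+1) z (mesh0 m).
  have le2 := unboxed_le N z.
  have b0 : 0 <= beyond S u N%:R z by [].
  have o0 : 0 <= outside z.2 by [].
  have r0 : 0 <= on_range S u N z by [].
  have g1 : 0 <= Num.max 0 (parts S u z - o m z - beyond S u N%:R z) by rewrite le_max lexx.
  have g2 : parts S u z - o m z - beyond S u N%:R z <=
    Num.max 0 (parts S u z - o m z - beyond S u N%:R z) by rewrite le_max lexx orbT.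
  move: le1 g2 g1; rewrite -/(o m z); move: (o m z) (Num.max _ _) => x y.
  by move=> le1 g2 g1; rewrite ler_norml; apply/andP; split; lra.
rewrite intD//; last by apply: L1D; [exact: L1Z|exact: (L1D L1_outside Lon)].
rewrite intD; [|exact: L1Z|exact: (L1D L1_outside Lon)].
rewrite intZ// intD//; last exact: L1_outside.
rewrite int_outside add0r int_on_range !lerD2r ler_pM2l//.
exact: int_beyond_le.
Qed.

End fixed_sample_size.
End parts_approximation.

Section parts_deviation.
Context {R : realType} {d : measure_display} {T : measurableType d}.
Variables (P : probability T R) (S : R -> {RV P >-> R}) (nu : {measure set R -> \bar R}).
Hypothesis subS : is_subordinator S.
Hypothesis driftS : driftfree_with_levy_measure S nu.
Local Notation phi := (laplace_exponent nu).
Local Notation PP := (P \x P)%E.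
Context {n : nat}.
Variable u : 'I_n -> {RV P >-> R}.
Hypothesis iid : iid_uniform u.
Hypothesis n0 : (0 < n)%N.

Definition positive_sum (N : nat) (w : T) : R :=
  \sum_(j < N) Num.max 0 (ln n%:R - S j%:R w).

Let ln0 : 0 <= ln n%:R :> R. Proof. by rewrite ln_ge0// ler1n. Qed.

Let hits h M w := \sum_(k < M) cell_hit S h n k w.
Let means h M w := \sum_(k < M) cell_mean S nu h n k w.

Let hits_bound h M w : 0 <= h -> 0 <= hits h M w <= M%:R.
Proof.
move=> h0; rewrite sumr_ge0/=; last by move=> k _; have /andP[] := cell_hit01 subS n h0 k w.
rewrite -[leRHS]mulr1 mulr_natl -[M in leRHS]card_ord -sumr_const; apply: ler_sum => k _.
by have /andP[] := cell_hit01 subS n h0 k w.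
Qed.

Let means_bound h M w : 0 <= h -> 0 <= means h M w <= M%:R.
Proof.
move=> h0; rewrite sumr_ge0/=; last by move=> k _; have /andP[] := cell_mean01 nu subS n h0 k w.
rewrite -[leRHS]mulr1 mulr_natl -[M in leRHS]card_ord -sumr_const; apply: ler_sum => k _.
by have /andP[] := cell_mean01 nu subS n h0 k w.
Qed.

Let m_hits h M : 0 <= h -> measurable_fun setT (hits h M).
Proof. by move=> h0; apply: measurable_sum => k; exact: (L1_measurable (L1_cell_hit subS n h0 k)). Qed.

Let m_means h M : 0 <= h -> measurable_fun setT (means h M).
Proof. by move=> h0; apply: measurable_sum => k; exact: (L1_measurable (L1_cell_mean nu subS n h0 k)). Qed.

Let m_fst (f : T -> R) : measurable_fun setT f -> measurable_fun setT (fun z : T * T => f z.1).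
Proof. by move=> mf; apply: (measurableT_comp mf); exact: measurable_fst. Qed.

Let int_occupied_hits h M r : 0 <= h -> 0 < r ->
  \int[PP]_z `|occupied S u h M z - hits h M z.1| <= M%:R * (h * phi n%:R) / (2 * r) + r / 2.
Proof.
move=> h0 r0; pose D z := occupied S u h M z - hits h M z.1.
have mD : measurable_fun setT D.
  by apply: measurable_funB; [exact: measurable_occupied|apply: m_fst; exact: m_hits].
have DM z : `|D z ^+ 2| <= M%:R ^+ 2.
  rewrite normrX lerXn2r ?nnegrE// /D.
  have /andP[? ?] := occupied_le S u h M z; have /andP[? ?] := hits_bound M z.1 h0.
  by rewrite ler_norml; apply/andP; split; lra.
have LD2 : L1 PP (fun z => D z ^+ 2).
  by apply: (@L1_bounded _ _ _ _ _ (M%:R ^+ 2)) => //; exact: measurable_funX.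
apply: (le_trans (int_norm_le_sqr r0 LD2 mD)); rewrite lerD2r ler_pM2r ?invr_gt0 ?mulr_gt0//.
have g0 w : 0 <= grid S h w 0 by rewrite (grid0 subS).
have dev w := occupied_cells_deviation iid M
  (fun k l => @le_grid _ _ _ P S subS h w k l h0) (g0 w) (fun k => ltW (squashed_lt1 S (k%:R * h) w)).
have dev' w : L1 P (fun w' => D (w, w') ^+ 2) /\
    \int[P]_w' (D (w, w') ^+ 2) <= hits h M w.
  exact: dev.
have [|L ->] := @int_prod _ _ T T R P P _ LD2; first by move=> w; exact: (dev' w).1.
apply: (@le_trans _ _ (\int[P]_w hits h M w)).
  apply: le_int => //; first by apply: L1_sum => k; exact: (L1_cell_hit subS).
  by move=> w; exact: (dev' w).2.
by rewrite -(int_occupied subS iid)//; exact: (int_occupied_le subS driftS iid).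
Qed.

Let int_hits_means h M r : 0 <= h -> 0 < r ->
  \int[PP]_z `|hits h M z.1 - means h M z.1| <= M%:R * (h * phi n%:R) / (2 * r) + r / 2.
Proof.
move=> h0 r0; pose D w := hits h M w - means h M w.
have mD : measurable_fun setT D.
  by apply: measurable_funB; [exact: m_hits|exact: m_means].
have [LD2 D2] := cell_hit_compensation subS driftS n h0 M.
rewrite (@int_fst _ _ _ P (fun w => `|D w|) M%:R).
- apply: (le_trans (int_norm_le_sqr r0 LD2 mD)).
  by rewrite lerD2r ler_pM2r ?invr_gt0 ?mulr_gt0.
- exact: measurableT_comp.
- move=> w; rewrite normr_id /D.
  have /andP[? ?] := hits_bound M w h0; have /andP[? ?] := means_bound M w h0.
  by rewrite ler_norml; apply/andP; split; lra.
Qed.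

Variable C1 : R.
Hypothesis C1P : forall h s, 0 <= h -> h * phi n%:R ^+ 2 <= 1 -> 0 <= s ->
  `|binE (expR (- s)) n (fun j => 1 - expR (- (h * phi j%:R)))
     - h * Num.max 0 (ln n%:R - s)| <= C1 * h.

Let means_positive_sum N m w : m.+1%:R^-1 * phi n%:R ^+ 2 <= 1 ->
  `|means m.+1%:R^-1 (N * m.+1) w - positive_sum N w| <= N%:R * C1 + ln n%:R.
Proof.
move=> hphi; set h := m.+1%:R^-1 in hphi *.
have h0 : 0 <= h by rewrite /h.
have hm : h * m.+1%:R = 1 by rewrite mulVf// pnatr_eq0.
pose psi t := Num.max 0 (ln n%:R - S t w).
have -> : means h (N * m.+1) w - positive_sum N w =
  (means h (N * m.+1) w - \sum_(k < N * m.+1) h * psi (k%:R * h)) +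
  (\sum_(k < N * m.+1) h * psi (k%:R * h) - \sum_(j < N) psi j%:R).
  by rewrite addrA subrK.
apply: (le_trans (ler_normD _ _)); apply: lerD; last first.
  apply: ler_sum_blocks => // [s t s0 st|t t0].
    by rewrite /psi ge_max !le_max lexx/= lerD2l lerN2 (sub_nondecreasing subS) ?orbT.
  rewrite /psi le_max lexx/= ge_max ln0/= gerBl; exact: (subordinator_ge0 subS).
rewrite -sumrB; apply: (le_trans (ler_norm_sum _ _ _)).
apply: (@le_trans _ _ (\sum_(k < N * m.+1) C1 * h)).
  by apply: ler_sum => k _; apply: C1P => //; apply: (subordinator_ge0 subS); exact: mulr_ge0.
rewrite sumr_const card_ord -[_ *+ (N * m.+1)]mulr_natl natrM.
by rewrite (mulrC C1) mulrA -(mulrA N%:R) (mulrC m.+1%:R) hm mulr1.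
Qed.

Lemma L1_parts_deviation N : L1 PP (fun z => parts S u z - positive_sum N z.1).
Proof.
apply: L1B; first exact: L1_parts.
apply: (@L1_bounded _ _ _ _ _ (N%:R * ln n%:R)) => [|z].
  apply: m_fst; apply: measurable_sum => j; apply: measurable_maxr; first exact: measurable_cst.
  by apply: measurable_funB => //; exact: measurable_funPT.
have le0 j : 0 <= Num.max 0 (ln n%:R - S j%:R z.1) by rewrite le_max lexx.
rewrite ger0_norm ?sumr_ge0// mulr_natl -[N in leRHS]card_ord -sumr_const.
apply: ler_sum => j _; rewrite ge_max ln0/= gerBl; exact: (subordinator_ge0 subS).
Qed.

(** The bounds depend on the mesh only through mesh times number of cells, which is N, and through
    an error that vanishes with the mesh. The two variance estimates share [r], each giving N phi n
    / (2 r) + r / 2. *)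
Lemma parts_deviation N r : 0 < r ->
  \int[PP]_z `|parts S u z - positive_sum N z.1| <=
    N%:R * phi n%:R / r + r + (N%:R * C1 + ln n%:R) +
    (2 * (n%:R * expR (- (N%:R * phi 1))) + n%:R * range_length S N).
Proof.
move=> r0; have [e e0 He] := int_parts_occupied subS driftS iid N.
rewrite -subr_le0; apply: (cvgr_to_ge e0).
near=> m.
(* The mesh must be at most phi n ^ (- 2) for the linearization in [C1P] to be available. *)
have hphi : m.+1%:R^-1 * phi n%:R ^+ 2 <= 1.
  rewrite ler_pdivrMl// mulr1; apply/ltW/(lt_trans (truncnS_gt _)); rewrite ltr_nat ltnS.
  by near: m; exists (Num.truncn (phi n%:R ^+ 2)).+1.
have h0 : 0 <= m.+1%:R^-1 :> R by [].
set h := m.+1%:R^-1 in hphi h0; pose M := (N * m.+1)%N.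
have Mh x : M%:R * (h * x) = N%:R * x.
  by rewrite natrM /h mulrA mulfK// pnatr_eq0.
have := He m; rewrite -/h -/M => Hem.
have Ho := int_occupied_hits M h0 r0; have Hm := int_hits_means M h0 r0.
rewrite Mh in Ho Hm.
have Lb (f : T -> R) : measurable_fun setT f -> (forall w, 0 <= f w <= M%:R) -> L1 PP (fun z : T * T => f z.1).
  move=> mf fM; apply: (@L1_bounded _ _ _ _ _ M%:R) => [|z]; first exact: m_fst.
  by have /andP[? ?] := fM z.1; rewrite ger0_norm.
have Lh : L1 PP (fun z => hits h M z.1) by apply: Lb; [exact: m_hits|move=> w; exact: hits_bound].
have Lm : L1 PP (fun z => means h M z.1) by apply: Lb; [exact: m_means|move=> w; exact: means_bound].
have Lo : L1 PP (occupied S u h M) by exact: L1_occupied.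
have L1' := L1_norm (L1B (L1_parts subS u) Lo).
have L2' := L1_norm (L1B Lo Lh); have L3' := L1_norm (L1B Lh Lm).
pose c := N%:R * C1 + ln n%:R.
have Lc : L1 PP (fun=> c) by apply: (@L1_bounded _ _ _ _ _ `|c|).
have : \int[PP]_z `|parts S u z - positive_sum N z.1| <=
  \int[PP]_z (`|parts S u z - occupied S u h M z| + (`|occupied S u h M z - hits h M z.1| +
     (`|hits h M z.1 - means h M z.1| + c))).
  apply: le_int; first exact: (L1_norm (L1_parts_deviation N)).
    by do 3! apply: L1D => //.
  move=> z; have H := means_positive_sum N z.1 hphi; rewrite -/h -/M -/c in H.
  apply: le_trans (lerD (lexx _) (lerD (lexx _) (lerD (lexx _) H))).
  have -> : parts S u z - positive_sum N z.1 = (parts S u z - occupied S u h M z) +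
    ((occupied S u h M z - hits h M z.1) + ((hits h M z.1 - means h M z.1) +
     (means h M z.1 - positive_sum N z.1))) by ring.
  do 2! (apply: (le_trans (ler_normD _ _)); apply: lerD => //).
  exact: ler_normD.
rewrite intD//; last by do 2! apply: L1D => //.
rewrite intD//; last by apply: L1D.
rewrite intD// [X in _ + (_ + (_ + X))](_ : _ = c); last exact: int_cst.
move: Hem Ho Hm; rewrite -/c invfM !mulrA.
set I1 := \int[PP]_z _; set I2 := \int[PP]_z _; set I3 := \int[PP]_z _.
move: (n%:R * range_length S N) (N%:R * phi n%:R) (expR _) => x y v.
lra.
Unshelve. all: by end_near. Qed.

End parts_deviation.

(** * Linearization at the crossing time *)

Section parts_deviation_order.
Context {R : realType} {d : measure_display} {T : measurableType d}.
Variables (P : probability T R) (S : R -> {RV P >-> R}) (nu : {measure set R -> \bar R}).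
Hypothesis subS : is_subordinator S.
Hypothesis driftS : driftfree_with_levy_measure S nu.
Hypothesis cL : condition_L nu.
Local Notation phi := (laplace_exponent nu).
Local Notation PP := (P \x P)%E.
Variable u : forall n : nat, 'I_n -> {RV P >-> R}.
Arguments u : clear implicits.
Hypothesis iid : forall n, iid_uniform (u n).

Let Levy : is_levy_measure nu := driftS.1.

Lemma laplace_exponent_nat_le (C : R) n : `|phi n%:R - ln n.+1%:R| <= C ->
  phi n%:R <= C + ln n.+1%:R.
Proof. by rewrite ler_norml => /andP[_]; rewrite lerBlDr. Qed.

(** A positive length b would give n b <= 2 N phi n for all n, although phi n grows like ln n. *)
Lemma range_length_eq0 N : range_length S N = 0.
Proof.
have [C C0 CP] := laplace_exponent_log Levy cL.
have b0 : 0 <= range_length S N by apply: int_ge0 => w; exact: unif_ge0.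
apply/eqP; rewrite eq_le b0 andbT leNgt; apply/negP => bpos.
have N0 : 0 < N%:R :> R.
  rewrite ltr0n lt0n; apply/eqP => N0.
  have := range_length_le subS driftS (iid 1) N.
  by rewrite N0 mul0r mulr0 mul1r leNgt -N0 bpos.
set b := range_length S N in b0 bpos *.
(* The slope of a tangent bound for ln, chosen so that N a n = n b / 4; doubled, this takes up only
   half of n b. *)
pose a := b / (4 * N%:R); have a0 : 0 < a by rewrite divr_gt0// mulr_gt0.
have Na : N%:R * a = b / 4 by rewrite /a; field; rewrite gt_eqF.
have bnd n : n%:R * b <= 2 * (N%:R * (C + a - 1 - ln a) + n%:R * b / 4).
  apply: (le_trans (range_length_le subS driftS (iid n) N)).
  rewrite ler_pM2l// (_ : n%:R * b / 4 = N%:R * (a * n%:R)); last by rewrite mulrA Na; ring.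
  rewrite -mulrDr ler_pM2l//.
  have := laplace_exponent_nat_le (CP n).
  have : ln n.+1%:R <= a * n.+1%:R - 1 - ln a.
    have an0 : 0 < a * n.+1%:R by rewrite mulr_gt0.
    have := ln_le_sub1 an0; rewrite lnM ?posrE//; lra.
  by rewrite -natr1; move: (phi _) (ln _) (ln _) => x y z; lra.
set c := N%:R * _ in bnd.
have := bnd (Num.truncn (4 * `|c| / b)).+1.
have := truncnS_gt (4 * `|c| / b); set n := (Num.truncn _).+1.
rewrite ltr_pdivrMr// => H1 H2; have := ler_norm c.
by move: (n%:R * b) H1 H2 => x H1 H2 H3; lra.
Qed.

(** Late enough that n exp (- N phi 1), which bounds the mean number of points beyond this time N,
    is at most 1, yet of order ln n. *)
Definition horizon (n : nat) : nat := (Num.truncn (ln n%:R / phi 1 : R)).+1.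

Let phi1_gt0 : 0 < phi 1. Proof. exact: laplace_exponent1_gt0. Qed.

Lemma horizon_le : exists2 A : R, 0 <= A &
  forall n, 1 <= ln n%:R :> R -> (horizon n)%:R <= A * ln n%:R.
Proof.
exists ((phi 1)^-1 + 1) => [|n L1]; first by rewrite addr_ge0// invr_ge0 ltW.
rewrite /horizon -natr1 mulrDl mul1r lerD// (mulrC _^-1) truncn_le//.
by rewrite divr_ge0// ltW// (lt_le_trans _ L1).
Qed.

Lemma horizon_ge n : ln n%:R <= (horizon n)%:R * phi 1.
Proof. by rewrite -ler_pdivrMr//; apply/ltW/truncnS_gt. Qed.

Lemma parts_deviation_le : exists2 A : R, 0 <= A &
  forall n, 1 <= ln n%:R :> R ->
    \int[PP]_z `|parts S (u n) z - positive_sum S (n := n) (horizon n) z.1| <= A * ln n%:R.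
Proof.
have [C C0 CP] := laplace_exponent_log Levy cL.
have [C1 C10 C1P] := cell_mean_approx Levy cL.
have [A A0 HA] := horizon_le.
exists (A * (C + 2) + 1 + (A * C1 + 1) + 2) => [|n L1].
  by rewrite !addr_ge0// mulr_ge0// addr_ge0.
set L := ln n%:R in L1 *; have L0 : 0 < L by rewrite (lt_le_trans _ L1).
have n0 : (0 < n)%N.
  by rewrite lt0n; apply/eqP => n0; move: L1; rewrite /L n0 ln0// ler10.
have nR : 1 <= n%:R :> R by rewrite ler1n.
(* With r = ln n the terms N phi n / r and r are both of order ln n. *)
apply: (le_trans (parts_deviation subS driftS (iid n) n0 (fun h s => C1P n h s n0) (horizon n) L0)).
rewrite range_length_eq0 mulr0 addr0 -/L.
have pn : phi n%:R <= (C + 2) * L.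
  apply: (le_trans (laplace_exponent_nat_le (CP n))).
  have : ln n.+1%:R <= L + 1.
    have n1 : 0 < n.+1%:R / n%:R :> R by rewrite divr_gt0// ltr0n.
    have := ln_le_sub1 n1; rewrite ln_div ?posrE ?ltr0n// -/L => H.
    have : n.+1%:R / n%:R <= 2 :> R by rewrite ler_pdivrMr ?ltr0n// -natr1; lra.
    lra.
  by have := ler_wpM2l C0 L1; lra.
have hN := HA n L1; rewrite -/L in hN.
have e1 : n%:R * expR (- ((horizon n)%:R * phi 1)) <= 1.
  rewrite -[X in X * _](@lnK R) ?posrE ?ltr0n// -expRD -[leRHS]expR0 ler_expR subr_le0.
  exact: horizon_ge.
have T1 : (horizon n)%:R * phi n%:R / L <= A * (C + 2) * L.
  rewrite ler_pdivrMr// (_ : A * (C + 2) * L * L = (A * L) * ((C + 2) * L)); last by ring.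
  by apply: ler_pM => //; exact: laplace_exponent_ge0.
have T2 : (horizon n)%:R * C1 <= A * C1 * L.
  by rewrite -mulrA (mulrC C1) mulrA ler_wpM2r.
move: T1 T2 e1; move: (_ * _ / L) (_ * C1) (n%:R * _) => x y z T1 T2 e1.
nra.
Qed.

End parts_deviation_order.

Lemma L1_fst {d : measure_display} {T : measurableType d} {R : realType}
    (P : probability T R) (f : T -> R) : L1 P f ->
  L1 (P \x P)%E (fun z => f z.1) /\ \int[(P \x P)%E]_z f z.1 = \int[P]_w f w.
Proof.
move=> Lf; have mf := L1_measurable Lf.
have mfst : measurable_fun setT (fun z : T * T => f z.1).
  by apply: (measurableT_comp mf); exact: measurable_fst.
have LPP : L1 (P \x P)%E (fun z => f z.1).
  apply/integrableP; split; first exact/measurable_EFinP.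
  rewrite (@fubini_tonelli1 _ _ T T R P P (fun z => `|(f z.1)%:E|%E))//; last first.
    by apply: measurableT_comp => //; exact/measurable_EFinP.
  have E w : (\int[P]_(y in setT) `|(f w)%:E| = `|(f w)%:E|)%E.
    exact: (etrans (int_EFin (L1_cst P `|f w|)) (congr1 EFin (int_cst P `|f w|))).
  rewrite (eq_integral (fun w => `|(f w)%:E|%E)); last by move=> w _; exact: E.
  by move/integrableP : Lf => [].
split=> //; have [||_ ->] := @int_prod _ _ T T R P P (fun z => f z.1) => //.
  by move=> w; exact: (L1_cst P (f w)).
by apply: eq_Rintegral => w _; exact: (int_cst P (f w)).
Qed.

Lemma sum_interval_indicator_le {R : realType} (a b : R) N : a <= b ->
  \sum_(j < N) (a < j%:R < b)%R%:R <= b - a + 2.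
Proof.
move=> ab; pose k := Num.truncn (Num.max 0 a); pose K := (Num.truncn (b - a + 1)).+1.
have kle : k%:R <= Num.max 0 a by rewrite truncn_le// le_max lexx.
have kgt : Num.max 0 a < k%:R + 1 by rewrite natr1 truncnS_gt.
have Kgt : b - a + 1 < K%:R by exact: truncnS_gt.
have Kle : K%:R <= b - a + 2.
  have : (Num.truncn (b - a + 1))%:R <= b - a + 1 by rewrite truncn_le//; lra.
  by rewrite /K -natr1; lra.
apply: le_trans Kle; apply: (@le_trans _ _ (\sum_(j < N) (k <= j < k + K)%N%:R)).
  apply: ler_sum => j _; have [/andP[aj jb]|//] := boolP (_ < _ < _).
  rewrite (_ : (k <= j < k + K)%N = true)//; apply/andP; split.
    by rewrite -(ler_nat R) (le_trans kle)// ge_max ler0n ltW.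
  rewrite -(ltr_nat R) natrD; have : a <= Num.max 0 a by rewrite le_max lexx orbT.
  by move: (Num.max 0 a) kgt => y; lra.
rewrite -natr_sum ler_nat.
suff -> : (\sum_(j < N) (k <= j < k + K) = minn N (k + K) - k)%N.
  by rewrite leq_subLR geq_minr.
elim: N => [|N IH]; first by rewrite big_ord0 min0n sub0n.
rewrite big_ord_recr/= IH; case: (leqP k N) => kN; case: (ltnP N (k + K)) => NK /=.
- by rewrite !(minn_idPl _) ?(ltnW NK)// addn1 subSn.
- by rewrite !(minn_idPr _) ?(leqW NK)// addn0.
- rewrite addn0; have -> : (N - k = 0)%N by apply/eqP; rewrite subn_eq0 ltnW.
  by apply/esym/eqP; rewrite subn_eq0 (leq_trans (geq_minl _ _)).
- by have := leq_trans (leq_addr K k) NK; rewrite leqNgt kN.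
Qed.

Section linearization.
Context {R : realType} {d : measure_display} {T : measurableType d}.
Variables (P : probability T R) (S : R -> {RV P >-> R}) (nu : {measure set R -> \bar R}).
Hypothesis subS : is_subordinator S.
Hypothesis driftS : driftfree_with_levy_measure S nu.
Hypothesis cL : condition_L nu.
Hypothesis cR : condition_R nu.
Local Notation phi := (laplace_exponent nu).
Local Notation m1 := (moment nu 1).
Local Notation m2 := (moment nu 2).

Let Levy : is_levy_measure nu := driftS.1.
Let m1_gt0 : 0 < m1. Proof. exact: moment1_gt0. Qed.
Let m2_gt0 : 0 < m2. Proof. exact: moment2_gt0. Qed.

Definition centered (j : nat) (w : T) : R := S j%:R w - m1 * j%:R.

Lemma mean_subordinator t : 0 <= t -> L1 P (S t) /\ \int[P]_w S t w = t * m1.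
Proof.
move=> t0; apply: (int_mean_of_laplace Levy cR) => //.
- by move=> w; exact: (subordinator_ge0 subS).
- by move=> s s0; exact: (laplace_subordinator driftS).
Qed.

Lemma sqr_subordinator t : 0 <= t ->
  L1 P (fun w => S t w ^+ 2) /\ \int[P]_w S t w ^+ 2 = t * m2 + (t * m1) ^+ 2.
Proof.
move=> t0; apply: (int_sqr_of_laplace Levy cR) => //.
- by move=> w; exact: (subordinator_ge0 subS).
- by move=> s s0; exact: (laplace_subordinator driftS).
Qed.

Lemma variance_centered j :
  L1 P (fun w => centered j w ^+ 2) /\ \int[P]_w centered j w ^+ 2 = j%:R * m2.
Proof.
have [L1S ES] := mean_subordinator (ler0n R j); have [L2S E2] := sqr_subordinator (ler0n R j).
have -> : (fun w => centered j w ^+ 2) =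
  (fun w => S j%:R w ^+ 2 - (2 * (m1 * j%:R)) * S j%:R w + (m1 * j%:R) ^+ 2).
  by apply/funext => w; rewrite /centered; ring.
have Lc := L1_cst P ((m1 * j%:R) ^+ 2); have LZ := L1Z (2 * (m1 * j%:R)) L1S.
split; first by apply: L1D => //; exact: L1B.
rewrite intD//; last exact: L1B.
by rewrite intB// intZ// int_cst E2 ES; ring.
Qed.

Lemma measurable_centered j : measurable_fun setT (centered j).
Proof. by apply: measurable_funB => //; exact: measurable_funPT. Qed.

Lemma L1_centered j : L1 P (centered j).
Proof. by apply: L1_sqr; [exact: measurable_centered|exact: (variance_centered j).1]. Qed.

Lemma int_norm_centered_le j s : 0 < s ->
  \int[P]_w `|centered j w| <= j%:R * m2 / (2 * s) + s / 2.
Proof.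
move=> s0; have [L2 E2] := variance_centered j.
by have := int_norm_le_sqr s0 L2 (measurable_centered j); rewrite E2.
Qed.

(** The first integer time at which the mean of the subordinator exceeds ln n. *)
Definition crossing (n : nat) : nat := (Num.truncn (ln n%:R / m1 : R)).+1.

Lemma crossingP n j : (0 < n)%N -> (j < crossing n)%N = (m1 * j%:R <= ln n%:R).
Proof.
move=> n0; rewrite ltnS truncn_ge_nat; first by rewrite ler_pdivlMr// mulrC.
by rewrite divr_ge0 ?ln_ge0 ?ler1n// ltW.
Qed.

(** The signs of b - x and b disagree only if |x| >= |b|, and the error is then at most |x| - |b|.
    For |b| >= r this is at most |x| - r <= x^2 / (4 r); within the window it is bounded by |x|. *)
Lemma positive_part_error (b x r : R) (below : bool) : below = (0 <= b) -> 0 < r ->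
  `|Num.max 0 (b - x) - below%:R * (b - x)| <=
    x ^+ 2 / (4 * r) + (- r < b < r)%R%:R * `|x|.
Proof.
move=> -> r0; have x2 : 0 <= x ^+ 2 / (4 * r) by rewrite divr_ge0 ?sqr_ge0// mulr_ge0// ltW.
have AM y : 0 <= y -> r <= y -> `|x| - y <= x ^+ 2 / (4 * r).
  move=> y0 ry; rewrite ler_pdivlMr ?mulr_gt0// -(real_normK (num_real x)).
  have := normr_ge0 x; move: (`|x|) => v v0; have := sqr_ge0 (v - 2 * y).
  have [vy|yv] := leP v y; first by have := mulr_ge0 (ltW r0) (_ : 0 <= y - v); nra.
  by have := mulr_ge0 (_ : 0 <= y - r) (_ : 0 <= v - y); nra.
have le1 : `|Num.max 0 (b - x) - (0 <= b)%R%:R * (b - x)| <= Num.max 0 (`|x| - `|b|).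
  rewrite le_max; have [b0|b0] := leP 0 b.
    rewrite mul1r (ger0_norm b0); have [bx|bx] := leP 0 (b - x); first by rewrite subrr normr0 lexx.
    rewrite sub0r normrN ltr0_norm// orbC; apply/orP; left.
    by have := ler_norm x; lra.
  rewrite mul0r subr0 (ltr0_norm b0); have [bx|bx] := leP 0 (b - x).
    by rewrite ger0_norm// orbC; have := ler_norm (- x); rewrite normrN => h; apply/orP; left; lra.
  by rewrite normr0 lexx.
apply: (le_trans le1); rewrite ge_max; apply/andP; split.
  by rewrite addr_ge0// mulr_ge0.
have [/andP[h1 h2]|nb] := boolP (- r < b < r).
  by rewrite mul1r; have := normr_ge0 b; lra.
rewrite mul0r addr0; apply: AM => //.
move: nb; rewrite negb_and -!leNgt => /orP[h|h].
- by rewrite ler_normr; apply/orP; right; lra.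
- by rewrite ler_normr h.
Qed.

(** The preceding bound is summed with b = ln n - m_1 j. The quadratic term involves N variances of
    order at most N, and at most 2 r / m_1 + 2 integers lie in the window. *)
Lemma positive_sum_linearization n N r s : (0 < n)%N -> 0 < r -> 0 < s ->
    (crossing n <= N)%N ->
  \int[P]_w `|positive_sum S (n := n) N w - \sum_(j < crossing n) (ln n%:R - S j%:R w)| <=
    N%:R ^+ 2 * m2 / (4 * r) + (2 * r / m1 + 2) * (N%:R * m2 / (2 * s) + s / 2).
Proof.
move=> n0 r0 s0 JN; set L := ln n%:R.
pose D (j : 'I_N) w : R := centered j w ^+ 2 / (4 * r) +
  (- r < L - m1 * j%:R < r)%R%:R * `|centered j w|.
have pw w : `|positive_sum S (n := n) N w - \sum_(j < crossing n) (L - S j%:R w)| <= \sum_j D j w.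
  rewrite (big_ord_widen _ (fun j => L - S j%:R w) JN) big_mkcond/= -sumrB.
  apply: (le_trans (ler_norm_sum _ _ _)); apply: ler_sum => j _.
  have -> : L - S j%:R w = (L - m1 * j%:R) - centered j w by rewrite /centered; ring.
  have := @positive_part_error (L - m1 * j%:R) (centered j w) r (j < crossing n)%N.
  rewrite crossingP// subr_ge0 -/L => /(_ erefl r0).
  by case: (m1 * j%:R <= L); rewrite ?mul1r ?mul0r.
have L2 j := (variance_centered j).1; have E2 j := (variance_centered j).2.
have Ln j := L1_norm (L1_centered j).
have LD j : L1 P (D j).
  apply: L1D; last exact: L1Z.
  have -> : (fun w => centered j w ^+ 2 / (4 * r)) = (fun w => (4 * r)^-1 * centered j w ^+ 2).
    by apply/funext => w; rewrite mulrC.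
  exact: L1Z.
apply: (@le_trans _ _ (\int[P]_w \sum_j D j w)).
  apply: le_int => //; last exact: L1_sum.
  apply: L1_norm; apply: L1B; last first.
    by apply: L1_sum => j; apply: L1B; [exact: L1_cst|exact: (mean_subordinator _).1].
  apply: L1_sum => j; apply: (@L1_bounded _ _ _ P _ L) => [|w].
    apply: measurable_maxr; first exact: measurable_cst.
    by apply: measurable_funB => //; exact: measurable_funPT.
  have ln0 : 0 <= L by rewrite ln_ge0// ler1n.
  rewrite ger0_norm ?le_max ?lexx// ge_max ln0 gerBl; exact: (subordinator_ge0 subS).
rewrite int_sum//.
have ED (j : 'I_N) : \int[P]_w D j w <= N%:R * m2 / (4 * r) +
    (- r < L - m1 * j%:R < r)%R%:R * (N%:R * m2 / (2 * s) + s / 2).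
  have jN : j%:R <= N%:R :> R by rewrite ler_nat ltnW.
  rewrite intD; last exact: L1Z.
    rewrite [X in _ + X]intZ//; apply: lerD.
      have -> : (fun w => centered j w ^+ 2 / (4 * r)) = (fun w => (4 * r)^-1 * centered j w ^+ 2).
        by apply/funext => w; rewrite mulrC.
      rewrite intZ// E2 mulrC ler_pM2r ?invr_gt0 ?mulr_gt0//.
      by rewrite ler_pM2r.
    apply: ler_wpM2l => //; apply: (le_trans (int_norm_centered_le j s0)).
    by rewrite lerD2r ler_pM2r ?invr_gt0 ?mulr_gt0// ler_pM2r.
  have -> : (fun w => centered j w ^+ 2 / (4 * r)) = (fun w => (4 * r)^-1 * centered j w ^+ 2).
    by apply/funext => w; rewrite mulrC.
  exact: L1Z.
apply: (@le_trans _ _ (\sum_(j < N) (N%:R * m2 / (4 * r) +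
    (- r < L - m1 * j%:R < r)%R%:R * (N%:R * m2 / (2 * s) + s / 2)))); first exact: ler_sum.
rewrite big_split/= sumr_const card_ord -[_ *+ N]mulr_natl -mulr_suml; apply: lerD.
  by rewrite !mulrA expr2.
have c0 : 0 <= N%:R * m2 / (2 * s) + s / 2.
  by apply: addr_ge0; [apply: divr_ge0; [exact: (mulr_ge0 _ (ltW m2_gt0))|exact/ltW/mulr_gt0]|
    exact/divr_ge0/ler0n/ltW].
apply: ler_wpM2r => //.
have ab : (L - r) / m1 <= (L + r) / m1 by rewrite ler_pM2r ?invr_gt0//; lra.
have := sum_interval_indicator_le N ab.
rewrite (_ : (L + r) / m1 - (L - r) / m1 = 2 * r / m1); last by rewrite -mulrBl; congr (_ / _); ring.
apply: le_trans; apply: ler_sum => j _.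
have [/andP[h1 h2]|//] := boolP (- r < L - m1 * j%:R < r).
rewrite (_ : (_ < _ < _) = true)// ltr_pdivrMr// ltr_pdivlMr// (mulrC j%:R).
by apply/andP; split; lra.
Qed.

Lemma sum_drift n : 1 <= ln n%:R :> R ->
  `|\sum_(j < crossing n) (ln n%:R - m1 * j%:R) - ln n%:R ^+ 2 / (2 * m1)| <= (1 + m1) * ln n%:R.
Proof.
move=> L1; set L := ln n%:R in L1 *; have L0 : 0 <= L by rewrite (le_trans _ L1).
have sumE J : \sum_(j < J) (L - m1 * j%:R) = J%:R * L - m1 * J%:R * (J%:R - 1) / 2.
  elim: J => [|J IH]; first by rewrite big_ord0 !(mul0r, mulr0) subr0.
  by rewrite big_ord_recr/= IH -natr1; field.
(* The rounding of ln n / m_1; being positive and at most 1, it changes the sum only by order ln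
   n. *)
rewrite sumE; pose th := (crossing n)%:R - L / m1.
have th1 : 0 < th by rewrite subr_gt0; exact: truncnS_gt.
have th2 : th <= 1.
  by rewrite lerBlDl /crossing -natr1 lerD2r truncn_le divr_ge0// ltW.
have -> : (crossing n)%:R = th + L / m1 by rewrite /th subrK.
have -> : (th + L / m1) * L - m1 * (th + L / m1) * (th + L / m1 - 1) / 2 - L ^+ 2 / (2 * m1) =
  (m1 * th + L - m1 * th ^+ 2) / 2 by field; rewrite gt_eqF.
have a1 : m1 * th <= m1 by rewrite ler_piMr// ltW.
have a2 : 0 <= m1 * th ^+ 2 by rewrite mulr_ge0 ?sqr_ge0// ltW.
have a3 : m1 * th ^+ 2 <= m1 * th by rewrite ler_pM2l// expr2 ler_piMr// ltW.
have a4 : m1 <= m1 * L by rewrite ler_peMr// ltW.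
by rewrite (mulrDl 1) mul1r ler_norml; apply/andP; split; lra.
Qed.

Lemma crossing_le n : 1 <= ln n%:R :> R ->
  (crossing n)%:R <= (m1^-1 + 1) * ln n%:R.
Proof.
move=> L1; rewrite /crossing -natr1 mulrDl mul1r lerD// (mulrC _^-1) truncn_le//.
by rewrite divr_ge0// ltW// (lt_le_trans _ L1).
Qed.

Lemma crossing_le_horizon n : (0 < n)%N -> (crossing n <= horizon nu n)%N.
Proof.
move=> n0; rewrite ltnS; apply: le_truncn.
have L0 : 0 <= ln n%:R :> R by rewrite ln_ge0// ler1n.
rewrite ler_wpM2l// lef_pV2 ?posrE//; first exact: laplace_exponent1_le_moment1.
exact: laplace_exponent1_gt0.
Qed.

(* The fourth root of [ln n], the unit in which the error terms are integral powers. *)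
Definition root4 (n : nat) : R := Num.sqrt (Num.sqrt (ln n%:R)).

Lemma root4E n : 0 <= ln n%:R :> R -> ln n%:R = root4 n ^+ 4.
Proof.
move=> L0; rewrite (exprM _ 2 2) /root4 sqr_sqrtr ?sqrtr_ge0//.
by rewrite sqr_sqrtr.
Qed.

Lemma root4_ge1 n : 1 <= ln n%:R :> R -> 1 <= root4 n.
Proof. by move=> L1; rewrite -[leLHS]sqrtr1 ler_wsqrtr// -[leLHS]sqrtr1 ler_wsqrtr. Qed.

(** About q^4 terms, each of mean absolute value of order q^2 by the choice s = q^2. Ignoring
    cancellations still gives the order q^6 = log^(3/2) n, which is what tightness needs. *)
Lemma int_norm_sum_centered : exists2 A : R, 0 <= A & forall n, 1 <= ln n%:R :> R ->
  \int[P]_w `|\sum_(j < crossing n) centered j w| <= A * root4 n ^+ 6.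
Proof.
pose B := m1^-1 + 1; have B0 : 0 <= B by rewrite addr_ge0// invr_ge0 ltW.
have m20 := ltW m2_gt0.
exists (B * (B * m2 / 2 + 1 / 2)) => [|n L1].
  by rewrite mulr_ge0// addr_ge0// divr_ge0// mulr_ge0.
set q := root4 n; have q1 : 1 <= q := root4_ge1 L1.
have q0 : 0 < q by rewrite (lt_le_trans _ q1).
have JB : (crossing n)%:R <= B * q ^+ 4.
  by rewrite -root4E ?crossing_le// (le_trans _ L1).
apply: (@le_trans _ _ (\int[P]_w \sum_(j < crossing n) `|centered j w|)).
  apply: le_int.
  - by apply: L1_norm; apply: L1_sum => j; exact: L1_centered.
  - by apply: L1_sum => j; apply: L1_norm; exact: L1_centered.
  - by move=> w; exact: ler_norm_sum.
rewrite int_sum; last by move=> j; apply: L1_norm; exact: L1_centered.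
apply: (@le_trans _ _ (\sum_(j < crossing n) (B * m2 / 2 + 1 / 2) * q ^+ 2)).
  apply: ler_sum => j _; have q20 : 0 < q ^+ 2 by rewrite exprn_gt0.
  apply: (le_trans (int_norm_centered_le j q20)); rewrite (mulrDl (B * m2 / 2)).
  apply: lerD; last by rewrite mul1r mulrC.
  rewrite ler_pdivrMr ?mulr_gt0//.
  rewrite (_ : B * m2 / 2 * q ^+ 2 * (2 * q ^+ 2) = B * q ^+ 4 * m2); last by field.
  by apply: ler_wpM2r => //; apply: le_trans JB; rewrite ler_nat ltnW.
rewrite sumr_const card_ord -[_ *+ (crossing n)]mulr_natl.
rewrite (_ : B * _ * q ^+ 6 = B * q ^+ 4 * ((B * m2 / 2 + 1 / 2) * q ^+ 2)); last by ring.
apply: ler_wpM2r => //; rewrite mulr_ge0 ?sqr_ge0// addr_ge0// divr_ge0// mulr_ge0//.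
Qed.

Variable u : forall n : nat, 'I_n -> {RV P >-> R}.
Arguments u : clear implicits.
Hypothesis iid : forall n, iid_uniform (u n).
Local Notation PP := (P \x P)%E.

Lemma parts_linearization : exists2 A : R, 0 <= A & forall n, 1 <= ln n%:R :> R ->
  L1 PP (fun z => parts S (u n) z - ln n%:R ^+ 2 / (2 * m1) +
    \sum_(j < crossing n) centered j z.1) /\
  \int[PP]_z `|parts S (u n) z - ln n%:R ^+ 2 / (2 * m1) +
    \sum_(j < crossing n) centered j z.1| <= A * root4 n ^+ 5.
Proof.
have [A1 A10 H1] := parts_deviation_le subS driftS cL iid.
have [B B0 HB] := horizon_le driftS cL.
have m20 := ltW m2_gt0; have m10 := ltW m1_gt0.
pose c1 := B ^+ 2 * m2 / 4; pose c2 := (2 / m1 + 2) * (B * m2 / 2 + 1 / 2).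
have c10 : 0 <= c1 by rewrite divr_ge0// mulr_ge0// sqr_ge0.
have c20 : 0 <= c2.
  apply: mulr_ge0; first by rewrite addr_ge0// divr_ge0.
  by rewrite addr_ge0// divr_ge0// mulr_ge0.
exists (A1 + (c1 + c2) + (1 + m1)) => [|n lnge]; first by rewrite !addr_ge0.
have L0 : 0 <= ln n%:R :> R by rewrite (le_trans _ lnge).
have n0 : (0 < n)%N.
  by rewrite lt0n; apply/eqP => n0; move: lnge; rewrite n0 ln0// ler10.
set q := root4 n; have q1 : 1 <= q := root4_ge1 lnge.
have q0 : 0 < q by rewrite (lt_le_trans _ q1).
have Lq : ln n%:R = q ^+ 4 by exact: root4E.
have L5 : ln n%:R <= q ^+ 5 by rewrite Lq ler_weXn2l.
set J := crossing n; set N := horizon nu n.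
have JN : (J <= N)%N by exact: crossing_le_horizon.
pose f z := parts S (u n) z - positive_sum S (n := n) N z.1.
pose g w := positive_sum S (n := n) N w - \sum_(j < J) (ln n%:R - S j%:R w).
pose e := \sum_(j < J) (ln n%:R - m1 * j%:R) - ln n%:R ^+ 2 / (2 * m1).
have E z : parts S (u n) z - ln n%:R ^+ 2 / (2 * m1) + \sum_(j < J) centered j z.1 =
    f z + (g z.1 + e).
  have -> : \sum_(j < J) centered j z.1 =
      \sum_(j < J) (ln n%:R - m1 * j%:R) - \sum_(j < J) (ln n%:R - S j%:R z.1).
    by rewrite -sumrB; apply: eq_bigr => j _; rewrite /centered; ring.
  by rewrite /f /g /e; ring.
have Lf : L1 PP f by exact: (L1_parts_deviation subS).
have Lg : L1 P g.
  apply: L1B; last by apply: L1_sum => j; apply: L1B; [exact: L1_cst|exact: (mean_subordinator _).1].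
  apply: L1_sum => j; apply: (@L1_bounded _ _ _ P _ (ln n%:R)) => [|w].
    apply: measurable_maxr; first exact: measurable_cst.
    by apply: measurable_funB => //; exact: measurable_funPT.
  rewrite ger0_norm ?le_max ?lexx// ge_max L0 gerBl; exact: (subordinator_ge0 subS).
have [LgP _] := L1_fst Lg; have [LnP En] := L1_fst (L1_norm Lg).
have Le c : L1 PP (fun=> c : R) by apply: (@L1_bounded _ _ _ _ _ `|c|).
have -> : (fun z => parts S (u n) z - ln n%:R ^+ 2 / (2 * m1) + \sum_(j < J) centered j z.1) =
  (fun z => f z + (g z.1 + e)) by apply/funext => z; exact: E.
have LL : L1 PP (fun z => f z + (g z.1 + e)) by apply: L1D => //; exact: L1D.
split=> //; under eq_Rintegral do rewrite E.
apply: (@le_trans _ _ (\int[PP]_z (`|f z| + (`|g z.1| + `|e|)))).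
  apply: le_int; first exact: L1_norm.
    by apply: L1D; [exact: L1_norm|exact: L1D].
  by move=> z; apply: (le_trans (ler_normD _ _)); rewrite lerD2l; exact: ler_normD.
rewrite intD; [|exact: L1_norm|exact: L1D].
rewrite intD//; rewrite En [X in _ + (_ + X)](_ : _ = `|e|); last exact: int_cst.
have He : `|e| <= (1 + m1) * q ^+ 5.
  by apply: (le_trans (sum_drift lnge)); rewrite ler_wpM2l// addr_ge0.
have Hf : \int[PP]_z `|f z| <= A1 * q ^+ 5.
  by apply: (le_trans (H1 n lnge)); rewrite ler_wpM2l.
have Hg : \int[P]_w `|g w| <= (c1 + c2) * q ^+ 5.
  have q30 : 0 < q ^+ 3 by rewrite exprn_gt0.
  have q20 : 0 < q ^+ 2 by rewrite exprn_gt0.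
  (* With r = q^3 and s = q^2 the quadratic term costs q^8 / q^3 and the window q^3 q^2, both of
     order q^5. *)
  apply: (le_trans (positive_sum_linearization n0 q30 q20 JN)); rewrite (mulrDl c1).
  have HN : N%:R <= B * q ^+ 4 by rewrite -Lq; exact: HB.
  apply: lerD.
    rewrite ler_pdivrMr ?mulr_gt0//.
    rewrite (_ : c1 * q ^+ 5 * (4 * q ^+ 3) = (B * q ^+ 4) ^+ 2 * m2); last by rewrite /c1; field.
    by apply: ler_wpM2r => //; rewrite !expr2; apply: ler_pM.
  rewrite (_ : c2 * q ^+ 5 = ((2 / m1 + 2) * q ^+ 3) * ((B * m2 / 2 + 1 / 2) * q ^+ 2)); last by rewrite /c2; ring.
  apply: ler_pM.
  - by apply: addr_ge0 => //; apply: divr_ge0 => //; apply: mulr_ge0 => //; exact: ltW.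
  - apply: addr_ge0; apply: divr_ge0 => //; [exact: mulr_ge0|exact/ltW/mulr_gt0|exact: ltW].
  - rewrite (mulrDl (2 / m1)) lerD//; first by rewrite mulrAC.
    by rewrite ler_peMr// exprn_ege1.
  rewrite (mulrDl (B * m2 / 2)); apply: lerD; last by rewrite mul1r mulrC.
  rewrite ler_pdivrMr ?mulr_gt0//.
  rewrite (_ : B * m2 / 2 * q ^+ 2 * (2 * q ^+ 2) = B * q ^+ 4 * m2); last by field.
  exact: ler_wpM2r.
rewrite (mulrDl (A1 + _)) (mulrDl A1) -addrA.
by apply: lerD => //; exact: lerD.
Qed.

End linearization.

(** * The limit law *)

Lemma norm_cosB_le {R : realType} (x y : R) : `|cos x - cos y| <= `|x - y|.
Proof.
have D (z : R) : is_derive z (1 : R) (fun z : R => cos (z + y)) (- sin (z + y)).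
  have D1 : is_derive z (1 : R) (fun z : R => z + y) (1 : R).
    have := is_deriveD (is_derive_id z (1:R)) (is_derive_cst y z (1:R)).
    by rewrite addr0.
  have := @is_derive1_comp R cos (fun z => z + y) z _ _ (is_derive_cos (z + y)) D1.
  by rewrite mulr1.
have := @le_norm_mean_value R (fun z => cos (z + y)) (fun z => - sin (z + y)) (x - y) 1 D.
by rewrite subrK add0r mul1r; apply => z _; rewrite normrN; exact: sin_max.
Qed.

Section coupling_of_parts.
Context {R : realType} {d : measure_display} {T : measurableType d}.
Variables (P : probability T R) (S : R -> {RV P >-> R}).
Hypothesis subS : is_subordinator S.
Context {n : nat}.
Variable u : 'I_n -> {RV P >-> R}.
Hypothesis indep : independent2 P (family_sigma_algebra u)
  (random_set_sigma_algebra (closed_range (fun t w => S t w))).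
Local Notation PP := (P \x P)%E.

(** The number of parts is measurable for the product of the sigma-algebras generated by the range
    and by the sample, not merely for two copies of the whole one; this lets independence separate
    the two arguments. *)
Lemma int_parts_diag (f : R -> R) (M : R) : measurable_fun setT f ->
    (forall z, `|f (parts S u z)| <= M) ->
  \int[P]_w f (parts S u (w, w)) = \int[PP]_z f (parts S u z).
Proof.
move=> mf fM.
pose C w := closed_range (fun t w => S t w) w.
pose F : set (set T) := [set [set w | C w `&` O !=set0] | O in open].
pose G : set (set T) := \bigcup_i g_sigma_algebra_preimage (u i).
have FM : F `<=` measurable.
  by move=> _ [U oU <-]; exact: (measurable_closed_range_meet subS).
have GM : G `<=` measurable.
  move=> A [i _ [B mB <-]]; rewrite setTI -[X in measurable X]setTI.
  exact: measurable_funPT.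
have ind : independent2 P (<<s F >>) (<<s G >>).
  by move=> A B FA GB; rewrite setIC (indep GB FA) muleC.
have mu_ i : measurable_fun setT (u i : g_sigma_algebraType G -> R).
  by move=> _ B mB; apply: sub_sigma_algebra; exists i => //; exists B.
have mC O : open O -> measurable ([set w | C w `&` O !=set0] : set (g_sigma_algebraType F)).
  by move=> oO; apply: sub_sigma_algebra; exists O.
have m := @measurable_number_of_parts R _ _ (g_sigma_algebraType G) (g_sigma_algebraType F)
  n (fun i => u i) C mu_ (fun w => @closed_closed_range _ _ _ P S w) mC.
apply: (@int_diag _ _ _ P F G FM GM (fun z => f (parts S u z)) M) => //.
apply: (measurableT_comp mf).
apply: (measurableT_comp m (g := fun z : g_sigma_algebraType F * g_sigma_algebraType G => (z.2, z.1))).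
by apply: measurable_fun_pair; [exact: measurable_snd|exact: measurable_fst].
Qed.

Lemma measurable_parts_diag : measurable_fun setT (fun w => parts S u (w, w)).
Proof.
apply: (measurableT_comp (measurable_parts subS u) (g := fun w => (w, w))).
by apply: measurable_fun_pair; exact: measurable_id.
Qed.

End coupling_of_parts.

Section root4_limit.
Context {R : realType}.

Lemma ln_nat_near (A : R) : \forall n \near \oo, A <= ln n%:R.
Proof.
near=> n; rewrite -[leLHS]expRK ler_ln ?posrE ?expR_gt0//.
  apply/ltW/(lt_le_trans (truncnS_gt _)); rewrite ler_nat.
  by near: n; exists (Num.truncn (expR A)).+1.
rewrite (lt_le_trans (expR_gt0 A))//.
apply/ltW/(lt_le_trans (truncnS_gt _)); rewrite ler_nat.
by near: n; exists (Num.truncn (expR A)).+1.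
Unshelve. all: by end_near. Qed.

Lemma cvg_root4V : (root4 n : R)^-1 @[n --> \oo] --> (0 : R).
Proof.
apply/cvgrPdist_le => e e0; near=> n.
have L1 : 1 <= ln n%:R :> R by near: n; exact: ln_nat_near.
have Le : e^-1 ^+ 4 <= ln n%:R by near: n; exact: ln_nat_near.
have q1 := root4_ge1 L1.
rewrite sub0r normrN ger0_norm ?invr_ge0 ?(le_trans _ q1)//.
rewrite -[leRHS]invrK lef_pV2 ?posrE ?invr_gt0 ?(lt_le_trans _ q1)//.
rewrite -(@ler_pXn2r _ 4)// ?nnegrE ?invr_ge0 ?(ltW e0) ?(le_trans _ q1)//.
by rewrite -root4E// (le_trans _ L1).
Unshelve. all: by end_near. Qed.

Lemma powR_root4 n : 1 <= ln n%:R :> R -> ln n%:R `^ (3 / 2) = root4 n ^+ 6 :> R.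
Proof.
move=> L1; have L0 : 0 <= ln n%:R :> R by rewrite (le_trans _ L1).
have -> : 3 / 2 = 1 + 2^-1 :> R by field.
rewrite powRD; last by rewrite gt_eqF// (lt_le_trans _ L1).
rewrite powRr1// powR12_sqrt// [in LHS]root4E// (_ : Num.sqrt _ = root4 n ^+ 2).
  by rewrite -exprD.
by rewrite -root4E// /root4 sqr_sqrtr// sqrtr_ge0.
Qed.

End root4_limit.

(** * Gaussian limit of the weighted sum of increments *)

Section gaussian_limit.
Context {R : realType} {d : measure_display} {T : measurableType d}.
Variables (P : probability T R) (S : R -> {RV P >-> R}) (nu : {measure set R -> \bar R}).
Hypothesis subS : is_subordinator S.
Hypothesis driftS : driftfree_with_levy_measure S nu.
Hypothesis cL : condition_L nu.
Hypothesis cR : condition_R nu.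
Local Notation m1 := (moment nu 1).
Local Notation m2 := (moment nu 2).

Let Levy : is_levy_measure nu := driftS.1.
Let m1_gt0 : 0 < m1. Proof. exact: moment1_gt0. Qed.
Let m2_gt0 : 0 < m2. Proof. exact: moment2_gt0. Qed.

Definition spread : R := Num.sqrt (m2 / (3 * m1 ^+ 3)).

Lemma spread_gt0 : 0 < spread.
Proof. by rewrite sqrtr_gt0 divr_gt0// mulr_gt0// exprn_gt0. Qed.

Lemma spread_sqr : spread ^+ 2 = m2 / (3 * m1 ^+ 3).
Proof. by rewrite sqr_sqrtr// divr_ge0 ?mulr_ge0 ?exprn_ge0 ?ltW. Qed.

Let Y := increment S 1.

(** Exchange of summation: increment i enters S_j for i < j < k, that is k - 1 - i times. *)
Lemma sum_centered k w :
  \sum_(j < k) centered S nu j w = \sum_(i < k) (k%:R - 1 - i%:R) * (Y i w - m1).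
Proof.
elim: k => [|k IH]; first by rewrite !big_ord0.
rewrite [RHS]big_ord_recr/= [LHS]big_ord_recr/= IH.
have -> : centered S nu k w = \sum_(i < k) (Y i w - m1).
  rewrite sumrB (sum_increment subS) mulr1 /centered sumr_const card_ord.
  by rewrite mulr_natr.
rewrite -big_split/= -natr1 addrK subrr mul0r addr0.
by apply: eq_bigr => i _; ring.
Qed.

Lemma sum_sqr_rev (k : nat) : \sum_(i < k) (k%:R - 1 - i%:R) ^+ 2 =
  k%:R * (k%:R - 1) * (2 * k%:R - 1) / 6 :> R.
Proof.
elim: k => [|k IH]; first by rewrite big_ord0 !mul0r.
rewrite big_ord_recl/= subr0 -natr1 addrK.
rewrite (eq_bigr (fun i : 'I_k => (k%:R - 1 - i%:R) ^+ 2)).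
  by rewrite IH; field.
by move=> i _; rewrite /bump leq0n add1n -natr1 opprD addrA addrAC.
Qed.

Let a n : R := spread * root4 n ^+ 6.

Definition renewal_fluctuation n w : R := - (\sum_(j < crossing nu n) centered S nu j w) / a n.

(** The crossing time in units of ln n; it tends to 1 / m_1, the rounding costing at most 1 / ln
    n. *)
Let x n : R := (crossing nu n)%:R / root4 n ^+ 4.

Let r n : R := (root4 n)^-1.

Let cvg_r k : r n ^+ k.+1 @[n --> \oo] --> (0 : R).
Proof.
have c : {for (0 : R), continuous (fun y : R => y ^+ k.+1)} by exact: exprn_continuous.
have := cvg_comp _ _ (@cvg_root4V R) c.
by rewrite expr0n.
Qed.

Let cvg_x : x n @[n --> \oo] --> m1^-1.
Proof.
apply: (cvg_dist_le _ (cvg_r 3)); near=> n.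
have L1 : 1 <= ln n%:R :> R by near: n; exact: ln_nat_near.
have L0 : 0 < ln n%:R :> R by rewrite (lt_le_trans _ L1).
rewrite /x /r exprVn -root4E; last exact: ltW.
have -> : (crossing nu n)%:R / ln n%:R - m1^-1 = ((crossing nu n)%:R - ln n%:R / m1) / ln n%:R.
  by field; rewrite !gt_eqF.
have th1 : 0 <= (crossing nu n)%:R - ln n%:R / m1 by rewrite subr_ge0; apply/ltW/truncnS_gt.
have th2 : (crossing nu n)%:R - ln n%:R / m1 <= 1.
  by rewrite lerBlDl /crossing -natr1 lerD2r truncn_le divr_ge0// ltW.
rewrite ger0_norm; last by rewrite divr_ge0// ltW.
by rewrite ler_pdivrMr// mulVf ?gt_eqF.
Unshelve. all: by end_near. Qed.

Let a_gt0 n : 1 <= ln n%:R :> R -> 0 < a n.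
Proof.
move=> L1; rewrite mulr_gt0 ?spread_gt0// exprn_gt0//.
by rewrite (lt_le_trans _ (root4_ge1 L1)).
Qed.

Let mY := measurable_increment S 1.
Let indY := independent_increment subS (@ler01 R).

Let lawY i B : measurable B -> P (Y i @^-1` B) = P (Y 0%N @^-1` B).
Proof.
by move=> mB; rewrite (law_increment subS (@ler01 R) i mB) (law_increment subS (@ler01 R) 0%N mB).
Qed.

Let Y0E w : Y 0%N w - m1 = centered S nu 1 w.
Proof. by rewrite /Y /increment /centered mul0r mulr1 (sub_start subS) subr0 mulr1. Qed.

Let L2Y : L1 P (fun w => (Y 0%N w - m1) ^+ 2).
Proof.
have -> : (fun w => (Y 0%N w - m1) ^+ 2) = (fun w => centered S nu 1 w ^+ 2).
  by apply/funext => w; rewrite Y0E.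
exact: (variance_centered subS driftS cR 1).1.
Qed.

Let meanY : \int[P]_w (Y 0%N w - m1) = 0.
Proof.
under eq_Rintegral do rewrite Y0E /centered.
have [L E] := mean_subordinator subS driftS cR (ler0n R 1).
by rewrite intB//; [rewrite E int_cst; ring|exact: L1_cst].
Qed.

Let varY : \int[P]_w (Y 0%N w - m1) ^+ 2 = m2.
Proof.
under eq_Rintegral do rewrite Y0E.
by rewrite (variance_centered subS driftS cR 1).2 mul1r.
Qed.

Lemma renewal_fluctuation_cos t c :
  \int[P]_w cos (t * renewal_fluctuation n w + c) @[n --> \oo] -->
  expR (- (t ^+ 2 / 2)) * cos c.
Proof.
pose J n := crossing nu n.
pose th n i : R := - (t / a n) * ((J n)%:R - 1 - i%:R).
pose s2 n : R := \sum_(i < J n) th n i ^+ 2.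
(* The bound |t| J / a for all weights, written with x and r so that its limit 0 is read off. *)
pose al n : R := `|t| / spread * x n * r n ^+ 2.
have al0 n : 0 <= al n.
  apply: mulr_ge0; last by rewrite exprn_ge0// invr_ge0 sqrtr_ge0.
  apply: mulr_ge0; first by rewrite divr_ge0// ltW// spread_gt0.
  by rewrite /x divr_ge0// exprn_ge0// sqrtr_ge0.
have calpha : al n @[n --> \oo] --> (0 : R).
  rewrite -[X in _ --> X](mulr0 (`|t| / spread * m1^-1)).
  by apply: cvgM; [apply: cvgM => //; exact: cvg_cst|exact: cvg_r].
have s2E n : 1 <= ln n%:R :> R ->
    s2 n = t ^+ 2 / spread ^+ 2 * (x n * (x n - r n ^+ 4) * (2 * x n - r n ^+ 4) / 6).
  move=> L1; have q0 : root4 n != 0 :> R by rewrite gt_eqF// (lt_le_trans _ (root4_ge1 L1)).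
  rewrite /s2 /th (eq_bigr (fun i : 'I_(J n) => (t / a n) ^+ 2 * ((J n)%:R - 1 - i%:R) ^+ 2)).
    rewrite -mulr_sumr sum_sqr_rev /a /x /r -/(J n).
    by field; rewrite q0 gt_eqF ?spread_gt0.
  by move=> i _; rewrite exprMn sqrrN.
have cs2 : s2 n @[n --> \oo] --> t ^+ 2 / m2.
  (* The powers r^4 are the lower-order terms of the sum of squares. What remains is t^2 / spread^2
     times 1 / (3 m_1^3), and [spread] is normalized so that this is t^2 / m_2. *)
  have -> : t ^+ 2 / m2 = t ^+ 2 / spread ^+ 2 * (m1^-1 * (m1^-1 - 0) * (2 * m1^-1 - 0) / 6).
    by rewrite spread_sqr !subr0; field; rewrite !gt_eqF.
  apply: cvg_trans.
    apply: (near_eq_cvg (f := fun n => t ^+ 2 / spread ^+ 2 *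
      (x n * (x n - r n ^+ 4) * (2 * x n - r n ^+ 4) / 6))).
    near=> n; rewrite s2E//; near: n; exact: ln_nat_near.
  apply: cvgM; first exact: cvg_cst.
  apply: cvgM; last exact: cvg_cst.
  apply: cvgM; first by apply: cvgM => //; apply: cvgB => //; exact: cvg_r.
  by apply: cvgB; [apply: cvgM => //; exact: cvg_cst|exact: cvg_r].
pose err n : R := s2 n * (6 * truncated_variance P Y m1 (al n) + al n ^+ 2 * m2 ^+ 2).
have cerr : err n @[n --> \oo] --> (0 : R).
  rewrite [X in _ --> X](_ : 0 = t ^+ 2 / m2 * (6 * 0 + 0 * m2 ^+ 2)); last by ring.
  apply: cvgM => //; apply: cvgD; apply: cvgM.
  - exact: cvg_cst.
  - exact: (truncated_variance_cvg0 mY L2Y al0 calpha).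
  - by rewrite -[X in _ --> X](mulr0 0); apply: cvgM.
  - exact: cvg_cst.
pose g n : R := expR (- (m2 * s2 n / 2)) * cos c.
have cg : g n @[n --> \oo] --> expR (- (t ^+ 2 / 2)) * cos c.
  apply: cvgM; last exact: cvg_cst.
  apply: (@cvg_comp _ _ _ (fun n => - (m2 * s2 n / 2)) expR _ (nbhs (- (t ^+ 2 / 2)))); last exact: continuous_expR.
  apply: cvgN; apply: cvgM; last exact: cvg_cst.
  have -> : t ^+ 2 = m2 * (t ^+ 2 / m2) by field; rewrite gt_eqF.
  by apply: cvgM => //; exact: cvg_cst.
have lind : \forall n \near \oo,
    `|\int[P]_w cos (t * renewal_fluctuation n w + c) - g n| <= err n.
  near=> n; have L1 : 1 <= ln n%:R :> R by near: n; exact: ln_nat_near.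
  have an := a_gt0 L1.
  have -> : (fun w => cos (t * renewal_fluctuation n w + c)) =
      (fun w => cos (\sum_(i < J n) th n i * (Y i w - m1) + c)).
    apply/funext => w; congr (cos (_ + c)); rewrite /renewal_fluctuation sum_centered -/(J n).
    rewrite [RHS](eq_bigr (fun i : 'I_(J n) => - (t / a n) * (((J n)%:R - 1 - i%:R) * (Y i w - m1)))).
      by rewrite -mulr_sumr; field; rewrite gt_eqF.
    by move=> i _; rewrite mulrA.
  apply: (lindeberg_cos mY indY lawY L2Y meanY varY) => i iJ.
  have q0 : 0 < root4 n :> R by rewrite (lt_le_trans _ (root4_ge1 L1)).
  have -> : al n = `|t| / a n * (J n)%:R.
    rewrite /al /x /r /a -/(J n); field.
    by rewrite !gt_eqF ?spread_gt0.
  rewrite /th normrM normrN normrM normfV (gtr0_norm an).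
  apply: ler_wpM2l; first by rewrite divr_ge0// ltW.
  have iJ1 : i.+1%:R <= (J n)%:R :> R by rewrite ler_nat.
  rewrite -natr1 in iJ1; have i0 : 0 <= i%:R :> R by [].
  by rewrite ger0_norm; lra.
have cv : err n + `|g n - expR (- (t ^+ 2 / 2)) * cos c| @[n --> \oo] --> (0 : R).
  rewrite [X in _ --> X](_ : 0 = 0 + `|expR (- (t ^+ 2 / 2)) * cos c - expR (- (t ^+ 2 / 2)) * cos c|).
    by apply: cvgD => //; apply: cvg_norm; apply: cvgB => //; exact: cvg_cst.
  by rewrite subrr normr0 addr0.
apply: (cvg_dist_le _ cv); near=> n.
rewrite (_ : _ - _ = (\int[P]_w cos (t * renewal_fluctuation n w + c) - g n) +
  (g n - expR (- (t ^+ 2 / 2)) * cos c)); last by rewrite addrA subrK.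
by apply: (le_trans (ler_normD _ _)); rewrite lerD2r; near: n.
Unshelve. all: by end_near. Qed.

End gaussian_limit.

Theorem theorem11 (R : realType) (nu : {measure set R -> \bar R})
    (d : measure_display) (T : measurableType d) (P : probability T R)
    (S : R -> {RV P >-> R}) (u : forall n : nat, 'I_n -> {RV P >-> R})
    (S_subordinator : is_subordinator S)
    (S_driftfree : driftfree_with_levy_measure S nu)
    (nu_density : has_continuous_density nu)
    (nu_L : condition_L nu)
    (nu_R : condition_R nu)
    (u_iid : forall n, iid_uniform (u n))
    (u_indep : forall n, independent2 P (family_sigma_algebra (u n))
       (random_set_sigma_algebra (closed_range (fun t w => S t w)))) :
  exists Z : nat -> {RV P >-> R},
    (forall n w,
      let K := number_of_parts (closed_range (fun t w => S t w) w) (fun i => u n i w) in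
      Z n w = (K%:R - ln n%:R ^+ 2 / (2 * moment nu 1)) /
              (Num.sqrt (moment nu 2 / (3 * moment nu 1 ^+ 3)) *
               ln n%:R `^ (3 / 2))) /\
    weakly_converges (fun n => distribution P (Z n)) (normal_prob 0 1).
Proof.
pose c1 n : R := ln n%:R ^+ 2 / (2 * moment nu 1).
pose a n : R := Num.sqrt (moment nu 2 / (3 * moment nu 1 ^+ 3)) * ln n%:R `^ (3 / 2).
pose normalize n (k : R) := (k - c1 n) / a n.
have mN n : measurable_fun setT (normalize n).
  by apply: measurable_funM => //; exact: measurable_funB.
have mZ n : measurable_fun setT (fun w => normalize n (parts S (u n) (w, w))).
  exact: (measurableT_comp (mN n) (measurable_parts_diag S_subordinator (u n))).
exists (fun n => RV_of P (mZ n)); split=> //.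
have s0 := spread_gt0 S_driftfree nu_L nu_R.
have aE n : 1 <= ln n%:R :> R -> a n = spread nu * root4 n ^+ 6.
  by move=> L1; rewrite /a powR_root4.
have [A A0 HA] := parts_linearization S_subordinator S_driftfree nu_L nu_R u_iid.
have [B B0 HB] := int_norm_sum_centered S_subordinator S_driftfree nu_L nu_R.
pose PP := (P \x P)%E.
pose V n w := renewal_fluctuation S nu n w.
(* An error of order q^5 against a normalization of order q^6 leaves 1 / q, with q the fourth root
   of ln n. *)
have close n : 1 <= ln n%:R :> R ->
    L1 PP (fun z => normalize n (parts S (u n) z) - V n z.1) /\
    \int[PP]_z `|normalize n (parts S (u n) z) - V n z.1| <= A / spread nu * (root4 n)^-1.
  move=> lnge; have [L I] := HA n lnge.
  have q0 : 0 < root4 n :> R by rewrite (lt_le_trans _ (root4_ge1 lnge)).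
  have an : 0 < a n by rewrite aE// mulr_gt0// exprn_gt0.
  have E z : normalize n (parts S (u n) z) - V n z.1 = (a n)^-1 *
      (parts S (u n) z - ln n%:R ^+ 2 / (2 * moment nu 1) +
       \sum_(j < crossing nu n) centered S nu j z.1).
    rewrite /normalize /V /renewal_fluctuation -aE// /c1.
    by rewrite mulNr opprK -mulrDl mulrC.
  split; first by rewrite (funext E); exact: L1Z.
  under eq_Rintegral do rewrite E normrM (ger0_norm (x := (a n)^-1)) ?invr_ge0 ?(ltW an)//.
  rewrite intZ; last exact: L1_norm.
  rewrite ler_pdivrMl//; apply: (le_trans I); rewrite aE//.
  by rewrite le_eqVlt; apply/orP; left; apply/eqP; field; rewrite !gt_eqF.
have cls : \forall n \near \oo, 1 <= ln n%:R :> R by exact: ln_nat_near.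
have cvg_err (c : R) : c * (A / spread nu * (root4 n)^-1) @[n --> \oo] --> (0 : R).
  rewrite [X in _ --> X](_ : 0 = c * (A / spread nu * 0)); last by ring.
  apply: cvgM; first exact: cvg_cst.
  by apply: cvgM; [exact: cvg_cst|exact: cvg_root4V].
have mV n : measurable_fun setT (V n).
  apply: measurable_funM => //; apply: measurable_funN; apply: measurable_sum => j.
  exact: measurable_centered.
have mcos (t c : R) : measurable_fun setT (fun y : R => cos (t * y + c)).
  by apply: continuous_measurable_fun => y; apply: continuous_comp;
    [apply: cvgD; [apply: cvgM; [exact: cvg_cst|exact: cvg_id]|exact: cvg_cst]|exact: continuous_cos].
have cos1 (y : R) : `|cos y| <= 1 by rewrite ler_norml cos_geN1 cos_le1.
have normalize_bounded n z : `|normalize n (parts S (u n) z)| <= (n%:R + `|c1 n|) * `|(a n)^-1|.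
  rewrite normrM ler_wpM2r//; apply: (le_trans (ler_normB _ _)); rewrite lerD2r.
  by have /andP[? ?] := parts_le S (u n) z; rewrite ger0_norm.
have mabs n : measurable_fun setT (fun k => `|normalize n k|) by exact: measurableT_comp.
have labs n : L1 P (fun w => `|normalize n (parts S (u n) (w, w))|).
  apply: (@L1_bounded _ _ _ P _ ((n%:R + `|c1 n|) * `|(a n)^-1|)) => [|w].
    exact: (measurableT_comp (mabs n) (measurable_parts_diag S_subordinator (u n))).
  by rewrite normr_id.
have mnorm : measurable_fun setT (fun y : R => `|y|) by exact: normr_measurable.
apply: (@weak_cvg_of_cos _ _ _ ((A + B) / spread nu)).
(* Tightness: the first absolute moment is bounded by that of the fluctuation, of order q^6 before
   normalization, plus the distance just estimated. *)
- near=> n; have lnge : 1 <= ln n%:R :> R by near: n; exact: cls.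
  have q1 := root4_ge1 lnge; have q0 : 0 < root4 n :> R by rewrite (lt_le_trans _ q1).
  have an : 0 < a n by rewrite aE// mulr_gt0// exprn_gt0.
  split.
    apply: (@integrable_pushforward _ _ _ _ _ (RV_of P (mZ n))) => //.
      exact/measurable_EFinP.
    exact: labs.
  have -> : \int[distribution P (RV_of P (mZ n))]_y `|y| =
      \int[P]_w `|normalize n (parts S (u n) (w, w))|.
    exact: (int_distribution (X := RV_of P (mZ n)) mnorm (labs n)).
  (* Here, and for the cosine transform below, independence of sample and range moves the integral
     to the product space. *)
  rewrite (int_parts_diag S_subordinator (u_indep n) (mabs n)
    (M := (n%:R + `|c1 n|) * `|(a n)^-1|)); last by move=> z; rewrite normr_id.
  have [Lc Ic] := close n lnge.
  have LV : L1 P (V n).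
    rewrite (_ : V n = fun w => - (a n)^-1 * \sum_(j < crossing nu n) centered S nu j w).
      by apply: L1Z; apply: L1_sum => j; exact: (L1_centered S_subordinator S_driftfree nu_R).
    by apply/funext => w; rewrite /V /renewal_fluctuation -aE// mulNr mulNr mulrC.
  have [LVP EV] := L1_fst (L1_norm LV).
  apply: (@le_trans _ _ (\int[PP]_z (`|normalize n (parts S (u n) z) - V n z.1| + `|V n z.1|))).
    apply: le_int.
    - apply: (@L1_bounded _ _ _ _ _ ((n%:R + `|c1 n|) * `|(a n)^-1|)) => [|z].
        exact: (measurableT_comp (mabs n) (measurable_parts S_subordinator (u n))).
      by rewrite normr_id.
    - by apply: L1D => //; exact: L1_norm.
    - by move=> z; rewrite -[X in `|X|](subrK (V n z.1)); exact: ler_normD.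
  rewrite intD//; last exact: L1_norm.
  rewrite EV mulrDl; apply: lerD.
    apply: (le_trans Ic); rewrite ler_piMr ?divr_ge0 ?(ltW s0)//.
    by rewrite invf_le1.
  have -> : (fun w => `|V n w|) = (fun w => (a n)^-1 * `|\sum_(j < crossing nu n) centered S nu j w|).
    apply/funext => w; rewrite /V /renewal_fluctuation -aE// normrM normrN mulrC.
    by rewrite ger0_norm// invr_ge0 ltW.
  rewrite intZ; last first.
    by apply: L1_norm; apply: L1_sum => j; exact: (L1_centered S_subordinator S_driftfree nu_R).
  rewrite ler_pdivrMl//; apply: (le_trans (HB n lnge)); rewrite aE//.
  by rewrite le_eqVlt; apply/orP; left; apply/eqP; field; rewrite !gt_eqF.
- move=> t c; rewrite normal_cos.
  pose l : R := expR (- (t ^+ 2 / 2)) * cos c.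
  (* The cosine is 1-Lipschitz, so replacing the normalized count by the fluctuation costs |t| times
     their L^1 distance; the second term is the distance of the fluctuation's transform from its
     Gaussian limit. *)
  have cv : `|t| * (A / spread nu * (root4 n)^-1) +
      `|\int[P]_w cos (t * V n w + c) - l| @[n --> \oo] --> (0 : R).
    rewrite [X in _ --> X](_ : 0 = 0 + `|l - l|); last by rewrite subrr normr0 addr0.
    apply: cvgD => //; apply: cvg_norm; apply: cvgB; last exact: cvg_cst.
    exact: (renewal_fluctuation_cos S_subordinator S_driftfree nu_L nu_R).
  apply: (cvg_dist_le _ cv); near=> n.
  have lnge : 1 <= ln n%:R :> R by near: n; exact: cls.
  have [Lc Ic] := close n lnge.
  have Lcos (f : T -> R) : measurable_fun setT f -> L1 P (fun w => cos (t * f w + c)).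
    by move=> mf; apply: (@L1_bounded _ _ _ P _ 1) => //; exact: (measurableT_comp (mcos t c) mf).
  have -> : \int[distribution P (RV_of P (mZ n))]_y cos (t * y + c) =
      \int[P]_w cos (t * normalize n (parts S (u n) (w, w)) + c).
    exact: (int_distribution (X := RV_of P (mZ n)) (mcos t c) (Lcos _ (mZ n))).
  have mcosN : measurable_fun setT (fun k => cos (t * normalize n k + c)).
    exact: (measurableT_comp (mcos t c) (mN n)).
  rewrite (int_parts_diag S_subordinator (u_indep n) mcosN (M := 1))//.
  rewrite (_ : _ - _ = (\int[PP]_z cos (t * normalize n (parts S (u n) z) + c)
    - \int[P]_w cos (t * V n w + c)) + (\int[P]_w cos (t * V n w + c) - l)); last by rewrite addrA subrK.
  apply: (le_trans (ler_normD _ _)); rewrite lerD2r.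
  apply: (@le_trans _ _ (`|t| * \int[PP]_z `|normalize n (parts S (u n) z) - V n z.1|)); last first.
    exact: ler_wpM2l.
  have [LVP <-] := L1_fst (Lcos _ (mV n)).
  have LNP : L1 PP (fun z => cos (t * normalize n (parts S (u n) z) + c)).
    apply: (@L1_bounded _ _ _ _ _ 1) => // .
    exact: (measurableT_comp mcosN (measurable_parts S_subordinator (u n))).
  rewrite -intB// -intZ; last exact: L1_norm.
  apply: le_norm_int; [exact: L1B|by apply: L1Z; exact: L1_norm|move=> z].
  by apply: (le_trans (norm_cosB_le _ _)); rewrite opprD addrACA subrr addr0 -mulrBr normrM.
Unshelve. all: by end_near.
Qed.
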